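(* Let $d\in\mathbb{N}$, $\alpha > 0$, $1 < p < \infty$, $0 < q \leq \infty$, and $b > 1/q$. Then $$\mathrm{Lip}^{(\alpha,-b)}_{p,q}(\mathbb{R}^d) \hookrightarrow L_\infty(\mathbb{R}^d) \iff \alpha > d/p,$$ where $L_\infty(\mathbb{R}^d)$ can be replaced by $C(\mathbb{R}^d)$. The corresponding result with $\mathbb{R}^d$ replaced by $\mathbb{T}^d$ also holds true.
   Context: $A\hookrightarrow B$ means $A\subset B$ with continuous inclusion; $1/\infty=0$. $C(\mathbb{R}^d)$ is the space of bounded continuous functions with the supremum norm. Modulus of smoothness: for $\alpha>0$, $h\in\mathbb{R}^d$, $\Delta^\alpha_h f(x)=\sum_{j=0}^\infty(-1)^j\binom{\alpha}{j}f(x+(\alpha-j)h)$, where $\binom{\alpha}{j}=\frac{\alpha(\alpha-1)\cdots(\alpha-j+1)}{j!}$, $\binom{\alpha}{0}=1$, and for $f\in L_p(\mathbb{R}^d)$, $\omega_\alpha(f,t)_p=\sup_{|h|\le t}\|\Delta_h^\alpha f\|_{L_p(\mathbb{R}^d)}$, $t>0$. Logarithmic Lipschitz space: $\mathrm{Lip}^{(\alpha,-b)}_{p,q}(\mathbb{R}^d)$ is the set of $f\in L_p(\mathbb{R}^d)$ with $$\|f\|_{\mathrm{Lip}^{(\alpha,-b)}_{p,q}}=\|f\|_{L_p}+\Big(\int_0^1\big(t^{-\alpha}(1-\log t)^{-b}\omega_\alpha(f,t)_p\big)^q\frac{dt}{t}\Big)^{1/q}<\infty$$ (supremum over $0<t<1$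 if $q=\infty$). The periodic space $\mathrm{Lip}^{(\alpha,-b)}_{p,q}(\mathbb{T}^d)$ is defined by the same formulas with $L_p(\mathbb{R}^d)$ replaced by $L_p(\mathbb{T}^d)$. *)

(* Defs.v *)
From HB Require Import structures.
From mathcomp Require Import all_boot all_order all_algebra.
From mathcomp Require Import all_classical all_reals all_analysis.

Set Implicit Arguments.
Unset Strict Implicit.
Unset Printing Implicit Defensive.
Import Order.TTheory GRing.Theory Num.Theory.
Import numFieldNormedType.Exports.

Local Open Scope classical_set_scope.
Local Open Scope ring_scope.

Section row_measurable.
Context {R : realType} (n : nat).

Definition row_coord (i : 'I_n) (x : 'rV[R]_n) : R := x ord0 i.

Let row_set0 : g_sigma_preimage row_coord set0.
Proof. exact: sigma_algebra0. Qed.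

Let row_setC A : g_sigma_preimage row_coord A -> g_sigma_preimage row_coord (~` A).
Proof. exact: sigma_algebraC. Qed.

Let row_bigcup (F : nat -> set 'rV[R]_n) :
  (forall i, g_sigma_preimage row_coord (F i)) ->
  g_sigma_preimage row_coord (\bigcup_i (F i)).
Proof. exact: sigma_algebra_bigcup. Qed.

(* The Borel sigma-algebra of R^n, presented as the one generated by the
   coordinate maps. *)
HB.instance Definition _ := @isMeasurable.Build default_measure_display
  'rV[R]_n (g_sigma_preimage row_coord) row_set0 row_setC row_bigcup.

End row_measurable.

Section row_measurable_lemmas.
Context {R : realType}.

Lemma measurable_row_coord n (i : 'I_n) :
  measurable_fun [set: 'rV[R]_n] (@row_coord R n i).
Proof.
move=> _ Y mY; rewrite setTI; apply: sub_sigma_algebra => /=.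
rewrite -bigcup_seq/=; exists i => /=; first by rewrite mem_index_enum.
by exists Y => //; rewrite setTI.
Qed.

Lemma measurable_fun_rowP d (T : measurableType d) n (f : T -> 'rV[R]_n) :
  (forall i, measurable_fun [set: T] (row_coord i \o f)) ->
  measurable_fun [set: T] f.
Proof.
move=> mf _ A mA; rewrite setTI.
suff : g_sigma_preimage (@row_coord R n) `<=` [set B | measurable (f @^-1` B)].
  exact.
apply: smallest_sub.
  split=> /=.
  - by rewrite preimage_set0.
  - by move=> B mB; rewrite setTD preimage_setC; exact: measurableC.
  - by move=> F mF; rewrite preimage_bigcup; exact: bigcup_measurable.
move=> B; rewrite -bigcup_seq => -[i _ [C mC <-]] /=; rewrite setTI.
by have := mf i measurableT _ mC; rewrite setTI.
Qed.

Definition row_cons n (x : R * 'rV[R]_n) : 'rV[R]_n.+1 :=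
  row_mx (x.1)%:M x.2.

Definition row_uncons n (v : 'rV[R]_n.+1) : R * 'rV[R]_n :=
  (v ord0 ord0, @rsubmx R 1 1 n v).

Lemma row_consK n : cancel (@row_cons n) (@row_uncons n).
Proof.
case=> t v; rewrite /row_uncons /row_cons /= row_mxKr; congr pair.
by rewrite mxE; case: splitP => // j _; rewrite (ord1 j) mxE eqxx.
Qed.

Lemma measurable_row_cons n : measurable_fun [set: R * 'rV[R]_n] (@row_cons n).
Proof.
apply: measurable_fun_rowP => i; rewrite /row_coord /row_cons /=.
case: (@splitP 1 n i) => j ij.
- rewrite [X in measurable_fun _ X](_ : _ = fst); first exact: measurable_fst.
  apply/funext => x /=; have -> : i = lshift n j by exact: val_inj.
  by rewrite [LHS](row_mxEl (x.1)%:M x.2) (ord1 j) mxE eqxx.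
- rewrite [X in measurable_fun _ X](_ : _ = row_coord j \o snd); last first.
    apply/funext => x /=; have -> : i = rshift 1 j by exact: val_inj.
    by rewrite [LHS](row_mxEr (x.1)%:M x.2).
  by apply: measurableT_comp; [exact: measurable_row_coord|exact: measurable_snd].
Qed.

Lemma measurable_row_uncons n : measurable_fun [set: 'rV[R]_n.+1] (@row_uncons n).
Proof.
apply: measurable_fun_pair; first exact: measurable_row_coord.
apply: measurable_fun_rowP => j.
rewrite [X in measurable_fun _ X](_ : _ = row_coord (rshift 1 j)).
  exact: measurable_row_coord.
by apply/funext => v; rewrite /row_coord /= mxE.
Qed.

End row_measurable_lemmas.

(* Proved by hand: the canonical sigma-finite instance found on m1 \x m2 is the
   one for sub-probabilities. *)
Lemma sigma_finite_product d1 d2 (T1 : measurableType d1)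
    (T2 : measurableType d2) (R : realType)
    (m1 : {sigma_finite_measure set T1 -> \bar R})
    (m2 : {sigma_finite_measure set T2 -> \bar R}) :
  sigma_finite setT (m1 \x m2)%E.
Proof.
have /sigma_finiteP[F [TF ndF Foo]] := sigma_finiteT m1.
have /sigma_finiteP[G [TG ndG Goo]] := sigma_finiteT m2.
exists (fun n => F n `*` G n).
  rewrite -setXTT TF TG predeqE => -[x y]; split.
    move=> [/= [n _ Fnx] [k _ Gky]]; exists (maxn n k) => //; split.
    - by move: x Fnx; exact/subsetPset/ndF/leq_maxl.
    - by move: y Gky; exact/subsetPset/ndG/leq_maxr.
  by move=> [n _ []/= ? ?]; split; exists n.
move=> k; have [? ?] := Foo k; have [? ?] := Goo k.
split; first exact: measurableX.
by rewrite product_measure1E// lte_mul_pinfty// ge0_fin_numE.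
Qed.

Section lebesgue_measure_row.
Context {R : realType}.

Section step.
Variables (n : nat) (mu : {sigma_finite_measure set 'rV[R]_n -> \bar R}).

Definition lebesgue_rowS : set 'rV[R]_n.+1 -> \bar R :=
  pushforward (@lebesgue_measure R \x mu)%E (@row_cons R n).

Let pushS : {measure set 'rV[R]_n.+1 -> \bar R} :=
  measure_function_pushforward__canonical__measure_function_Measure
    (@lebesgue_measure R \x mu)%E (@measurable_row_cons R n).

Let lebesgue_rowS0 : lebesgue_rowS set0 = 0%E.
Proof. exact: (@measure0 _ _ _ pushS). Qed.

Let lebesgue_rowS_ge0 A : (0 <= lebesgue_rowS A)%E.
Proof. exact: (@measure_ge0 _ _ _ pushS). Qed.

Let lebesgue_rowS_sigma_additive : semi_sigma_additive lebesgue_rowS.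
Proof. exact: (@measure_semi_sigma_additive _ _ _ pushS). Qed.

HB.instance Definition _ := isMeasure.Build _ _ _ lebesgue_rowS
  lebesgue_rowS0 lebesgue_rowS_ge0 lebesgue_rowS_sigma_additive.

Let lebesgue_rowS_sigma_finite : sigma_finite setT lebesgue_rowS.
Proof.
have [F FT mF] := sigma_finite_product (@lebesgue_measure R) mu.
exists (fun k => @row_uncons R n @^-1` F k).
  by rewrite -preimage_bigcup -FT preimage_setT.
move=> k; have [mFk Fk] := mF k; split.
  by have := @measurable_row_uncons R n measurableT _ mFk; rewrite setTI.
rewrite /lebesgue_rowS /pushforward -comp_preimage.
by rewrite (_ : _ \o _ = id) //; apply/funext => x; exact: row_consK.
Qed.

HB.instance Definition _ :=
  Measure_isSigmaFinite.Build _ _ _ lebesgue_rowS lebesgue_rowS_sigma_finite.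
End step.

Fixpoint lebesgue_row n : {sigma_finite_measure set 'rV[R]_n -> \bar R} :=
  match n with
  | 0 => \d_(0 : 'rV[R]_0)
  | m.+1 => lebesgue_rowS (lebesgue_row m)
  end.

End lebesgue_measure_row.

Section torus.
Context {R : realType} (n : nat).

Definition torus_cell : set 'rV[R]_n :=
  [set x | forall i, 0 <= x ord0 i < 2 * pi].

Lemma measurable_torus_cell : measurable torus_cell.
Proof.
rewrite (_ : torus_cell =
    \big[setI/setT]_(i < n) (row_coord i @^-1` `[0, 2 * pi[)).
  apply: bigsetI_measurable => i _; rewrite -[X in measurable X]setTI.
  by apply: measurable_row_coord => //; exact: measurable_itv.
rewrite -bigcap_seq; apply/seteqP; split => x /= xP i.
  by move=> _; rewrite /= in_itv /=; exact: xP.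
by have := xP i (mem_index_enum i); rewrite /= in_itv.
Qed.

Definition lebesgue_torus : {measure set 'rV[R]_n -> \bar R} :=
  mrestr (lebesgue_row n) measurable_torus_cell.

(* Functions on T^n, T = R / 2 pi Z. *)
Definition torus_periodic : set ('rV[R]_n -> R) :=
  [set f | forall x i, f (x + (2 * pi) *: delta_mx ord0 i) = f x].

End torus.

Section smoothness.
Context {R : realType} {d : nat}.
Local Notation V := 'rV[R]_d.
Implicit Types (mu : {measure set V -> \bar R}) (f g : V -> R).

(* The normed structure on rows provided by the library is the max norm. *)
Definition enorm (h : V) : R := Num.sqrt (\sum_(i < d) h ord0 i ^+ 2).

Definition gbinom (alpha : R) (j : nat) : R :=
  (\prod_(i < j) (alpha - i%:R)) / j`!%:R.

(* For f in L_p with p >= 1 the series converges absolutely at almost every x,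
   because \sum_j |gbinom alpha j| is finite for alpha > 0. *)
Definition frac_diff (alpha : R) (h : V) f : V -> R := fun x =>
  limn (series (fun j : nat =>
    (-1) ^+ j * gbinom alpha j * f (x + (alpha - j%:R) *: h))).

Definition modulus mu (alpha p : R) f (t : R) : \bar R :=
  ereal_sup [set 'N[mu]_(p%:E)[EFin \o frac_diff alpha h f]
            | h in [set h : V | (enorm h <= t)%R]]%E.

Definition lip_weighted mu (alpha b p : R) f (t : R) : \bar R :=
  ((t `^ (- alpha) * (1 - ln t) `^ (- b))%:E * modulus mu alpha p f t)%E.

Definition lip_seminorm mu (alpha b p : R) (q : \bar R) f : \bar R :=
  match q with
  | r%:E => (\int[lebesgue_measure]_(t in `]0%R, 1%R[)
               (lip_weighted mu alpha b p f t `^ r * (t^-1)%:E)) `^ r^-1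
  | +oo => ereal_sup [set lip_weighted mu alpha b p f t | t in `]0%R, 1%R[]
  | -oo => 0
  end%E.

Definition lip_norm mu (alpha b p : R) (q : \bar R) f : \bar R :=
  ('N[mu]_(p%:E)[EFin \o f] + lip_seminorm mu alpha b p q f)%E.

Definition sup_norm f : \bar R := ereal_sup (range (fun x => `|f x|%:E)).

(* A (quasi-)normed space of functions, given by representatives: two functions
   of the carrier that agree almost everywhere denote the same element. *)
Record fun_space := FunSpace {
  carrier : set (V -> R);
  fnorm : (V -> R) -> \bar R }.

(* X is [set: V -> R] for functions on R^d and [torus_periodic] for functions
   on T^d. *)
Definition Lip_space mu (X : set (V -> R)) (alpha b p : R) (q : \bar R) :=
  FunSpace
    [set f | [/\ X f, f \in Lfun mu p%:E & (lip_norm mu alpha b p q f < +oo)%E]]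
    (lip_norm mu alpha b p q).

Definition Linfty_space mu (X : set (V -> R)) :=
  FunSpace [set f | X f /\ f \in Lfun mu +oo%E]
    (fun f => 'N[mu]_(+oo)[EFin \o f])%E.

Definition C_space (X : set (V -> R)) :=
  FunSpace [set f | [/\ X f, continuous f & (sup_norm f < +oo)%E]] sup_norm.

(* Inclusion of A in B up to equality almost everywhere, and continuity of the
   resulting map for the topologies defined by the (quasi-)norms. *)
Definition embeds mu (A B : fun_space) : Prop :=
  (forall f, carrier A f -> exists2 g, carrier B g & f = g %[ae mu]) /\
  (forall f g, carrier A f -> carrier B g -> f = g %[ae mu] ->
   forall e : R, 0 < e -> exists2 r : R, 0 < r &
   forall f' g', carrier A f' -> carrier B g' -> f' = g' %[ae mu] ->
   (fnorm A (f' \- f)%R < r%:E)%E -> (fnorm B (g' \- g)%R < e%:E)%E).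

End smoothness.

(* Main.v *)
Require Import Defs.
From HB Require Import structures.
From mathcomp Require Import all_boot all_order all_algebra.
From mathcomp Require Import all_classical all_reals all_analysis.
From mathcomp Require Import measurable_realfun ring lra zify.
Set Implicit Arguments.
Unset Strict Implicit.
Unset Printing Implicit Defensive.
Import Order.TTheory GRing.Theory Num.Theory.
Import numFieldNormedType.Exports.
Local Open Scope classical_set_scope.
Local Open Scope ring_scope.

(** The statement is proved once for a measure [mu] and a set [G] of periods
    with the properties collected in [translation_measure]; the whole space has
    no period, the torus has the steps 2 pi along the axes. Write c_j for the
    coefficients [dcoef] of the difference of order alpha; they are summable,
    with tails of order m^(-alpha).

    Necessity. Let alpha <= d/p. The bump max(0, 1 - L^2 sum_l kappa(x_l))^M,
    where kappa is s^2 on the line and 2 (1 - cos s) on the circle, equals 1 at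
    the origin and lives on a set of volume O(L^(-d)), so its L_p norm is
    O(L^(-d/p)), hence O(L^(-alpha)). Its differences of integer order i <= M
    with step t gain a factor (L t)^i ([bump_pointwise]). Cutting the fractional
    difference after about 1/(L t) terms and summing by parts until the order
    is negative ([Lnorm_pdiff_le]) turns this into a modulus of smoothness at
    most K min(t^alpha, L^(-alpha)) ([modulus_bump]). Since b > 1/q, the weight
    (1 - log t)^(-b) makes the Lipschitz norm of the bump tend to 0 as L grows,
    even for alpha = d/p ([lip_norm_small]), whereas its supremum stays 1: the
    inclusion is not continuous at 0.

    Sufficiency. Let d/p < s < alpha. A function f of Lipschitz norm N has
    modulus of smoothness at most C t^s N ([modulus_decay]). At scale 2^(-k)
    truncate the difference after J = 2^k terms and average over steps h in a
    cube of side comparable to 2^(-k): this approximates f(x) by the mean A_k(x)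
    of - sum_(1 <= j <= J) c_j f(x + j h). Only integrals of f enter A_k, so A_k
    is continuous, and Hoelder's inequality on the cube of steps costs a factor
    2^(k d/p). A pointwise identity ([normr_smooth_sum_sub_le]) bounds
    A_k - A_(k+1) by differences of f at the two scales, whose L_p norms are at
    most C 2^(-k s) N; so |A_k - A_(k+1)| <= C 2^(-k (s - d/p)) N everywhere and
    A_k converges uniformly to a bounded continuous g. The integrals of
    |f - A_k| over unit boxes tend to 0, so f = g almost everywhere
    ([continuous_representative]). *)

(** * Lebesgue measure on rows and on the torus *)

Lemma measurable_fun_restrict d (T : measurableType d) (R : realType)
    (D : set T) (F : T -> \bar R) :
  measurable D -> measurable_fun [set: T] F -> measurable_fun [set: T] (F \_ D).
Proof. by move=> mD mF; apply: (measurable_restrictT F mD).1; exact: measurable_funTS. Qed.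

Lemma integral_mrestr d (T : measurableType d) (R : realType)
    (mu : {measure set T -> \bar R}) (D : set T) (mD : measurable D) (F : T -> \bar R) :
  measurable_fun [set: T] F -> (forall x, 0 <= F x)%E ->
  (\int[mrestr mu mD]_x F x = \int[mu]_(x in D) F x)%E.
Proof.
move=> mF F0.
have mDC : measurable (~` D) by exact: measurableC.
rewrite (@ge0_negligible_integral _ _ _ (mrestr mu mD) _ (~` D))//; last first.
  by rewrite /= /mrestr setICl measure0.
rewrite setTD setCK; apply: eq_measure_integral => A mA AD.
by rewrite /= /mrestr setIidl.
Qed.

Section line_measure.
Context {R : realType}.
Local Notation lam := (@lebesgue_measure R).

Let affine (a c : R) : measurableTypeR R -> measurableTypeR R := fun t => a + c * t.

Let measurable_affine (a c : R) : measurable_fun [set: measurableTypeR R] (affine a c).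
Proof. by apply: measurable_funD => //; apply: measurable_funM. Qed.

(** Both sides are measures that agree on half-open intervals. *)
Lemma lebesgue_measure_affine (a c : R) (c0 : 0 < c) (A : set (measurableTypeR R)) :
  measurable A -> (lam A = c%:E * lam ((fun t => (a + c * t)%R) @^-1` A))%E.
Proof.
move=> mA.
pose m1 : {measure set (measurableTypeR R) -> \bar R} :=
   measure_function_pushforward__canonical__measure_function_Measure lam
     (measurable_affine a c).
pose m : {measure set (measurableTypeR R) -> \bar R} := mscale (NngNum (ltW c0)) m1.
suff -> : lam A = m A by [].
apply: lebesgue_measure_unique => // X [[u v]] /= _ <-.
rewrite /m/= /mscale /m1/= /pushforward.
have -> : affine a c @^-1` `]u, v]%classic = `]((u - a) / c), ((v - a) / c)]%classic.
  apply/seteqP; split => t /=; rewrite /affine !in_itv/= ltr_pdivrMr// ler_pdivlMr//.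
    by move=> /andP[? ?]; apply/andP; split; lra.
  by move=> /andP[? ?]; apply/andP; split; lra.
rewrite !lebesgue_measure_itv/= !lte_fin ltr_pM2r ?invr_gt0// ltrD2r.
case: ifPn => uv; last by rewrite mule0.
by rewrite -EFinD -EFinM; congr EFin; field; rewrite gt_eqF.
Qed.

Lemma ge0_integral_affine (a c : R) (c0 : 0 < c) (F : R -> \bar R) :
  measurable_fun [set: R] F -> (forall t, 0 <= F t)%E ->
  (\int[lam]_t F t = c%:E * \int[lam]_t F (a + c * t)%R)%E.
Proof.
move=> mF F0.
pose m1 : {measure set (measurableTypeR R) -> \bar R} :=
   measure_function_pushforward__canonical__measure_function_Measure lam
     (measurable_affine a c).
pose m : {measure set (measurableTypeR R) -> \bar R} := mscale (NngNum (ltW c0)) m1.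
transitivity (\int[m]_t F t)%E.
  by apply: eq_measure_integral => A mA _; exact: lebesgue_measure_affine.
rewrite ge0_integral_mscale//; congr (_ * _)%E.
rewrite /m1/=.
by rewrite ge0_integral_pushforward.
Qed.

Lemma ge0_integral_shift (a : R) (F : R -> \bar R) :
  measurable_fun [set: R] F -> (forall t, 0 <= F t)%E ->
  (\int[lam]_t F (a + t)%R = \int[lam]_t F t)%E.
Proof.
move=> mF F0; rewrite (@ge0_integral_affine a 1 _ F)// mul1e.
by apply: eq_integral => t _; rewrite mul1r.
Qed.

End line_measure.

Section row_measure.
Context {R : realType}.
Local Notation lam := (@lebesgue_measure R).

Lemma ge0_integral_row_cons n (F : 'rV[R]_n.+1 -> \bar R) :
  measurable_fun [set: 'rV[R]_n.+1] F -> (forall x, 0 <= F x)%E ->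
  (\int[lebesgue_row n.+1]_x F x =
   \int[lam]_t \int[lebesgue_row n]_v F (row_cons (t, v)))%E.
Proof.
move=> mF F0 /=.
rewrite (_ : \int[_]_x _ = \int[pushforward (lam \x lebesgue_row n)%E (@row_cons R n)]_x F x)%E//.
rewrite ge0_integral_pushforward//; last exact: measurable_row_cons.
rewrite preimage_setT.
rewrite [RHS](_ : _ = \int[lam]_t fubini_F (lebesgue_row n) (F \o (@row_cons R n)) t)%E//.
rewrite -fubini_tonelli1//; last by move=> x; exact: F0.
by apply: measurableT_comp => //; exact: measurable_row_cons.
Qed.

Lemma measurable_row_affine n (a : 'rV[R]_n) (c : R) :
  measurable_fun setT (fun x : 'rV[R]_n => a + c *: x).
Proof.
apply: measurable_fun_rowP => i.
rewrite [X in measurable_fun _ X](_ : _ = fun x => a ord0 i + c * row_coord i x); last first.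
  by apply/funext => x; rewrite /row_coord /= !mxE.
by apply: measurable_funD => //; apply: measurable_funM => //; exact: measurable_row_coord.
Qed.

Lemma measurable_row_shift n (a : 'rV[R]_n) :
  measurable_fun setT (fun x : 'rV[R]_n => x + a).
Proof.
rewrite [X in measurable_fun _ X](_ : _ = fun x => a + 1 *: x).
  exact: measurable_row_affine.
by apply/funext => x; rewrite scale1r addrC.
Qed.

Lemma row_cons_affine n (a : 'rV[R]_n.+1) (c t : R) (v : 'rV[R]_n) :
  a + c *: row_cons (t, v) =
  row_cons (a ord0 ord0 + c * t, @rsubmx R 1 1 n a + c *: v).
Proof.
apply/rowP => i; rewrite /row_cons /= mxE mxE.
case: (@splitP 1 n i) => j ij.
- have -> : i = lshift n j by exact: val_inj.
  rewrite !(row_mxEl _ _ ord0 j) (ord1 j) !mxE eqxx.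
  by congr (a _ _ + _); exact: val_inj.
- have -> : i = rshift 1 j by exact: val_inj.
  by rewrite !(@row_mxEr _ 1 1 n) !mxE.
Qed.

Lemma row_cons_addr n (a : 'rV[R]_n.+1) (t : R) (v : 'rV[R]_n) :
  row_cons (t, v) + a = row_cons (t + a ord0 ord0, v + @rsubmx R 1 1 n a).
Proof.
by rewrite addrC -[X in _ + X]scale1r row_cons_affine scale1r mul1r addrC [_ + v]addrC.
Qed.

(** Fubini peels off one coordinate at a time, each contributing a factor [c]. *)
Lemma ge0_integral_row_affine n (a : 'rV[R]_n) (c : R) (c0 : 0 < c)
    (F : 'rV[R]_n -> \bar R) :
  measurable_fun [set: 'rV[R]_n] F -> (forall x, 0 <= F x)%E ->
  (\int[lebesgue_row n]_x F x =
   (c ^+ n)%:E * \int[lebesgue_row n]_x F (a + c *: x)%R)%E.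
Proof.
elim: n a F => [|n IH] a F mF F0.
  rewrite expr0 mul1e; apply: eq_integral => x _; congr F.
  by apply/rowP; case.
have mFa : measurable_fun [set: 'rV[R]_n.+1] (fun x => F (a + c *: x)).
  by apply: measurableT_comp => //; exact: measurable_row_affine.
rewrite !ge0_integral_row_cons//.
have mFc : measurable_fun setT (F \o (@row_cons R n)).
  by apply: measurableT_comp => //; exact: measurable_row_cons.
rewrite (ge0_integral_affine (a ord0 ord0) c0); last 2 first.
- exact: (@measurable_fun_fubini_tonelli_F _ _ _ _ _ (lebesgue_row n) _ mFc (fun=> F0 _)).
- by move=> t; exact: integral_ge0.
rewrite exprS EFinM -muleA; congr (_ * _)%E.
rewrite -ge0_integralZl//; last 3 first.
- apply: (@measurable_fun_fubini_tonelli_F _ _ _ _ _ (lebesgue_row n)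
    ((fun x => F (a + c *: x)) \o (@row_cons R n))); last by move=> x; exact: F0.
  by apply: measurableT_comp => //; exact: measurable_row_cons.
- by move=> t _; exact: integral_ge0.
- by rewrite lee_fin exprn_ge0// ltW.
apply: eq_integral => t _.
rewrite (IH (@rsubmx R 1 1 n a))//; last first.
  by apply: (measurableT_comp mFc) => //; exact: measurable_fun_pair.
by congr (_ * _)%E; apply: eq_integral => v _; rewrite row_cons_affine.
Qed.

Lemma ge0_integral_row_shift n (a : 'rV[R]_n) (F : 'rV[R]_n -> \bar R) :
  measurable_fun [set: 'rV[R]_n] F -> (forall x, 0 <= F x)%E ->
  (\int[lebesgue_row n]_x F (x + a)%R = \int[lebesgue_row n]_x F x)%E.
Proof.
move=> mF F0; rewrite (@ge0_integral_row_affine n a 1 _ F)// expr1n mul1e.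
by apply: eq_integral => x _; rewrite scale1r addrC.
Qed.

Definition box n (l u : 'rV[R]_n) : set 'rV[R]_n :=
  [set x | forall i, l ord0 i <= x ord0 i < u ord0 i].

Lemma measurable_box n (l u : 'rV[R]_n) : measurable (box l u).
Proof.
rewrite (_ : box l u =
    \big[setI/setT]_(i < n) (row_coord i @^-1` `[l ord0 i, u ord0 i[)).
  apply: bigsetI_measurable => i _; rewrite -[X in measurable X]setTI.
  by apply: measurable_row_coord => //; exact: measurable_itv.
rewrite -bigcap_seq; apply/seteqP; split => x /= xP i.
  by move=> _; rewrite /= in_itv /=; exact: xP.
by have := xP i (mem_index_enum i); rewrite /= in_itv.
Qed.

Lemma row_cons_box n (l u : 'rV[R]_n.+1) :
  @row_cons R n @^-1` box l u =
  `[l ord0 ord0, u ord0 ord0[%classic `*`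
  box (@rsubmx R 1 1 n l) (@rsubmx R 1 1 n u).
Proof.
apply/seteqP; split=> -[t v]; rewrite /box /= in_itv/=.
  move=> h; split; first by have := h ord0; rewrite /row_cons mxE; case: splitP => // j _; rewrite (ord1 j) mxE eqxx.
  move=> i; have := h (rshift 1 i); rewrite /row_cons /= !mxE.
  case: splitP => // [j ij|j ij]; first by have := ltn_ord j; rewrite -ij.
  suff -> : i = j by [].
  by apply: val_inj; move: ij => /= /eqP; rewrite eqn_add2l => /eqP.
move=> -[h1 h2] i; rewrite /row_cons /= mxE.
case: splitP => j ij.
  rewrite (ord1 j) mxE eqxx mulr1n; suff -> : i = ord0 by [].
  by apply: val_inj; rewrite /= ij (ord1 j).
have := h2 j; rewrite !mxE; suff -> : rshift 1 j = i by [].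
exact: val_inj.
Qed.

Lemma lebesgue_row_box n (l u : 'rV[R]_n) : (forall i, l ord0 i <= u ord0 i) ->
  lebesgue_row n (box l u) = (\prod_(i < n) (u ord0 i - l ord0 i))%:E.
Proof.
elim: n l u => [|n IH] l u lu.
  by rewrite big_ord0 /= diracE mem_set//; case.
rewrite /= /lebesgue_rowS /pushforward row_cons_box.
rewrite product_measure1E//; last exact: measurable_box.
rewrite IH; last by move=> i; rewrite !mxE; exact: lu.
rewrite big_ord_recl EFinM; congr (_ * _)%E.
  rewrite [LHS](lebesgue_measure_itv `[l ord0 ord0, u ord0 ord0[)/= lte_fin.
  case: ltP => //.
  by move=> h; rewrite (@le_anti _ _ (u ord0 ord0) (l ord0 ord0)) ?subrr// h lu.
by congr EFin; apply: eq_bigr => i _; rewrite !mxE; congr (u _ _ - l _ _); exact: val_inj.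
Qed.

Definition cube n (t : R) : set 'rV[R]_n := box 0 (const_mx t).

Lemma lebesgue_row_cube n (t : R) : 0 <= t ->
  lebesgue_row n (@cube n t) = (t ^+ n)%:E.
Proof.
move=> t0; rewrite lebesgue_row_box; last by move=> i; rewrite !mxE.
under eq_bigr do rewrite !mxE subr0.
by rewrite prodr_const card_ord.
Qed.

(** Taking [G] empty gives all functions on R^d, taking the steps 2 pi along the
    axes gives those on T^d: this is what lets both cases be treated at once. *)
Definition invariant_by n (G : set 'rV[R]_n) (T : Type) (F : 'rV[R]_n -> T) : Prop :=
  forall g, G g -> forall x, F (x + g) = F x.

Definition torus_periods n : set 'rV[R]_n :=
  [set (2 * pi) *: delta_mx ord0 i | i in [set: 'I_n]].

Lemma invariant_by_set0 n (T : Type) : [set F | @invariant_by n set0 T F] = [set: 'rV[R]_n -> T].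
Proof. by apply/seteqP; split => // F _ g []. Qed.

Lemma invariant_by_torus n : [set F | @invariant_by n (@torus_periods n) R F] = @torus_periodic R n.
Proof.
apply/seteqP; split => f fP.
  by move=> x i; apply: fP; exists i.
by move=> _ [i _ <-] x; exact: fP.
Qed.

Lemma ge0_integral_itv_shift (h a b : R) (F : R -> \bar R) :
  measurable_fun [set: R] F -> (forall t, 0 <= F t)%E ->
  (\int[lam]_(t in `[a, b[) F (t + h)%R = \int[lam]_(t in `[(a + h)%R, (b + h)%R[) F t)%E.
Proof.
move=> mF F0; rewrite [LHS]integral_mkcond [RHS]integral_mkcond.
rewrite -[RHS](ge0_integral_shift h).
- apply: eq_integral => t _; rewrite !patchE.
  rewrite (_ : (h + t \in `[(a + h)%R, (b + h)%R[%classic) = (t \in `[a, b[%classic)).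
    by case: ifP => // _; rewrite addrC.
  by apply/idP/idP; rewrite !inE /= !in_itv/= => /andP[? ?]; apply/andP; split; lra.
- have mI : measurable (`[(a + h)%R, (b + h)%R[%classic : set (measurableTypeR R)).
    exact: measurable_itv.
  have := @measurable_fun_restrict _ (measurableTypeR R) R _ F mI mF.
  exact.
- by move=> t; apply: erestrict_ge0.
Qed.

(** Up to a multiple of the period the shift is some r in [0, 2 pi), and then the
    piece of the shifted interval that leaves [0, 2 pi) re-enters at its left end. *)
Lemma ge0_integral_circle_shift (h : R) (F : R -> \bar R) :
  measurable_fun [set: R] F -> (forall t, 0 <= F t)%E ->
  (forall t, F (t + 2 * pi)%R = F t) ->
  (\int[lam]_(t in `[0%R, (2 * pi)%R[) F (t + h)%R =
   \int[lam]_(t in `[0%R, (2 * pi)%R[) F t)%E.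
Proof.
set T : R := 2 * pi; have T0 : 0 < T by rewrite mulr_gt0// pi_gt0.
move=> mF F0 FT.
have FTz (z : int) t : F (t + z%:~R * T) = F t.
  have Fn (n : nat) s : F (s + n%:R * T) = F s.
    elim: n s => [|n IH] s; first by rewrite mul0r addr0.
    by rewrite -natr1 mulrDl mul1r addrA FT IH.
  case: z => n; first exact: Fn.
  rewrite -(Fn n.+1 (t + _)) NegzE mulrNz; congr F.
  by rewrite mulNr subrK.
pose r := h - (Num.floor (h / T))%:~R * T.
have /andP[r0 rT] : 0 <= r < T.
  have := floor_itv (h / T); rewrite ler_pdivlMr// ltr_pdivrMr// /r => /andP[h1 h2].
  by move: h2; rewrite intrD mulrDl mul1r => h2; apply/andP; split; lra.
under eq_integral => t _.
  rewrite (_ : t + h = (t + r) + (Num.floor (h / T))%:~R * T); last by rewrite /r; ring.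
  rewrite FTz.
  over.
have split3 a b c : a <= b -> b <= c ->
    (\int[lam]_(t in `[a, c[) F t = \int[lam]_(t in `[a, b[) F t + \int[lam]_(t in `[b, c[) F t)%E.
  move=> ab bc; rewrite -ge0_integral_setU//=.
  - congr (integral _ _ _); apply/seteqP; split => t /=; rewrite !in_itv/=.
      by move=> /andP[? ?]; case: (ltP t b) => ?; [left|right]; apply/andP; split.
    by case=> /andP[? ?]; apply/andP; split; lra.
  - exact/measurable_funTS.
  - apply/disj_setPS => t [/=]; rewrite !in_itv/= => /andP[? ?] /andP[? ?]; lra.
rewrite ge0_integral_itv_shift// add0r.
rewrite (split3 r T (T + r)); [|lra|lra].
rewrite -[X in `[X, T + r[](add0r T) (addrC T r) -ge0_integral_itv_shift//.
under [X in (_ + X)%E]eq_integral do rewrite FT.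
by rewrite addeC -split3//; lra.
Qed.

Lemma torus_cellE n : @torus_cell R n = @cube n (2 * pi).
Proof. by apply/seteqP; split => x xP i; have := xP i; rewrite !mxE. Qed.

Lemma ge0_integral_cube_cons n (t : R) (F : 'rV[R]_n.+1 -> \bar R) :
  measurable_fun [set: 'rV[R]_n.+1] F -> (forall x, 0 <= F x)%E ->
  (\int[lebesgue_row n.+1]_(x in cube t) F x =
   \int[lam]_(s in `[0%R, t[) \int[lebesgue_row n]_(v in cube t) F (row_cons (s, v)))%E.
Proof.
move=> mF F0.
have mC k : measurable (@cube k t) by exact: measurable_box.
rewrite [LHS]integral_mkcond ge0_integral_row_cons//; last 2 first.
- exact: (measurable_fun_restrict (mC n.+1) mF).
- by move=> x; apply: erestrict_ge0.
rewrite [RHS]integral_mkcond; apply: eq_integral => s _.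
rewrite patchE; case: ifPn => hs.
  rewrite [RHS]integral_mkcond; apply: eq_integral => v _.
  rewrite !patchE; congr (if _ then _ else _).
  apply/idP/idP; rewrite !inE /=.
    move=> h; have : (@row_cons R n @^-1` cube t) (s, v) by [].
    by rewrite row_cons_box => -[_ /=] h' i; have := h' i; rewrite !mxE.
  move=> h; suff : (@row_cons R n @^-1` cube t) (s, v) by [].
  rewrite row_cons_box; split => /=; first by move: hs; rewrite inE /= !mxE.
  by move=> i; have := h i; rewrite !mxE.
rewrite integral0_eq// => v _; rewrite patchE; case: ifPn => // h; exfalso.
move/negP: hs; apply; rewrite inE.
have : (@row_cons R n @^-1` cube t) (s, v) by move: h; rewrite inE.
by rewrite row_cons_box => -[/=]; rewrite !mxE.
Qed.

(** By induction on the dimension: translate the last coordinates first, then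
    the remaining one on the circle. *)
Lemma ge0_integral_torus_shift n (h : 'rV[R]_n) (F : 'rV[R]_n -> \bar R) :
  measurable_fun [set: 'rV[R]_n] F -> (forall x, 0 <= F x)%E ->
  invariant_by (@torus_periods n) F ->
  (\int[lebesgue_torus n]_x F (x + h)%R = \int[lebesgue_torus n]_x F x)%E.
Proof.
have mC k t : measurable (@cube k t) by exact: measurable_box.
move=> mF F0 FG.
have mFh : measurable_fun [set: 'rV[R]_n] (fun x => F (x + h)).
  by apply: measurableT_comp => //; exact: measurable_row_shift.
rewrite !integral_mrestr//; rewrite torus_cellE.
elim: n h F mF F0 FG mFh => [|n IH] h F mF F0 FG mFh.
  by apply: eq_integral => x _; congr F; apply/rowP; case.
have mFc : measurable_fun setT (F \o (@row_cons R n)).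
  by apply: measurableT_comp => //; exact: measurable_row_cons.
rewrite !ge0_integral_cube_cons//.
pose G (s : R) := (\int[lebesgue_row n]_(v in cube (2 * pi)) F (row_cons (s, v)))%E.
transitivity (\int[lam]_(s in `[0%R, (2 * pi)%R[) G (s + h ord0 ord0)%R)%E.
  apply: eq_integral => s _; rewrite /G.
  rewrite -(IH (@rsubmx R 1 1 n h) (fun v => F (row_cons (s + h ord0 ord0, v))))//.
  - by apply: eq_integral => v _; rewrite row_cons_addr.
  - by apply: (measurableT_comp mFc) => //; exact: measurable_fun_pair.
  - move=> _ [i _ <-] v; rewrite -[RHS](FG ((2 * pi) *: delta_mx ord0 (rshift 1 i))); last by exists (rshift 1 i).
    rewrite row_cons_addr !mxE /= mulr0 addr0; congr (F (row_cons (_, _ + _))).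
    by apply/rowP => j; rewrite !mxE.
  - apply: (@measurableT_comp _ _ _ _ _ _ (fun v => F (row_cons (s + h ord0 ord0, v)))).
      by apply: (measurableT_comp mFc) => //; exact: measurable_fun_pair.
    exact: measurable_row_shift.
apply: ge0_integral_circle_shift.
- rewrite /G; under eq_fun do rewrite integral_mkcond.
  have mX : measurable ([set: R] `*` @cube n (2 * pi)) by exact: measurableX.
  have Fc0 z : (0 <= ((F \o (@row_cons R n)) \_ ([set: R] `*` @cube n (2 * pi))) z)%E.
    by apply: erestrict_ge0 => w _; exact: F0.
  have := @measurable_fun_fubini_tonelli_F _ _ _ _ _ (lebesgue_row n) _
    (measurable_fun_restrict mX mFc) Fc0.
  rewrite (_ : fubini_F _ _ = fun s => (\int[lebesgue_row n]_x
      ((fun v => F (row_cons (s, v))) \_ (cube (2 * pi))) x)%E).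
    exact.
  apply/funext => s; apply: eq_integral => v _; rewrite !patchE.
  by congr (if _ then _ else _); apply/idP/idP; rewrite !inE//= => -[].
- by move=> s; exact: integral_ge0.
move=> s; apply: eq_integral => v _.
rewrite -[RHS](FG ((2 * pi) *: delta_mx ord0 ord0)); last by exists ord0.
rewrite row_cons_addr !mxE /= mulr1; congr (F (row_cons (_, _))).
by apply/rowP => j; rewrite !mxE /= mulr0 addr0.
Qed.

End row_measure.

(** What the argument needs from Lebesgue measure on R^d or on a fundamental
    cell of T^d. Translation invariance makes the L_p norms of the terms
    f(x - j h) equal; [tm_cube] bounds local integrals by norms; [tm_ac] lets an
    equality be checked for Lebesgue measure on R^d; [tm_dense] says that a
    periodic property true almost everywhere holds arbitrarily close to any
    point, on the upper side of it so that half-open boxes suffice. *)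
Record translation_measure (R : realType) (d : nat)
    (mu : {measure set 'rV[R]_d -> \bar R}) (G : set 'rV[R]_d) : Prop := {
  tm_shift : forall (h : 'rV[R]_d) (F : 'rV[R]_d -> \bar R),
    measurable_fun [set: 'rV[R]_d] F -> (forall x, 0 <= F x)%E ->
    invariant_by G F -> (\int[mu]_x F (x + h)%R = \int[mu]_x F x)%E ;
  tm_cube : forall F : 'rV[R]_d -> \bar R,
    measurable_fun [set: 'rV[R]_d] F -> (forall x, 0 <= F x)%E ->
    (\int[lebesgue_row d]_(x in cube 1) F x <= \int[mu]_x F x)%E ;
  tm_ac : forall P : set 'rV[R]_d, {ae lebesgue_row d, forall x, P x} -> {ae mu, forall x, P x} ;
  tm_dense : forall (P : set 'rV[R]_d) (x : 'rV[R]_d) (e : R), 0 < e ->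
    (forall g, G g -> forall x, P (x + g) <-> P x) -> {ae mu, forall x, P x} ->
    exists2 y, P y & forall i, x ord0 i <= y ord0 i < x ord0 i + e }.

Section euclidean_and_torus_measure.
Context {R : realType}.

Lemma translation_measure_row d : translation_measure (@lebesgue_row R d) set0.
Proof.
split.
- by move=> h F mF F0 _; exact: ge0_integral_row_shift.
- move=> F mF F0; apply: ge0_subset_integral => //; first exact: measurable_box.
- by [].
- move=> P x e e0 _ [N [mN N0 PN]].
  pose B := box x (x + const_mx e).
  apply: contrapT => nP.
  have BN : B `<=` N.
    move=> y By; apply: PN => /= Py; apply: nP; exists y => // i.
    by have := By i; rewrite !mxE.
  have : (lebesgue_row d B <= 0)%E.
    by rewrite -N0; apply: le_measure => //; rewrite inE //; exact: measurable_box.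
  rewrite lebesgue_row_box; last by move=> i; rewrite !mxE lerDl ltW.
  rewrite lee_fin leNgt prodr_gt0// => i _; rewrite !mxE; lra.
Qed.

(** Only [tm_dense] takes work: a whole number of periods moves the given point
    into the cell, where a box small enough to stay in the cell has positive
    measure. *)
Lemma translation_measure_torus d :
  translation_measure (@lebesgue_torus R d) (@torus_periods R d).
Proof.
have pi2 : 1 <= 2 * pi :> R by have := @pi_ge2 R; lra.
split.
- by move=> h F mF F0 FG; exact: ge0_integral_torus_shift.
- move=> F mF F0; rewrite integral_mrestr// torus_cellE.
  apply: ge0_subset_integral => //; try exact: measurable_box.
    exact: measurable_funTS.
  move=> x xP i; have := xP i; rewrite !mxE => /andP[-> /=] h.
  by rewrite (lt_le_trans h).
- move=> P [N [mN N0 PN]]; exists N; split => //.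
  apply/eqP; rewrite eq_le measure_ge0 andbT -N0 /= /mrestr.
  apply: le_measure; rewrite ?inE//; apply: measurableI => //; exact: measurable_torus_cell.
- move=> P x e e0 PG [N [mN N0 PN]].
  pose S (v : 'rV[R]_d) := forall y, P (y + v) <-> P y.
  have SD u v : S u -> S v -> S (u + v).
    by move=> Su Sv y; rewrite addrA; apply: (iff_trans (Sv _)).
  have S0 : S 0 by move=> y; rewrite addr0.
  have SN v : S v -> S (- v).
    by move=> Sv y; apply: iff_sym; rewrite -[X in P X](subrK v); exact: Sv.
  have SZ (z : int) v : S v -> S (z%:~R *: v).
    have Sn (n : nat) : S v -> S (n%:R *: v).
      move=> Sv; elim: n => [|n IH]; first by rewrite scale0r.
      by rewrite -natr1 scalerDl scale1r; exact: SD.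
    case: z => n Sv; first exact: Sn.
    by rewrite NegzE mulrNz scaleNr; apply/SN/Sn.
  pose z i := Num.floor (x ord0 i / (2 * pi)).
  pose w : 'rV[R]_d := \sum_(i < d) (z i)%:~R *: ((2 * pi) *: delta_mx ord0 i).
  have Sw : S w.
    rewrite /w; elim/big_ind : _ => // i _; apply: SZ => y.
    by apply: PG; exists i.
  have wE i : w ord0 i = (z i)%:~R * (2 * pi).
    rewrite /w summxE (bigD1 i)//= big1 ?addr0; last first.
      by move=> j /negbTE ji; rewrite !mxE /= eq_sym ji mulr0 mulr0.
    by rewrite !mxE !eqxx mulr1.
  have xw i : 0 <= x ord0 i - w ord0 i < 2 * pi.
    have := floor_itv (x ord0 i / (2 * pi)).
    rewrite ler_pdivlMr ?ltr_pdivrMr; [|lra|lra].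
    by rewrite wE -/(z i) intrD mulrDl mul1r => /andP[? ?]; apply/andP; split; lra.
  pose u : 'rV[R]_d := \row_i Num.min (x ord0 i - w ord0 i + e) (2 * pi).
  pose B := box (x - w) u.
  apply: contrapT => nP.
  have BN : B `<=` N.
    move=> y By; apply: PN => /= Py; apply: nP; exists (y + w); first exact/Sw.
    move=> i; have := By i; rewrite !mxE lt_min => /andP[? /andP[? _]].
    by apply/andP; split; lra.
  have BC : B `<=` @torus_cell R d.
    move=> y By i; have := By i; rewrite !mxE lt_min => /andP[h /andP[_ ->]].
    by rewrite andbT; have /andP[h' _] := xw i; rewrite (le_trans h').
  have : (lebesgue_row d B <= 0)%E.
    rewrite -N0 /= /mrestr; apply: le_measure; rewrite ?inE.
    - exact: measurable_box.
    - by apply: measurableI => //; exact: measurable_torus_cell.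
    - by move=> y By; split; [exact: BN|exact: BC].
  rewrite lebesgue_row_box.
    rewrite lee_fin leNgt prodr_gt0// => i _; rewrite !mxE subr_gt0 lt_min.
    by have /andP[_ ->] := xw i; rewrite andbT; lra.
  move=> i; rewrite !mxE le_min; have /andP[_ /ltW ->] := xw i; rewrite andbT; lra.
Qed.

End euclidean_and_torus_measure.

(** * The coefficients of the fractional difference *)

Section fractional_coefficients.
Context {R : realType}.
Implicit Types b : R.

Definition dcoef b (j : nat) : R := (-1) ^+ j * gbinom b j.

Lemma dcoef0 b : dcoef b 0 = 1.
Proof. by rewrite /dcoef /gbinom big_ord0 fact0 expr0 divr1 mulr1. Qed.

Lemma dcoefS b j : dcoef b j.+1 = dcoef b j * ((j%:R - b) / j.+1%:R).
Proof.
rewrite /dcoef /gbinom big_ord_recr /= factS natrM exprS.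
have f0 : j`!%:R != 0 :> R by rewrite pnatr_eq0 -lt0n fact_gt0.
have u0 : j.+1%:R != 0 :> R by rewrite pnatr_eq0.
move: f0 u0; move: (j`!%:R) (j.+1%:R) (\prod_(i < j) _) => f u P f0 u0.
by field; rewrite f0 u0.
Qed.

Lemma dcoefS_pred b j : dcoef b j.+1 = - b / j.+1%:R * dcoef (b - 1) j.
Proof.
elim: j => [|j IH]; first by rewrite dcoefS !dcoef0; field.
rewrite dcoefS IH dcoefS; field.
by rewrite !nat1r -!natrD -!natr1 ?pnatr_eq0; apply/andP; split; rewrite gt_eqF// ltr_wpDl.
Qed.

(** Pascal's rule: a difference of order [b] is one of order [b - 1] applied to a
    first difference. *)
Lemma dcoef_pascal b j : dcoef b j.+1 = dcoef (b - 1) j.+1 - dcoef (b - 1) j.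
Proof. by rewrite dcoefS_pred dcoefS; field; rewrite nat1r pnatr_eq0. Qed.

Lemma sum_dcoef b n : \sum_(j < n.+1) dcoef b j = dcoef (b - 1) n.
Proof.
elim: n => [|n IH]; first by rewrite big_ord_recl big_ord0 !dcoef0 addr0.
by rewrite big_ord_recr /= IH dcoef_pascal addrC subrK.
Qed.

Lemma sum_dcoef_nat b m n : (m <= n)%N ->
  \sum_(m.+1 <= j < n.+1) dcoef b j = dcoef (b - 1) n - dcoef (b - 1) m.
Proof.
move=> mn; rewrite -!sum_dcoef -!(big_mkord xpredT (dcoef b)).
by rewrite [X in _ = X - _](@big_cat_nat _ _ _ m.+1)//= addrAC subrr add0r.
Qed.

Lemma powR_expR (a x : R) : 0 < a -> a `^ x = expR (x * ln a).
Proof. by move=> a0; rewrite /powR gt_eqF. Qed.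

Lemma ler_powN (x y a : R) : 0 <= a -> 0 < x -> x <= y -> y `^ (- a) <= x `^ (- a).
Proof.
move=> a0 x0 xy; have y0 := lt_le_trans x0 xy.
rewrite !powRN lef_pV2 ?posrE ?powR_gt0//.
by apply: ge0_ler_powR; rewrite ?nnegrE ?(ltW x0) ?(ltW y0).
Qed.

(** The ratio of consecutive terms is 1 - (b + 1) / (j + 1), so |dcoef b j| times a
    power b + 1 of j, or of j + 1, is eventually nonincreasing, because
    log (1 + x) <= x. *)
Lemma dcoef_decay b : exists2 C, 0 < C &
  forall n, `|dcoef b n| <= C * n.+1%:R `^ (- b - 1).
Proof.
have nonincr_bounded (s : nat -> R) n0 : (forall n, 0 <= s n) ->
    (forall n, (n0 <= n)%N -> s n.+1 <= s n) -> exists2 C, 0 < C & forall n, s n <= C.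
  move=> s0 sS; exists (1 + \sum_(i < n0.+1) s i).
    by rewrite ltr_pwDl// sumr_ge0.
  move=> n; have le_s m : (m <= n0)%N -> s m <= 1 + \sum_(i < n0.+1) s i.
    move=> mn; rewrite -ltnS in mn; rewrite (bigD1 (Ordinal mn))//= addrCA.
    by rewrite lerDl addr_ge0// sumr_ge0.
  case: (leqP n n0) => [/le_s//|/ltnW nn].
  rewrite -(subnK nn); elim: (n - n0)%N => [|k]; first exact: le_s.
  by apply: le_trans; apply: sS; rewrite leq_addl.
(* The sign of [b + 1] decides which of (j + 1)^(b + 1) and j^(b + 1) has to be
   used as the weight for the monotonicity to hold. *)
case: (leP 0 (b + 1)) => hb.
  pose s n := `|dcoef b n| * n.+1%:R `^ (b + 1).
  have s0 n : 0 <= s n by rewrite mulr_ge0// powR_ge0.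
  have step n : ((Num.truncn (b + 1)).+1 <= n)%N -> s n.+1 <= s n.
    move=> hn; have bn : b + 1 <= n.+1%:R.
      rewrite ltW// (lt_le_trans (truncnS_gt _))// ler_nat; exact: leqW.
    have n1 : 0 < n.+1%:R :> R by rewrite ltr0n.
    have n2 : 0 < n.+2%:R :> R by rewrite ltr0n.
    rewrite /s dcoefS normrM -mulrA ler_wpM2l//.
    rewrite ger0_norm; last first.
      by rewrite divr_ge0//; move: bn; rewrite -natr1; lra.
    have -> : (n%:R - b) / n.+1%:R = 1 + - (b + 1) / n.+1%:R.
      by rewrite -[in LHS](addrK 1 n%:R) natr1; field; rewrite nat1r gt_eqF.
    rewrite (le_trans (ler_wpM2r (powR_ge0 _ _) (expR_ge1Dx _)))//.
    rewrite !powR_expR// -expRD ler_expR.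
    suff : ln n.+2%:R <= ln n.+1%:R + n.+1%:R^-1 :> R.
      move: hb; move: (ln n.+2%:R) (ln n.+1%:R) (n.+1%:R^-1) => x y z hb h; nra.
    rewrite -lerBlDl -ln_div// -natr1 mulrDl divff ?gt_eqF// mul1r.
    by apply: le_ln1Dx; rewrite (lt_trans (ltrN10 _))// invr_gt0.
  have [C C0 hC] := nonincr_bounded s _ s0 step.
  exists C => // n; have := hC n; rewrite /s -ler_pdivlMr ?powR_gt0//.
  by rewrite -opprD powRN.
pose s n := `|dcoef b n.+1| * n.+1%:R `^ (b + 1).
have s0 n : 0 <= s n by rewrite mulr_ge0// powR_ge0.
have step n : (0 <= n)%N -> s n.+1 <= s n.
  move=> _; have n1 : 0 < n.+1%:R :> R by rewrite ltr0n.
  have n2 : 0 < n.+2%:R :> R by rewrite ltr0n.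
  rewrite /s dcoefS normrM -mulrA ler_wpM2l//.
  have -> : (n.+1%:R - b) / n.+2%:R = 1 + - (b + 1) / n.+2%:R.
    by rewrite -[in LHS](addrK 1 n.+1%:R) natr1; field; rewrite -!natrD gt_eqF.
  rewrite ger0_norm; last first.
    by rewrite addr_ge0// divr_ge0// oppr_ge0 ltW.
  rewrite (le_trans (ler_wpM2r (powR_ge0 _ _) (expR_ge1Dx _)))//.
  rewrite !powR_expR// -expRD ler_expR.
  suff : ln n.+1%:R <= ln n.+2%:R - n.+2%:R^-1 :> R.
    move=> h; have b1 : 0 <= - (b + 1) by rewrite oppr_ge0 ltW.
    by move: b1 h; move: (ln n.+2%:R) (ln n.+1%:R) (n.+2%:R^-1) => x y z b1 h; nra.
  rewrite -lerBlDl -ln_div//.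
  have -> : n.+1%:R / n.+2%:R = 1 + - n.+2%:R^-1 :> R.
    move: n2; rewrite -[n.+2%:R]natr1; move: (n.+1%:R) => x x0.
    by field; rewrite gt_eqF.
  by apply: le_ln1Dx; rewrite ltrN2 invf_lt1// ltr1n.
have [C C0 hC] := nonincr_bounded s _ s0 step.
exists (Num.max C 1); first by rewrite lt_max C0.
move=> [|n]; first by rewrite dcoef0 normr1 powR1 mulr1 le_max lexx orbT.
have := hC n; rewrite /s -ler_pdivlMr ?powR_gt0// -powRN opprD => /le_trans; apply.
apply: ler_pM; [exact: ltW|exact: powR_ge0|by rewrite le_max lexx|].
by apply: ge0_ler_powR; rewrite ?nnegrE ?ler0n ?ler_nat//; lra.
Qed.

Lemma dcoef_neg_ge0 b n : b < 0 -> 0 <= dcoef b n.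
Proof.
move=> b0; elim: n => [|n IH]; first by rewrite dcoef0.
by rewrite dcoefS mulr_ge0// divr_ge0// subr_ge0 (le_trans (ltW b0)).
Qed.

(** Beyond [b] the coefficients have a constant sign, so the sum of their absolute
    values is, up to sign, a difference of two partial sums, which are the
    coefficients of order [b - 1]. *)
Lemma dcoef_tail b : 0 < b -> exists2 C, 0 < C & forall m n,
  \sum_(m.+1 <= j < n) `|dcoef b j| <= C * m.+1%:R `^ (- b).
Proof.
move=> b0; have [C C0 hC] := dcoef_decay (b - 1).
have {}hC n : `|dcoef (b - 1) n| <= C * n.+1%:R `^ (- b).
  by rewrite (le_trans (hC n))// (_ : - (b - 1) - 1 = - b)//; ring.
pose k := (Num.truncn b).+1; have bk : b < k%:R by exact: truncnS_gt.
have [s s1 sk] : exists2 s : R, `|s| = 1 & forall j, (k <= j)%N -> 0 <= s * dcoef b j.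
  exists (if 0 <= dcoef b k then 1 else -1); first by case: ifP => _; rewrite ?normrN normr1.
  move=> j kj; rewrite -(subnK kj); elim: (j - k)%N => [|i IH].
    rewrite add0n; case: ifPn; first by rewrite mul1r.
    by rewrite -ltNge mulN1r oppr_ge0 => /ltW.
  rewrite addSn dcoefS mulrA mulr_ge0// divr_ge0// subr_ge0 (le_trans (ltW bk))//.
  by rewrite ler_nat leq_addl.
have tail m n : (k <= m)%N ->
    \sum_(m.+1 <= j < n) `|dcoef b j| <= C *+ 2 * m.+1%:R `^ (- b).
  move=> km; have [nm|] := leqP n m.+1.
    by rewrite big_geq// mulr_ge0 ?powR_ge0// mulrn_wge0// ltW.
  case: n => // n; rewrite ltnS => mn.
  rewrite (eq_big_nat _ _ (F2 := fun j => s * dcoef b j)); last first.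
    move=> j /andP[mj _]; rewrite -[RHS]ger0_norm; last by apply: sk; lia.
    by rewrite [RHS]normrM s1 mul1r.
  rewrite -mulr_sumr sum_dcoef_nat; last by lia.
  rewrite (le_trans (ler_norm _))// normrM s1 mul1r.
  rewrite (le_trans (ler_normB _ _))// mulr2n mulrDl lerD//.
  rewrite (le_trans (hC _))// ler_wpM2l ?(ltW C0)//.
  by apply: ler_powN; rewrite ?ltr0n ?ler_nat ?(ltW b0)// ltnS ltnW.
pose B : R := \sum_(j < k.+1) `|dcoef b j|.
have B0 : 0 <= B by apply: sumr_ge0.
have K1 : 1 <= k.+1%:R `^ b by rewrite -[leLHS](powRr0 k.+1%:R) ler_powR ?ler1n ?(ltW b0).
exists ((B + C *+ 2) * k.+1%:R `^ b).
  by rewrite mulr_gt0// ?powR_gt0// ltr_wpDl// mulrn_wgt0.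
move=> m n; case: (leqP k m) => km.
  apply: (le_trans (tail _ _ km)); rewrite ler_wpM2r ?powR_ge0//.
  by move: K1; rewrite mulr2n; move: (k.+1%:R `^ b) => K K1; nra.
have le1 : 1 <= k.+1%:R `^ b * m.+1%:R `^ (- b).
  rewrite powRN -ler_pdivrMr ?invr_gt0 ?powR_gt0// invrK mul1r.
  by apply: ge0_ler_powR; rewrite ?nnegrE ?ler0n ?ler_nat// ?ltW// ltnS ltnW.
apply: (@le_trans _ _ (B + C *+ 2)); last first.
  rewrite -mulrA -[leLHS]mulr1 ler_wpM2l//.
  by rewrite addr_ge0// mulrn_wge0// ltW.
have subB l : (m < l <= k.+1)%N -> \sum_(m.+1 <= j < l) `|dcoef b j| <= B.
  move=> /andP[ml lk]; rewrite /B -(big_mkord xpredT (fun j => `|dcoef b j|)).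
  rewrite [leRHS](@big_cat_nat _ _ _ m.+1) //=; last by lia.
  rewrite [leRHS]addrC [X in _ <= X + _](@big_cat_nat _ _ _ l) //=.
  rewrite -addrA lerDl; apply: addr_ge0; apply: sumr_ge0 => //.
have [nk|kn] := leqP n k.+1.
  have [nm|mn] := leqP n m.+1; first by rewrite big_geq// addr_ge0// mulrn_wge0// ltW.
  by rewrite (le_trans (subB _ _))//; [lia|rewrite lerDl mulrn_wge0// ltW].
rewrite (@big_cat_nat _ _ _ k.+1) //=; [|lia|lia].
apply: lerD; first by apply: subB; lia.
apply: (le_trans (tail _ _ (leqnn k))).
rewrite -[leRHS]mulr1 ler_wpM2l ?mulrn_wge0 ?(ltW C0)//.
rewrite powRN invf_le1 ?powR_gt0//.
Qed.

Lemma dcoef_summable b : 0 < b -> exists2 C, 0 < C & forall n,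
  \sum_(j < n) `|dcoef b j| <= C.
Proof.
move=> b0; have [C C0 hC] := dcoef_tail b0; exists (1 + C); first by rewrite addr_gt0.
move=> [|n]; first by rewrite big_ord0 addr_ge0// ltW.
rewrite big_ord_recl dcoef0 normr1 lerD2l.
have := hC 0%N n.+1; rewrite powR1 mulr1; apply: le_trans.
by rewrite big_add1 /= big_mkord.
Qed.

End fractional_coefficients.

(** * Integrals and the L_p seminorm *)

Section integration_complements.
Context d (T : measurableType d) (R : realType).
Variable mu : {measure set T -> \bar R}.

(** Monotonicity of the integral of nonnegative functions holds without
    measurability, since the integral is a supremum over simple functions below
    the integrand. *)
Lemma ge0_le_integralT (D : set T) (f g : T -> \bar R) :
  (forall x, D x -> 0 <= f x)%E -> (forall x, D x -> f x <= g x)%E ->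
  (\int[mu]_(x in D) f x <= \int[mu]_(x in D) g x)%E.
Proof.
move=> f0 fg; rewrite !ge0_integralE//; last first.
  by move=> x Dx; rewrite (le_trans (f0 x Dx)) ?fg.
apply: ge0_ereal_sup_le || apply: ereal_sup_le => _ [h hf <-].
by exists h => // x; rewrite (le_trans (hf x))// lee_restrict.
Qed.

Lemma measurable_cvgn_set (u : nat -> T -> R) :
  (forall n, measurable_fun [set: T] (u n)) ->
  measurable [set x | cvgn (u ^~ x)].
Proof.
move=> mu_; rewrite (_ : mkset _ = \bigcap_k \bigcup_N \bigcap_(n in [set n | (N <= n)%N])
    [set x | `|u n x - u N x| <= k.+1%:R^-1]); last first.
  apply/seteqP; split => x /=.
    move=> /cauchy_cvgP /cauchy_ballP cu k _.
    have k0 : 0 < k.+1%:R^-1 :> R by rewrite invr_gt0.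
    have [[A B] /= [[NA _ hA] [NB _ hB]] AB] := cu _ k0.
    exists (maxn NA NB) => // n /= hn; rewrite distrC.
    have := AB (u (maxn NA NB) x, u n x); rewrite /ball /= => h; apply/ltW/h; split => /=.
      by apply: hA => /=; exact: leq_maxl.
    by apply: hB => /=; rewrite (leq_trans (leq_maxr _ _) hn).
  move=> h; apply/cauchy_cvgP/cauchy_exP => e e0.
  have [k ke] : exists k : nat, k.+1%:R^-1 < e.
    exists (Num.truncn e^-1); rewrite -[ltRHS]invrK ltf_pV2 ?posrE ?invr_gt0//.
    exact: truncnS_gt.
  have [N _ hN] := h k I.
  exists (u N x); exists N => // n /= Nn; rewrite /ball /= distrC.
  by apply: le_lt_trans ke; exact: hN.
apply: bigcap_measurableType => k _; apply: bigcup_measurable => N _.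
apply: bigcap_measurableType => n _.
rewrite (_ : mkset _ = (fun x => `|u n x - u N x|) @^-1` `]-oo, k.+1%:R^-1]%classic); last first.
  by apply/seteqP; split => x; rewrite /= in_itv.
rewrite -[X in measurable X]setTI.
apply: (measurableT_comp (@normr_measurable _ _)) => //.
by apply: measurable_funB.
Qed.

(** The value of [limn] on divergent sequences is one fixed point, so the limit is
    measurable even where the sequence diverges. *)
Lemma measurable_limn (u : nat -> T -> R) :
  (forall n, measurable_fun [set: T] (u n)) ->
  measurable_fun [set: T] (fun x => limn (u ^~ x)).
Proof.
move=> mu_.
pose C := [set x | cvgn (u ^~ x)].
pose v n x : R := if x \in C then u n x else point.
apply: (@measurable_fun_cvg _ _ _ _ v).
  move=> n; apply: measurable_fun_ifT => //.
  apply: (measurable_fun_bool true) => /=.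
  rewrite setTI (_ : _ @^-1` _ = C); first exact: measurable_cvgn_set.
  by apply/seteqP; split => x /=; [move/set_mem|move/mem_set].
move=> x _; have [xC|] := boolP (x \in C).
  rewrite (_ : v ^~ x = u ^~ x); first by have := set_mem xC.
  by apply/funext => n; rewrite /v xC.
move=> xC; rewrite (_ : v ^~ x = fun=> point); last first.
  by apply/funext => n; rewrite /v (negbTE xC).
move: xC; rewrite notin_setE => ncu.
have -> : limn (u ^~ x) = point.
  by apply: getPN => l hl; apply: ncu; apply/cvg_ex; exists l.
exact: cvg_cst.
Qed.

End integration_complements.

Section Lp_seminorm.
Context d (T : measurableType d) (R : realType).
Variables (mu : {measure set T -> \bar R}) (p : R).
Hypothesis p1 : 1 <= p.
Local Notation L f := ('N[mu]_(p%:E)[EFin \o f%R])%E.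
Let p0 : 0 < p. Proof. exact: lt_le_trans p1. Qed.

Lemma LnormE (f : T -> \bar R) :
  ('N[mu]_(p%:E)[f] = (\int[mu]_x (`|f x| `^ p)) `^ p^-1)%E.
Proof. by rewrite unlock /Lnorm. Qed.

Lemma le_Lnorm (f g : T -> \bar R) : (forall x, `|f x| <= `|g x|)%E ->
  ('N[mu]_(p%:E)[f] <= 'N[mu]_(p%:E)[g])%E.
Proof.
move=> fg; rewrite !LnormE; apply: gt0_ler_poweR.
- by rewrite invr_ge0 ltW.
- by rewrite in_itv /= leey andbT integral_ge0// => x _; exact: poweR_ge0.
- by rewrite in_itv /= leey andbT integral_ge0// => x _; exact: poweR_ge0.
apply: ge0_le_integralT => x _; first exact: poweR_ge0.
by apply: gt0_ler_poweR; rewrite ?in_itv /= ?leey ?andbT// ltW.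
Qed.

Lemma ae_le_Lnorm (f g : T -> \bar R) :
  measurable_fun [set: T] f -> measurable_fun [set: T] g ->
  {ae mu, forall x, `|f x| <= `|g x|}%E ->
  ('N[mu]_(p%:E)[f] <= 'N[mu]_(p%:E)[g])%E.
Proof.
move=> mf mg fg; rewrite !LnormE; apply: gt0_ler_poweR.
- by rewrite invr_ge0 ltW.
- by rewrite in_itv /= leey andbT integral_ge0// => x _; exact: poweR_ge0.
- by rewrite in_itv /= leey andbT integral_ge0// => x _; exact: poweR_ge0.
apply: ae_ge0_le_integral => //.
- by move=> x _; exact: poweR_ge0.
- by apply: (measurableT_comp (measurable_poweR _)) => //; exact: measurableT_comp.
- by move=> x _; exact: poweR_ge0.
- by apply: (measurableT_comp (measurable_poweR _)) => //; exact: measurableT_comp.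
apply: filterS fg => x h _.
by apply: gt0_ler_poweR; rewrite ?in_itv /= ?leey ?andbT// ltW.
Qed.

Lemma LnormZl (c : R) (f : T -> R) : measurable_fun [set: T] f ->
  L (fun x => c * f x) = (`|c|%:E * L f)%E.
Proof.
move=> mf; rewrite !LnormE.
have -> : (\int[mu]_x (`|(EFin \o (fun x0 => (c * f x0)%R)) x| `^ p) =
    \int[mu]_x ((`|c| `^ p)%:E * (`|(EFin \o f) x| `^ p)))%E.
  apply: eq_integral => x _ /=.
  by rewrite normrM powRM// EFinM.
rewrite ge0_integralZl//.
- rewrite poweRM ?lee_fin ?powR_ge0//; last by apply: integral_ge0 => x _; exact: poweR_ge0.
  by rewrite poweR_EFin -powRrM divff ?gt_eqF// powRr1.
- apply: (measurableT_comp (measurable_poweR _)) => //.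
  by apply: measurableT_comp => //; exact/measurable_EFinP.
- by move=> x _; exact: poweR_ge0.
Qed.

Lemma le_Lnorm_sum (I : Type) (r : seq I) (a : I -> R) (F : I -> T -> R) :
  (forall i, measurable_fun [set: T] (F i)) ->
  (L (fun x => \sum_(i <- r) a i * F i x)%R <= \sum_(i <- r) `|a i|%:E * L (F i))%E.
Proof.
move=> mF; elim: r => [|i r IH].
  rewrite (_ : _ \o _ = cst 0%E); last by apply/funext => x /=; rewrite big_nil.
  by rewrite Lnorm0 ?big_nil// eqe gt_eqF.
rewrite big_cons -LnormZl//.
rewrite (_ : _ \o _ = (EFin \o ((fun x => a i * F i x) \+ (fun x => \sum_(i <- r) a i * F i x)))); last first.
  by apply/funext => x /=; rewrite big_cons.
apply: (le_trans (minkowski_EFin _ _ _ _)) => //.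
- exact: measurable_funM.
- by apply: measurable_sum => j; exact: measurable_funM.
- exact: leeD2l.
Qed.

(** Monotone convergence for the integrals of [g n `^ p]. *)
Lemma Lnorm_limn_le (g : nat -> T -> \bar R) (B : \bar R) :
  (forall n, measurable_fun [set: T] (g n)) -> (forall n x, 0 <= g n x)%E ->
  (forall x, {homo g ^~ x : m n / (m <= n)%N >-> (m <= n)%E}) ->
  (0 <= B)%E -> (forall n, 'N[mu]_(p%:E)[g n] <= B)%E ->
  ('N[mu]_(p%:E)[(fun x => limn (g ^~ x))] <= B)%E.
Proof.
move=> mg g0 ndg B0 gB.
have ndgp x : {homo (fun n => g n x `^ p)%E : m n / (m <= n)%N >-> (m <= n)%E}.
  by move=> m n mn; apply: gt0_ler_poweR; rewrite ?in_itv/= ?leey ?andbT ?ndg// ltW.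
pose H x := limn (fun n => g n x `^ p)%E.
have cg x : cvgn (fun n => g n x `^ p)%E by apply: ereal_nondecreasing_is_cvgn; exact: ndgp.
have H0 x : (0 <= H x)%E by apply: lime_ge => //; near=> n; exact: poweR_ge0.
have gH n x : (g n x <= H x `^ p^-1)%E.
  rewrite -[leLHS]poweRe1// -[X in (_ `^ X)%E](divff (x := p)) ?gt_eqF// poweRrM.
  apply: gt0_ler_poweR; rewrite ?in_itv/= ?leey ?andbT ?poweR_ge0// ?invr_ge0 ?(ltW p0)//.
  rewrite /H (cvg_lim _ (ereal_nondecreasing_cvgn (@ndgp x)))//.
  by apply: ereal_sup_ubound; exists n.
have lg x : (0 <= limn (g ^~ x) <= H x `^ p^-1)%E.
  have cgx : cvgn (g ^~ x) by apply: ereal_nondecreasing_is_cvgn; exact: ndg.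
  by apply/andP; split; [apply: lime_ge => //; near=> n|apply: lime_le => //; near=> n].
have HB : (\int[mu]_x H x <= B `^ p)%E.
  rewrite monotone_convergence//.
  - apply: lime_le.
      apply: ereal_nondecreasing_is_cvgn => m n mn; apply: ge0_le_integralT => x _; first exact: poweR_ge0.
      exact: ndgp.
    near=> n; have := gB n; rewrite LnormE => h.
    have {}h := @gt0_ler_poweR _ p (ltW p0) _ _ _ _ h.
    rewrite -poweRrM mulVf ?gt_eqF// poweRe1 in h.
      under eq_integral do rewrite -[g n _]gee0_abs//.
      by apply: h; rewrite ?in_itv/= ?leey ?andbT ?poweR_ge0.
    by apply: integral_ge0 => x _; exact: poweR_ge0.
  - by move=> n; apply: (measurableT_comp (measurable_poweR _)).
  - by move=> n x _; exact: poweR_ge0.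
rewrite LnormE -[leRHS]poweRe1// -[X in (_ <= _ `^ X)%E](divff (x := p)) ?gt_eqF// poweRrM.
apply: gt0_ler_poweR; rewrite ?in_itv/= ?leey ?andbT ?poweR_ge0// ?invr_ge0 ?(ltW p0)//.
  by apply: integral_ge0 => x _; exact: poweR_ge0.
apply: le_trans HB; apply: ge0_le_integralT => x _; first exact: poweR_ge0.
have /andP[l0 lH] := lg x.
rewrite gee0_abs// -[leRHS]poweRe1// -[X in (_ <= _ `^ X)%E](mulVf (x := p)) ?gt_eqF// poweRrM.
by apply: gt0_ler_poweR; rewrite ?in_itv/= ?leey ?andbT ?poweR_ge0// ltW.
Unshelve. all: by end_near. Qed.

Lemma Lnorm_lty_ae (g : T -> \bar R) : measurable_fun [set: T] g ->
  ('N[mu]_(p%:E)[g] < +oo)%E -> {ae mu, forall x, (`|g x| < +oo)%E}.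
Proof.
move=> mg; rewrite LnormE => h.
have {}h : (\int[mu]_x (`|g x| `^ p) < +oo)%E.
  by apply: lty_poweRy h; rewrite invr_eq0 gt_eqF.
have : mu.-integrable [set: T] (fun x => `|g x| `^ p)%E.
  apply/integrableP; split.
    by apply: (measurableT_comp (measurable_poweR _)) => //; exact: measurableT_comp.
  by under eq_integral do rewrite gee0_abs ?poweR_ge0//.
move=> /integrable_ae-/(_ measurableT); apply: filterS => x /(_ I).
rewrite ge0_fin_numE ?poweR_ge0// => hx.
by apply: lty_poweRy hx; rewrite gt_eqF.
Qed.

End Lp_seminorm.

(** * Fractional differences in L_p *)

Section fractional_difference.
Context {R : realType} (d : nat).
Local Notation V := 'rV[R]_d.
Variables (mu : {measure set V -> \bar R}) (G : set V) (p : R).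
Hypotheses (tmu : translation_measure mu G) (p1 : 1 <= p).
Local Notation L f := ('N[mu]_(p%:E)[EFin \o f%R])%E.

Definition periodic_mfun (f : V -> R) :=
  measurable_fun [set: V] f /\ invariant_by G f.

Lemma periodic_mfun_shift f h :
  periodic_mfun f -> periodic_mfun (fun x => f (x + h)).
Proof.
move=> [mf If]; split.
  by apply: measurableT_comp => //; exact: measurable_row_shift.
by move=> g Gg x /=; rewrite addrAC (If g Gg).
Qed.

Lemma periodic_mfunZ (c : R) f : periodic_mfun f -> periodic_mfun (fun x => c * f x).
Proof.
move=> [mf If]; split; first exact: measurable_funM.
by move=> g Gg x; rewrite If.
Qed.

Lemma periodic_mfunB f1 f2 : periodic_mfun f1 -> periodic_mfun f2 ->
  periodic_mfun (fun x => f1 x - f2 x).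
Proof.
move=> [mf If] [mf2 If2]; split; first exact: measurable_funB.
by move=> g Gg x; rewrite If// If2.
Qed.

Lemma periodic_mfun_sum (I : Type) (r : seq I) (F : I -> V -> R) :
  (forall i, periodic_mfun (F i)) -> periodic_mfun (fun x => \sum_(i <- r) F i x).
Proof.
move=> hF; split; first by apply: measurable_sum => i; exact: (hF i).1.
by move=> g Gg x; apply: eq_bigr => i _; exact: (hF i).2.
Qed.

Lemma eLnorm_shift (f : V -> \bar R) h :
  measurable_fun [set: V] f -> invariant_by G f ->
  ('N[mu]_(p%:E)[(fun x => f (x + h)%R)] = 'N[mu]_(p%:E)[f])%E.
Proof.
move=> mf If; rewrite !LnormE; congr (_ `^ _)%E.
apply: (tm_shift tmu h (F := fun x => (`|f x| `^ p)%E)).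
- by apply: (measurableT_comp (measurable_poweR _)) => //; exact: measurableT_comp.
- by move=> x; exact: poweR_ge0.
- by move=> g Gg x; rewrite If.
Qed.

Lemma Lnorm_shift f h : periodic_mfun f -> L (fun x => f (x + h)) = L f.
Proof.
move=> [mf If]; apply: (eLnorm_shift (f := EFin \o f)).
  exact/measurable_EFinP.
by move=> g Gg x /=; rewrite If.
Qed.

(** The truncation of the difference of order [b], based at the upper end of
    the progression: [frac_diff] evaluates it at [x + b *: h]. *)
Definition pdiff (b : R) (h : V) (n : nat) (f : V -> R) : V -> R :=
  fun x => \sum_(j < n) dcoef b j * f (x - j%:R *: h).

Definition fdiff (b : R) (h : V) (f : V -> R) : V -> R :=
  fun x => limn (fun n => pdiff b h n f x).

Lemma frac_diffE b h f : frac_diff b h f = (fun x => fdiff b h f (x + b *: h)).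
Proof.
apply/funext => x; rewrite /frac_diff /fdiff.
rewrite (_ : series _ = (fun n => pdiff b h n f (x + b *: h)))//.
apply/funext => n; rewrite /series /= /pdiff big_mkord; apply: eq_bigr => j _.
by rewrite -addrA -scalerBl.
Qed.

Lemma periodic_mfun_pdiff b h n f : periodic_mfun f -> periodic_mfun (pdiff b h n f).
Proof.
move=> hf; apply: periodic_mfun_sum => j; apply: periodic_mfunZ.
exact: periodic_mfun_shift.
Qed.

Lemma periodic_mfun_fdiff b h f : periodic_mfun f -> periodic_mfun (fdiff b h f).
Proof.
move=> hf; split; first by apply: measurable_limn => n; exact: (periodic_mfun_pdiff b h n hf).1.
move=> g Gg x; rewrite /fdiff.
rewrite (_ : (fun n => pdiff b h n f (x + g)) = (fun n => pdiff b h n f x))//.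
apply/funext => n; exact: (periodic_mfun_pdiff b h n hf).2.
Qed.

Lemma Lnorm_frac_diff b h f : periodic_mfun f -> L (frac_diff b h f) = L (fdiff b h f).
Proof. by move=> hf; rewrite frac_diffE Lnorm_shift//; exact: periodic_mfun_fdiff. Qed.

Lemma Lnorm_sum_shift_le (r : seq nat) (a : nat -> R) h f : periodic_mfun f ->
  (L (fun x => \sum_(j <- r) a j * f (x - j%:R *: h)%R)%R <=
   (\sum_(j <- r) `|a j|)%:E * L f)%E.
Proof.
move=> hf.
apply: (le_trans (@le_Lnorm_sum _ _ _ mu p p1 _ r a (fun j x => f (x - j%:R *: h)) _)).
  by move=> j; exact: (periodic_mfun_shift _ hf).1.
rewrite -sumEFin ge0_sume_distrl; last by move=> i _; rewrite lee_fin.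
by apply: lee_sum => j _; rewrite Lnorm_shift.
Qed.

Lemma limn_dist_le (u : nat -> R) (m : nat) (c M : R) : cvgn u ->
  (forall n, (m <= n)%N -> `|u n - c| <= M) -> `|limn u - c| <= M.
Proof.
move=> cu hM.
have h : `|u n - c| @[n --> \oo] --> `|limn u - c|.
  by apply: cvg_norm; apply: cvgB => //; exact: cvg_cst.
rewrite -(cvg_lim _ h)//; apply: limr_le; first by apply/cvg_ex; eexists; exact: h.
by exists m.
Qed.

(** The function T = sum_(j >= m) |c_j| |f(x - j h)| has L_p norm at most e times
    that of f by monotone convergence; so it is finite almost everywhere, and
    there the series converges and its remainder is at most T. *)
Lemma Lnorm_fdiff_remainder b h f m (e : R) : periodic_mfun f ->
  (L f < +oo)%E -> (forall n, \sum_(m <= j < n) `|dcoef b j| <= e) ->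
  (L (fun x => fdiff b h f x - pdiff b h m f x)%R <= e%:E * L f)%E.
Proof.
move=> hf Lf he.
have e0 : 0 <= e by have := he m; rewrite big_geq.
pose g n x := (\sum_(m <= j < n) `|dcoef b j| * `|f (x - j%:R *: h)|)%:E.
have g0 n x : (0 <= g n x)%E by rewrite lee_fin sumr_ge0// => j _; rewrite mulr_ge0.
have ndg x : {homo g ^~ x : i n / (i <= n)%N >-> (i <= n)%E}.
  move=> i n ni; rewrite lee_fin; apply: (@nondecreasing_series _ (fun j => `|dcoef b j| * `|f (x - j%:R *: h)|) (fun=> true) m) => //.
have hnf : periodic_mfun (fun x => `|f x|).
  split; first by apply: measurableT_comp => //; exact: hf.1.
  by move=> k Gk x; rewrite hf.2.
have mg n : measurable_fun [set: V] (g n).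
  apply/measurable_EFinP; apply: measurable_sum => j; apply: measurable_funM => //.
  exact: (periodic_mfun_shift _ hnf).1.
have Lnf : L (fun x => `|f x|) = L f.
  by apply/eqP; rewrite eq_le !le_Lnorm// => x /=; rewrite normr_id.
pose T x := limn (g ^~ x).
have LT : ('N[mu]_(p%:E)[T] <= e%:E * L f)%E.
  apply: Lnorm_limn_le => //; first by rewrite mule_ge0 ?Lnorm_ge0// lee_fin.
  move=> n; apply: (le_trans (Lnorm_sum_shift_le (index_iota m n) (fun j => `|dcoef b j|) h hnf)).
  rewrite Lnf lee_wpmul2r ?Lnorm_ge0// lee_fin.
  by under eq_bigr do rewrite normr_id; exact: he.
have cg x : g n x @[n --> \oo] --> T x by exact: ereal_nondecreasing_is_cvgn.
have mT : measurable_fun [set: V] T by apply: (emeasurable_fun_cvg g) => // x _; exact: cg.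
have gT n x : (g n x <= T x)%E.
  rewrite /T (cvg_lim _ (ereal_nondecreasing_cvgn (@ndg x)))//.
  by apply: ereal_sup_ubound; exists n.
have T0 x : (0 <= T x)%E by apply: le_trans (gT 0%N x).
have Tfin : {ae mu, forall x, (`|T x| < +oo)%E}.
  apply: (Lnorm_lty_ae p1) => //; apply: (le_lt_trans LT).
  by rewrite lte_mul_pinfty// ?lee_fin.
apply: le_trans LT; apply: ae_le_Lnorm => //.
  apply/measurable_EFinP; apply: measurable_funB.
    exact: (periodic_mfun_fdiff b h hf).1.
  exact: (periodic_mfun_pdiff b h m hf).1.
apply: filterS Tfin => x; rewrite (gee0_abs (T0 x)) => Tx /=.
have TxE : T x = (fine (T x))%:E by rewrite fineK// ge0_fin_numE.
pose u j := dcoef b j * f (x - j%:R *: h).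
have uE n : pdiff b h n f x = series u n by rewrite /series /= big_mkord.
have su : (fun n => pdiff b h n f x) = series u by apply/funext.
have tail n : \sum_(m <= j < n) `|u j| <= fine (T x).
  by have := gT n x; rewrite TxE lee_fin /g; under eq_bigr do rewrite -normrM.
have csu : cvgn (series u).
  apply: normed_cvg; apply: nondecreasing_is_cvgn.
    exact: (@nondecreasing_series _ (fun j => `|u j|) xpredT 0%N).
  exists (\sum_(0 <= j < m) `|u j| + fine (T x)) => _ [n _ <-].
  change (\sum_(0 <= j < n) `|u j| <= \sum_(0 <= j < m) `|u j| + fine (T x)).
  have [mn|nm] := leqP m n.
    by rewrite (@big_cat_nat _ _ _ m)//= lerD2l.
  rewrite [leRHS](_ : _ = \sum_(0 <= j < n) `|u j| + (\sum_(n <= j < m) `|u j| + fine (T x))).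
    by rewrite lerDl addr_ge0 ?sumr_ge0// fine_ge0.
  by rewrite addrA -big_cat_nat//= ltnW.
rewrite TxE lee_fin uE /fdiff su; apply: (limn_dist_le (m := m)) => // n mn.
rewrite /series /= (@big_cat_nat _ _ _ m 0 n)//= addrAC subrr add0r.
exact: (le_trans (ler_norm_sum _ _ _)).
Qed.

Lemma Lnorm_triangle f1 f2 : periodic_mfun f1 -> periodic_mfun f2 ->
  (L f1 <= L (fun x => f1 x - f2 x)%R + L f2)%E.
Proof.
move=> h1 h2.
have -> : EFin \o f1 = EFin \o ((fun x => f1 x - f2 x) \+ f2)%R.
  by apply/funext => x /=; rewrite subrK.
apply: minkowski_EFin => //; last exact: h2.1.
exact: (periodic_mfunB h1 h2).1.
Qed.

Lemma Lnorm_subC f1 f2 : L (fun x => f1 x - f2 x)%R = L (fun x => f2 x - f1 x)%R.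
Proof. by apply/eqP; rewrite eq_le !le_Lnorm// => x /=; rewrite distrC. Qed.

End fractional_difference.

(** * Fractional differences bounded by integer ones *)

Section bound_from_integer_differences.
Context {R : realType} (d : nat).
Local Notation V := 'rV[R]_d.
Variables (mu : {measure set V -> \bar R}) (G : set V) (p : R).
Hypotheses (tmu : translation_measure mu G) (p1 : 1 <= p).
Local Notation L f := ('N[mu]_(p%:E)[EFin \o f%R])%E.

Definition bdiff (h : V) (f : V -> R) : V -> R := fun x => f x - f (x - h).

Lemma periodic_mfun_bdiff h f : periodic_mfun G f -> periodic_mfun G (bdiff h f).
Proof. by move=> hf; apply: periodic_mfunB => //; exact: periodic_mfun_shift. Qed.

(** Summation by parts, by [dcoef_pascal]; the last term is the boundary term left by
    the truncation. *)
Lemma pdiff_bdiff b h n f x :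
  pdiff b h n.+1 f x =
  pdiff (b - 1) h n.+1 (bdiff h f) x + dcoef (b - 1) n * f (x - n.+1%:R *: h).
Proof.
rewrite /pdiff; elim: n => [|n IH].
  by rewrite !big_ord_recl !big_ord0 !dcoef0 /bdiff scale0r subr0 scale1r; ring.
rewrite big_ord_recr [in RHS]big_ord_recr /= IH dcoef_pascal /bdiff.
have -> : x - n.+1%:R *: h - h = x - n.+2%:R *: h.
  by rewrite -[n.+2%:R]natr1 scalerDl scale1r opprD addrA.
by ring.
Qed.

(** Each summation by parts lowers the order by one and leaves a boundary term;
    once the order is negative the coefficients are nonnegative and their sum is
    explicit. *)
Lemma Lnorm_pdiff_le m b h n f (a : nat -> R) : b < m%:R -> periodic_mfun G f ->
  (forall i, (i <= m)%N -> (L (iter i (bdiff h) f) <= (a i)%:E)%E) ->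
  (L (pdiff b h n.+1 f) <=
    (\sum_(i < m.+1) `|dcoef (b - 1 - i%:R) n| * a i)%:E)%E.
Proof.
elim: m b f a => [|m IH] b f a bm hf ha.
  rewrite big_ord_recl big_ord0 addr0 subr0 -sum_dcoef EFinM.
  have := Lnorm_sum_shift_le tmu p1 (index_iota 0 n.+1) (dcoef b) h hf.
  rewrite big_mkord (_ : (fun x => _) = pdiff b h n.+1 f); last first.
    by apply/funext => x; rewrite big_mkord.
  move=> /le_trans; apply.
  rewrite [X in (_ <= X%:E * _)%E]ger0_norm; last first.
    by apply: sumr_ge0 => j _; exact: dcoef_neg_ge0.
  under eq_bigr do rewrite ger0_norm ?dcoef_neg_ge0//.
  apply: lee_wpmul2l; last exact: (ha 0%N).
  by rewrite lee_fin sumr_ge0// => j _; exact: dcoef_neg_ge0.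
rewrite big_ord_recl subr0 addrC EFinD.
pose g x := dcoef (b - 1) n * f (x - n.+1%:R *: h).
have hsh := periodic_mfun_shift (- (n.+1%:R *: h)) hf.
have hg : periodic_mfun G g by exact: periodic_mfunZ.
have -> : EFin \o pdiff b h n.+1 f =
    EFin \o (pdiff (b - 1) h n.+1 (bdiff h f) \+ g)%R.
  by apply/funext => x /=; rewrite pdiff_bdiff.
apply: (le_trans (minkowski_EFin _ _ _ _)) => //.
- exact: (periodic_mfun_pdiff _ _ _ (periodic_mfun_bdiff h hf)).1.
- exact: hg.1.
apply: leeD.
  have := IH (b - 1) (bdiff h f) (fun i => a i.+1).
  move=> /(_ _ (periodic_mfun_bdiff h hf)).
  rewrite -natr1 in bm; rewrite ltrBlDr => /(_ bm) h1.
  apply: (le_trans (h1 _)).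
    by move=> i im; rewrite -iterSr; exact: ha.
  rewrite lee_fin le_eqVlt; apply/orP; left; apply/eqP; apply: eq_bigr => i _.
  by rewrite /= -natr1; congr (`|dcoef _ _| * _); ring.
rewrite /g LnormZl//; last exact: hsh.1.
rewrite (Lnorm_shift p tmu)// EFinM lee_wpmul2l ?lee_fin//.
exact: (ha 0%N).
Qed.

(** The case of the empty truncation in [Lnorm_fdiff_remainder]. *)
Lemma Lnorm_fdiff_le b : 0 < b -> exists2 C, 0 < C & forall h f, periodic_mfun G f ->
  (L f < +oo -> L (fdiff b h f) <= C%:E * L f)%E.
Proof.
move=> b0; have [C C0 hC] := dcoef_summable b0; exists C => // h f hf Lf.
have := Lnorm_fdiff_remainder tmu p1 h hf Lf (m := 0) (b := b) (e := C).
rewrite (_ : (fun x => _) = fdiff b h f); first by apply=> n; rewrite big_mkord.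
by apply/funext => x; rewrite /pdiff big_ord0 subr0.
Qed.

(** Cutting the series at about [1 / eta] terms balances the terms of
    [Lnorm_pdiff_le] against the remainder. *)
Lemma Lnorm_fdiff_powR m b : 0 < b < m%:R -> exists2 C, 0 < C &
  forall h f (A eta : R), periodic_mfun G f -> 0 <= A -> 0 < eta <= 1 ->
  (forall i, (i <= m)%N -> (L (iter i (bdiff h) f) <= (A * eta ^+ i)%:E)%E) ->
  (L (fdiff b h f) <= (C * A * eta `^ b)%:E)%E.
Proof.
move=> /andP[b0 bm].
have [C1 C10 hC1] := dcoef_tail b0.
have /choice[D hD] : forall i : nat, exists D, 0 < D /\ forall n,
    `|dcoef (b - 1 - i%:R) n| <= D * n.+1%:R `^ (i%:R - b).
  move=> i; have [D D0 hD] := dcoef_decay (b - 1 - i%:R).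
  exists D; split => // n; rewrite (le_trans (hD n))//.
  by rewrite (_ : - (b - 1 - i%:R) - 1 = i%:R - b)//; ring.
pose S := \sum_(i < m.+1) D i * 2 ^+ i.
have S0 : 0 <= S by apply: sumr_ge0 => i _; rewrite mulr_ge0 ?exprn_ge0// ltW// (hD i).1.
exists (S + C1); first by rewrite ltr_wpDl.
move=> h f A eta hf A0 /andP[eta0 eta1] hA.
pose n := Num.truncn eta^-1.
have ie1 : 1 <= eta^-1 by rewrite invf_ge1.
have n1 : eta^-1 < n.+1%:R by exact: truncnS_gt.
have n2 : n.+1%:R <= 2 / eta.
  have : n%:R <= eta^-1 by rewrite /n truncn_le// ltW// invr_gt0.
  by rewrite -natr1; lra.
have npos : 0 < n.+1%:R :> R by rewrite ltr0n.
have nb : n.+1%:R `^ (- b) <= eta `^ b.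
  rewrite -[in leRHS](invrK eta) -[in leRHS]powR_inv1 ?invr_ge0 ?(ltW eta0)//.
  rewrite -powRrM mulN1r; apply: ler_powN; rewrite ?invr_gt0 ?(ltW b0) ?(ltW n1)//.
have Lf : (L f < +oo)%E by apply: (le_lt_trans (hA 0%N _)); rewrite ?ltry.
have := Lnorm_triangle mu p1 (periodic_mfun_fdiff b h hf) (periodic_mfun_pdiff b h n.+1 hf).
move=> /le_trans; apply.
rewrite (_ : (_ * A * _) = (C1 * eta `^ b) * A + S * A * eta `^ b); last by ring.
rewrite EFinD; apply: leeD.
  apply: (@le_trans _ _ ((C1 * n.+1%:R `^ (- b))%:E * L f)%E).
    exact: (Lnorm_fdiff_remainder tmu p1 h hf Lf).
  rewrite [leRHS]EFinM; apply: lee_pmul.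
  - by rewrite lee_fin mulr_ge0 ?powR_ge0// ltW.
  - exact: Lnorm_ge0.
  - by rewrite lee_fin ler_wpM2l// ltW.
  - by have := hA 0%N (leq0n _); rewrite expr0 mulr1.
apply: (le_trans (Lnorm_pdiff_le n bm hf hA)).
rewrite lee_fin /S !mulr_suml; apply: ler_sum => i _.
rewrite mulrA mulrAC -[leRHS]mulrA [A * _]mulrC [leRHS]mulrA ler_wpM2r//.
have [Di hDi] := hD i.
rewrite (le_trans (ler_wpM2r (exprn_ge0 _ (ltW eta0)) (hDi n)))//.
rewrite -!mulrA ler_wpM2l ?(ltW Di)// powRD ?(gt_eqF npos) ?implybT//.
rewrite mulrAC powR_mulrn ?ler0n// -exprMn ler_pM ?exprn_ge0 ?mulr_ge0 ?powR_ge0 ?(ltW eta0)//.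
by apply: lerXn2r; rewrite ?nnegrE ?mulr_ge0 ?(ltW eta0)// -ler_pdivlMr.
Qed.

End bound_from_integer_differences.

Section finite_differences_of_sequences.
Context {R : realType}.
Implicit Types (a b : nat -> R).

Definition sdiff a : nat -> R := fun j => a j - a j.+1.

Lemma iterS_sdiff k a j :
  iter k.+1 sdiff a j = iter k sdiff a j - iter k sdiff a j.+1.
Proof. by []. Qed.

Lemma iter_sdiffD k a b j :
  iter k sdiff (fun j => a j + b j) j = iter k sdiff a j + iter k sdiff b j.
Proof.
by elim: k j => [//|k IH] j; rewrite !iterS_sdiff !IH; ring.
Qed.

Lemma iter_sdiffZ k (c : R) a j :
  iter k sdiff (fun j => c * a j) j = c * iter k sdiff a j.
Proof. by elim: k j => [//|k IH] j; rewrite !iterS_sdiff !IH -mulrBr. Qed.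

Lemma iter_sdiff_sum k (I : finType) (F : I -> nat -> R) j :
  iter k sdiff (fun j => \sum_i F i j) j = \sum_i iter k sdiff (F i) j.
Proof.
elim: k j => [//|k IH] j; rewrite iterS_sdiff !IH -sumrB.
by apply: eq_bigr.
Qed.

Lemma iter_sdiff_cst k (c : R) j : iter k.+1 sdiff (fun=> c) j = 0.
Proof. by elim: k j => [|k IH] j; rewrite iterS_sdiff ?IH subrr. Qed.

Lemma iter_sdiff_shift k a i j : iter k sdiff (fun j => a (i + j)%N) j = iter k sdiff a (i + j).
Proof.
elim: k j => [//|k IH] j.
by rewrite [LHS]iterS_sdiff [RHS]iterS_sdiff -addnS; congr (_ - _); exact: IH.
Qed.

Lemma eq_iter_sdiff k a b j : (forall i, (j <= i <= j + k)%N -> a i = b i) ->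
  iter k sdiff a j = iter k sdiff b j.
Proof.
elim: k j => [|k IH] j ab; first by apply: ab; rewrite addn0 leqnn.
by rewrite !iterS_sdiff !IH// => i hi; apply: ab; lia.
Qed.

Lemma normr_iter_sdiff k a j (M : R) : (forall i, (j <= i <= j + k)%N -> `|a i| <= M) ->
  `|iter k sdiff a j| <= 2 ^+ k * M.
Proof.
elim: k j => [|k IH] j aM; first by rewrite expr0 mul1r; apply: aM; rewrite addn0 leqnn.
rewrite iterS_sdiff (le_trans (ler_normB _ _))// exprS -mulrA mulr2n mulrDl !mul1r lerD// IH//.
- by move=> i hi; apply: aM; lia.
- by move=> i hi; apply: aM; lia.
Qed.

(** The discrete form of derivatives of order i <= n bounded by A eta^i; the
    condition [i + j <= n] keeps it to the values of the sequence up to [n]. *)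
Definition sbounded (eta : R) (n : nat) (A : R) a :=
  forall i j, (i + j <= n)%N -> `|iter i sdiff a j| <= A * eta ^+ i.

(** Leibniz' rule: the difference of a product is [sdiff a j * b j + a j.+1 * sdiff b j]. *)
Lemma sboundedM eta n A B a b : 0 <= eta -> 0 <= A -> 0 <= B ->
  sbounded eta n A a -> sbounded eta n B b ->
  sbounded eta n (2 ^+ n * A * B) (fun j => a j * b j).
Proof.
move=> eta0.
have key i : forall n A B a b j, 0 <= A -> 0 <= B -> (i + j <= n)%N ->
    sbounded eta n A a -> sbounded eta n B b ->
    `|iter i sdiff (fun j => a j * b j) j| <= 2 ^+ i * A * B * eta ^+ i.
  elim: i => [|i IH] {}n {}A {}B {}a {}b j A0 B0 ijn Sa Sb.
    rewrite /= !expr0 mulr1 mul1r normrM ler_pM//.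
      by have := Sa 0%N j ijn; rewrite expr0 mulr1.
    by have := Sb 0%N j ijn; rewrite expr0 mulr1.
  rewrite iterSr.
  rewrite (eq_iter_sdiff (b := fun j => sdiff a j * b j + a (1 + j)%N * sdiff b j)); last first.
    by move=> l _; rewrite /sdiff add1n; ring.
  rewrite iter_sdiffD (le_trans (ler_normD _ _))//.
  have Ssd (c : nat -> R) C : sbounded eta n C c -> sbounded eta n.-1 (C * eta) (sdiff c).
    move=> Sc k l kl; rewrite -iterSr; apply: (le_trans (Sc _ _ _)); first by lia.
    by rewrite exprS mulrA.
  have Ssh (c : nat -> R) C : sbounded eta n C c -> sbounded eta n.-1 C (fun j => c (1 + j)%N).
    by move=> Sc k l kl; rewrite iter_sdiff_shift; apply: Sc; lia.
  have Sl (c : nat -> R) C : sbounded eta n C c -> sbounded eta n.-1 C c.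
    by move=> Sc k l kl; apply: Sc; lia.
  have h1 := IH n.-1 (A * eta) B (sdiff a) b j (mulr_ge0 A0 eta0) B0 _ (Ssd _ _ Sa) (Sl _ _ Sb).
  have h2 := IH n.-1 A (B * eta) (fun j => a (1 + j)%N) (sdiff b) j A0 (mulr_ge0 B0 eta0) _ (Ssh _ _ Sa) (Ssd _ _ Sb).
  rewrite (le_trans (lerD (h1 _) (h2 _)))//; [lia|lia|].
  by rewrite le_eqVlt; apply/orP; left; apply/eqP; rewrite !exprS; ring.
move=> A0 B0 Sa Sb i j ijn.
rewrite (le_trans (key i n A B a b j A0 B0 ijn Sa Sb))//.
rewrite ler_wpM2r ?exprn_ge0// ler_wpM2r// ler_wpM2r//.
by rewrite ler_eXn2l ?ltr1n//; lia.
Qed.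

Lemma sboundedX eta n A a M : 0 <= eta -> 0 <= A -> sbounded eta n A a ->
  sbounded eta n ((2 ^+ n * A) ^+ M) (fun j => a j ^+ M).
Proof.
move=> eta0 A0 Sa; elim: M => [|M IH].
  move=> [|i] j ij; first by rewrite /= !expr0 normr1 mulr1.
  rewrite (eq_iter_sdiff (b := fun=> 1)); last by move=> l _; rewrite expr0.
  by rewrite iter_sdiff_cst normr0 mulr_ge0// ?exprn_ge0.
rewrite (_ : (fun j => _) = (fun j => a j * a j ^+ M)); last by apply/funext => j; rewrite exprS.
rewrite exprS; apply: sboundedM => //.
by rewrite exprn_ge0// mulr_ge0// exprn_ge0.
Qed.

End finite_differences_of_sequences.

(** * A bump and its integer differences *)

Section bump.
Context {R : realType} (d : nat) (kappa : R -> R).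
Local Notation V := 'rV[R]_d.

(** Properties of [kappa] that make [bump] smooth: it behaves like the square
    of the distance to the set of its zeros. *)
Record square_like : Prop := {
  sq_ge0 : forall s, 0 <= kappa s ;
  sq0 : kappa 0 = 0 ;
  sq_continuous : continuous kappa ;
  sq_diff : forall s h e : R, 0 <= e -> kappa s <= e ^+ 2 ->
    `|kappa s - kappa (s - h)| <= 2 * `|h| * e + h ^+ 2 ;
  sq_iter_diff : forall k (s h : R), (2 <= k)%N ->
    `|iter k sdiff (fun j => kappa (s - j%:R * h)) 0%N| <= 2 * `|h| ^+ k }.

Hypothesis sq : square_like.

Definition bump_base (lambda : R) (x : V) : R :=
  1 - lambda ^+ 2 * \sum_(l < d) kappa (x ord0 l).

Definition bump_support (lambda : R) (x : V) : R := (0 < bump_base lambda x)%R%:R.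

Definition bump (lambda : R) (M : nat) (x : V) : R :=
  Num.max 0 (bump_base lambda x) ^+ M.

Lemma iter_bdiffE k h (f : V -> R) x i :
  iter k (bdiff h) f (x - i%:R *: h) = iter k sdiff (fun j => f (x - j%:R *: h)) i.
Proof.
elim: k i => [//|k IH] i; rewrite iterS_sdiff -!IH /= {1}/bdiff.
by rewrite -[i.+1%:R]natr1 scalerDl scale1r opprD addrA.
Qed.

Lemma bump_base_le1 lambda x : bump_base lambda x <= 1.
Proof.
rewrite /bump_base gerBl mulr_ge0 ?sqr_ge0// sumr_ge0// => l _.
exact: sq_ge0.
Qed.

Lemma dist_pospart_le (a b : R) : `|Num.max 0 a - Num.max 0 b| <= `|a - b|.
Proof.
have := ler_norm (a - b); have := ler_norm (b - a).
rewrite distrC; move: `|a - b| => n h1 h2; rewrite ler_norml.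
by case: (leP 0 a) => ?; case: (leP 0 b) => ?; apply/andP; split; lra.
Qed.

(** Where the base is positive each [kappa (x l)] is at most [lambda ^- 2], and
    [sq_diff] applies with [e = lambda^-1]. *)
Lemma bump_base_step (lambda t : R) (x h : V) : 1 <= lambda -> 0 <= t -> lambda * t <= 1 ->
  (forall l, `|h ord0 l| <= t) -> 0 < bump_base lambda x ->
  `|bump_base lambda x - bump_base lambda (x - h)| <= 3 * d%:R * (lambda * t).
Proof.
move=> l1 t0 lt1 ht s0.
have l0 : 0 < lambda by exact: lt_le_trans l1.
have kl l : kappa (x ord0 l) <= (lambda^-1) ^+ 2.
  have : kappa (x ord0 l) <= \sum_(i < d) kappa (x ord0 i).
    by rewrite (bigD1 l)//= lerDl sumr_ge0// => i _; exact: sq_ge0.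
  move=> /le_trans; apply; move: s0; rewrite /bump_base subr_gt0 => h1.
  rewrite exprVn -[leRHS]mul1r ler_pdivlMr ?exprn_gt0// mulrC; exact: ltW.
rewrite /bump_base (_ : 1 - _ - _ = lambda ^+ 2 *
    (\sum_(l < d) kappa ((x - h) ord0 l) - \sum_(l < d) kappa (x ord0 l))); last by ring.
rewrite -sumrB.
rewrite normrM ger0_norm ?sqr_ge0//.
apply: (@le_trans _ _ (lambda ^+ 2 * \sum_(i < d) (2 * t * lambda^-1 + t ^+ 2))).
  rewrite ler_wpM2l ?sqr_ge0// (le_trans (ler_norm_sum _ _ _))// ler_sum// => i _.
  rewrite mxE [X in kappa (_ + X)]mxE distrC.
  apply: (le_trans (sq_diff sq (h ord0 i) _ (kl i))); first by rewrite invr_ge0 ltW.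
  rewrite lerD//.
    by rewrite ler_wpM2r ?invr_ge0 ?(ltW l0)// ler_wpM2l.
  by rewrite -real_normK ?num_real// lerXn2r// nnegrE.
rewrite [X in _ * X](_ : _ = d%:R * (2 * t * lambda^-1 + t ^+ 2)); last first.
  by rewrite sumr_const card_ord [RHS]mulr_natl.
rewrite (_ : _ * (d%:R * _) = d%:R * (lambda ^+ 2 * (2 * t * lambda^-1 + t ^+ 2))); last by ring.
rewrite (_ : 3 * _ * _ = d%:R * (3 * (lambda * t))); last by ring.
rewrite ler_wpM2l// mulrDr (_ : lambda ^+ 2 * (2 * t / lambda) = 2 * (lambda * t)); last by field; rewrite gt_eqF.
rewrite -exprMn; set e := lambda * t.
have e0 : 0 <= e by rewrite mulr_ge0// ltW.
have : e ^+ 2 <= e by rewrite expr2 -[leRHS]mulr1 ler_wpM2l.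
by lra.
Qed.

(** If the positive part vanishes at one of the points, then being Lipschitz it is
    at most [e * M] at all of them, and its [M]-th power is already as small as
    the differences should be; no smoothness is needed there. *)
Lemma edge_sdiff (s : nat -> R) (e : R) M k j1 : 0 <= e -> (k <= M)%N ->
  (forall j, `|Num.max 0 (s j) - Num.max 0 (s j.+1)| <= e) ->
  (j1 <= k)%N -> s j1 <= 0 ->
  `|iter k sdiff (fun j => Num.max 0 (s j) ^+ M) 0| <= 2 ^+ k * (e * M%:R) ^+ M.
Proof.
move=> e0 kM lip j1k sj1; pose rho j := Num.max 0 (s j).
have rho0 j : 0 <= rho j by rewrite le_max lexx.
have lip2 i j : `|rho i - rho (i + j)%N| <= e * j%:R.
  elim: j => [|j IH]; first by rewrite addn0 subrr normr0 mulr0.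
  rewrite addnS -natr1 mulrDr mulr1.
  rewrite (_ : rho i - _ = (rho i - rho (i + j)%N) + (rho (i + j)%N - rho (i + j).+1)); last by ring.
  by apply: (le_trans (ler_normD _ _)); apply: lerD => //; exact: lip.
have r1 : rho j1 = 0 by apply/max_idPl.
have rhoj j : (j <= k)%N -> rho j <= e * M%:R.
  move=> jk; have [ij|ij] := leqP j j1.
    have := lip2 j (j1 - j)%N; rewrite subnKC// r1 subr0 ger0_norm// => /le_trans; apply.
    by rewrite ler_wpM2l// ler_nat (leq_trans (leq_subr _ _))// (leq_trans j1k).
  have := lip2 j1 (j - j1)%N; rewrite subnKC ?(ltnW ij)// r1 sub0r normrN ger0_norm// => /le_trans; apply.
  by rewrite ler_wpM2l// ler_nat (leq_trans (leq_subr _ _))// (leq_trans jk).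
apply: normr_iter_sdiff => i /andP[_ ik]; rewrite -/(rho i).
rewrite ger0_norm ?exprn_ge0// lerXn2r// ?nnegrE ?rho0//; last exact: rhoj.
by rewrite mulr_ge0.
Qed.

(** Order zero is [bump_base_le1], order one [bump_base_step], and the higher
    orders [sq_iter_diff] summed over the coordinates. *)
Lemma bump_base_sbounded (lambda t : R) (x h : V) k : 1 <= lambda -> 0 <= t ->
  lambda * t <= 1 -> (forall l, `|h ord0 l| <= t) ->
  (forall j, (j <= k)%N -> 0 < bump_base lambda (x - j%:R *: h)) ->
  sbounded (lambda * t) k (3 * d%:R + 1) (fun j => bump_base lambda (x - j%:R *: h)).
Proof.
move=> l1 t0 lt1 ht allpos; have D0 : 0 <= d%:R :> R by rewrite ler0n.
have l0 : 0 < lambda by exact: lt_le_trans l1.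
have eta0 : 0 <= lambda * t by rewrite mulr_ge0// ltW.
move=> [|[|i]] j ijk.
- rewrite expr0 mulr1 /= ger0_norm; last by rewrite ltW// allpos.
  by rewrite (le_trans (bump_base_le1 _ _))// lerDr mulr_ge0.
- rewrite expr1 /= /sdiff [X in _ - bump_base _ X](_ : _ = (x - j%:R *: h) - h); last first.
    by rewrite -[j.+1%:R]natr1 scalerDl scale1r opprD addrA.
  apply: (le_trans (bump_base_step _ _ _ ht _)) => //; last by rewrite ler_wpM2r// lerDl.
  by apply: allpos; rewrite (leq_trans _ ijk)// add1n.
rewrite (eq_iter_sdiff (b := fun j => 1 + - lambda ^+ 2 * (\sum_(l < d) kappa (x ord0 l - j%:R * h ord0 l)))); last first.
  move=> u _; rewrite /bump_base mulNr; congr (1 - _ * _).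
  by apply: eq_bigr => l _; rewrite !mxE.
rewrite iter_sdiffD iter_sdiff_cst add0r iter_sdiffZ iter_sdiff_sum.
rewrite mulNr normrN normrM (ger0_norm (sqr_ge0 _)).
apply: (@le_trans _ _ (lambda ^+ 2 * \sum_(l < d) 2 * t ^+ i.+2)).
  rewrite ler_wpM2l ?sqr_ge0// (le_trans (ler_norm_sum _ _ _))// ler_sum// => l _.
  rewrite -[j in iter _ _ _ j]addn0 -iter_sdiff_shift.
  rewrite (eq_iter_sdiff (b := fun u => kappa ((x ord0 l - j%:R * h ord0 l) - u%:R * h ord0 l))); last first.
    by move=> u _; congr kappa; rewrite natrD; ring.
  apply: (le_trans (sq_iter_diff sq _ _ _)) => //.
  by rewrite ler_wpM2l// lerXn2r// ?nnegrE.
rewrite [X in _ * X](_ : _ = d%:R * (2 * t ^+ i.+2)); last first.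
  by rewrite sumr_const card_ord [RHS]mulr_natl.
rewrite exprMn.
have ll : lambda ^+ 2 <= lambda ^+ i.+2 by rewrite ler_weXn2l.
have ti : 0 <= t ^+ i.+2 by rewrite exprn_ge0.
rewrite (_ : lambda ^+ 2 * _ = (2 * d%:R) * (lambda ^+ 2 * t ^+ i.+2)); last by ring.
apply: ler_pM => //.
- by rewrite mulr_ge0// exprn_ge0// ltW.
- by move: D0; move: (d%:R) => D D0; lra.
by rewrite ler_wpM2r.
Qed.

(** If the base is positive along the whole progression then the bump is a power
    of a smooth function, and [sboundedX] applies; if it is positive at some
    points only, the edge of the support is close, and [edge_sdiff] applies. *)
Lemma bump_pointwise M : (0 < M)%N -> exists2 C : R, 0 < C & forall (lambda t : R) (h x : V) k,
  1 <= lambda -> 0 <= t -> lambda * t <= 1 -> (forall l, `|h ord0 l| <= t) ->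
  (k <= M)%N ->
  `|iter k (bdiff h) (bump lambda M) x| <=
    C * (lambda * t) ^+ k * \sum_(j < k.+1) bump_support lambda (x - j%:R *: h).
Proof.
move=> M0; pose A : R := 3 * d%:R + 1.
have A0 : 0 <= A by rewrite addr_ge0// mulr_ge0.
pose C1 := (2 ^+ M * A) ^+ M; pose C2 := 2 ^+ M * (A * M%:R) ^+ M.
have C10 : 0 <= C1 by rewrite exprn_ge0// mulr_ge0// exprn_ge0.
have C20 : 0 <= C2 by rewrite mulr_ge0// exprn_ge0// mulr_ge0.
exists (C1 + C2 + 1); first by rewrite ltr_wpDl// addr_ge0.
have C0 : 0 <= C1 + C2 + 1 by rewrite !addr_ge0.
move=> lambda t h x k l1 t0 lt1 ht kM.
have l0 : 0 < lambda by exact: lt_le_trans l1.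
have eta0 : 0 <= lambda * t by rewrite mulr_ge0// ltW.
have etak : 0 <= (lambda * t) ^+ k by exact: exprn_ge0.
pose sg j := bump_base lambda (x - j%:R *: h).
have -> : iter k (bdiff h) (bump lambda M) x = iter k sdiff (fun j => Num.max 0 (sg j) ^+ M) 0.
  by rewrite -[x in LHS]subr0 -(scale0r h) (iter_bdiffE k h _ x 0).
have supp0 j : 0 <= bump_support lambda (x - j%:R *: h) by exact: ler0n.
have [[j0 j0k sj0]|nosupp] := pselect (exists2 j, (j <= k)%N & 0 < sg j); last first.
  apply: (@le_trans _ _ (2 ^+ k * 0)); last by rewrite mulr0 !mulr_ge0// sumr_ge0.
  apply: normr_iter_sdiff => i /andP[_ ik]; rewrite add0n in ik.
  have si : sg i <= 0 by rewrite leNgt; apply/negP => si; apply: nosupp; exists i.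
  by rewrite (max_idPl si) expr0n gtn_eqF// normr0.
have supp1 : 1 <= \sum_(j < k.+1) bump_support lambda (x - j%:R *: h).
  have j0k' : (j0 < k.+1)%N by [].
  by rewrite (bigD1 (Ordinal j0k'))//= {1}/bump_support sj0 lerDl sumr_ge0.
suff h1 : `|iter k sdiff (fun j => Num.max 0 (sg j) ^+ M) 0| <= (C1 + C2 + 1) * (lambda * t) ^+ k.
  by apply: (le_trans h1); rewrite -[leLHS]mulr1 ler_wpM2l// mulr_ge0.
have [allpos|] := pselect (forall j, (j <= k)%N -> 0 < sg j).
  have := sboundedX M eta0 A0 (bump_base_sbounded l1 t0 lt1 ht allpos).
  move=> /(_ k 0%N); rewrite addn0 => /(_ (leqnn k)).
  rewrite (eq_iter_sdiff (b := fun j => Num.max 0 (sg j) ^+ M)); last first.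
    by move=> j /andP[_ jk]; congr (_ ^+ _); apply/esym/max_idPr/ltW; exact: allpos.
  move=> /le_trans; apply; rewrite ler_wpM2r//.
  apply: (@le_trans _ _ C1); last by rewrite -addrA lerDl addr_ge0.
  apply: lerXn2r; rewrite ?nnegrE; try by rewrite mulr_ge0// exprn_ge0.
  by rewrite ler_wpM2r// ler_weXn2l// ler1n.
move=> /existsNP[j1 /not_implyP[j1k /negP]]; rewrite -leNgt => sj1.
have AE : 0 <= A * (lambda * t) by rewrite mulr_ge0.
have lip j : `|Num.max 0 (sg j) - Num.max 0 (sg j.+1)| <= A * (lambda * t).
  have le : 3 * d%:R * (lambda * t) <= A * (lambda * t) by rewrite ler_wpM2r// lerDl.
  have sgS : x - j.+1%:R *: h = (x - j%:R *: h) - h.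
    by rewrite -natr1 scalerDl scale1r opprD addrA.
  have [sj|] := boolP (0 < sg j).
    apply: (le_trans (dist_pospart_le _ _)); apply: le_trans le.
    by rewrite /sg sgS; apply: bump_base_step.
  rewrite -leNgt => sj; have [sj2|] := boolP (0 < sg j.+1).
    apply: (le_trans (dist_pospart_le _ _)); apply: le_trans le.
    rewrite distrC /sg [X in _ - bump_base _ X](_ : _ = (x - j.+1%:R *: h) - (- h)).
      by apply: bump_base_step => // l; rewrite mxE normrN.
    by rewrite sgS opprK subrK.
  by rewrite -leNgt => sj2; rewrite (max_idPl sj) (max_idPl sj2) subrr normr0.
apply: (le_trans (edge_sdiff AE kM lip j1k sj1)).
have le1 : 2 ^+ k <= 2 ^+ M :> R by rewrite ler_weXn2l// ler1n.
have le2 : (lambda * t) ^+ M <= (lambda * t) ^+ k by rewrite ler_wiXn2l.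
rewrite (_ : A * (lambda * t) * M%:R = (A * M%:R) * (lambda * t)); last by ring.
rewrite exprMn mulrA; apply: ler_pM => //; rewrite ?exprn_ge0//.
  by rewrite mulr_ge0// ?exprn_ge0// mulr_ge0.
apply: (@le_trans _ _ C2); last by rewrite addrAC lerDr addr_ge0.
by rewrite ler_wpM2r// exprn_ge0// mulr_ge0.
Qed.

End bump.

(** * Logarithmic weights and the Lipschitz norm *)

Section logarithmic_weights.
Context {R : realType}.
Local Notation lam := (@lebesgue_measure R).

(** The exponent eps log (1 + y) - a y is bounded above: compare the logarithm with
    its tangent at eps / a. *)
Lemma powR_le_expR (eps a : R) : 0 < eps -> 0 < a ->
  exists2 C, 0 < C & forall y, 0 <= y -> (1 + y) `^ eps <= C * expR (a * y).
Proof.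
move=> e0 a0; exists (expR (a - eps + eps * ln (eps / a))); first exact: expR_gt0.
move=> y y0; have y1 : 0 < 1 + y by lra.
have ea0 : 0 < eps / a by rewrite divr_gt0.
rewrite powR_expR// -expRD ler_expR.
have z0 : 0 < (1 + y) / (eps / a) by rewrite divr_gt0.
have h1 : ln ((1 + y) / (eps / a)) <= (1 + y) / (eps / a) - 1.
  rewrite -[X in ln X](subrK 1) addrC; apply: le_ln1Dx.
  by rewrite ltrBrDr addNr.
rewrite ln_div// in h1.
have h2 := ler_wpM2l (ltW e0) h1.
have : eps * ((1 + y) / (eps / a)) = a * (1 + y).
  by field; rewrite !gt_eqF.
by move: h2; move: (ln (1 + y)) (ln (eps / a)) ((1 + y) / (eps / a)) => u v w; nra.
Qed.

(** The primitive (1 - log t)^(1 - s) / (s - 1) is bounded, so the integrals away from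
    the singularity at 0 are bounded, and they increase to the whole integral. *)
Lemma log_integrable (s : R) : 1 < s ->
  (\int[lam]_(t in `]0%R, 1%R[) (((1 - ln t) `^ (- s) * t^-1)%R)%:E <= ((s - 1)^-1)%:E)%E.
Proof.
move=> s1.
pose f (t : R) := (1 - ln t) `^ (- s) * t^-1.
pose F (t : R) := (s - 1)^-1 * (1 - ln t) `^ (1 - s).
have lnlt1 t : 0 < t <= 1 -> 0 < 1 - ln t.
  by move=> /andP[t0 t1]; have := ln_le0 t1; lra.
have dF (t : R) : 0 < t <= 1 -> is_derive t 1 F (f t).
  move=> /[dup] ht /andP[t0 t1].
  have d1 : is_derive t 1 (fun t : R => 1 - ln t) (- t^-1).
    rewrite -[X in is_derive _ _ _ X]add0r; apply: is_deriveB.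
    exact: is_derive1_ln.
  have d2 : is_derive (1 - ln t) 1 (@powR R ^~ (1 - s)) ((1 - s) * (1 - ln t) `^ (1 - s - 1)).
    by apply: is_derive1_powR; exact: lnlt1.
  have d3 := @is_derive1_comp _ (@powR R ^~ (1 - s)) (fun t => 1 - ln t) t _ _ d2 d1.
  have d4 := @is_deriveZ _ _ _ _ (s - 1)^-1 _ _ _ d3.
  rewrite /f (_ : _ * _ = (s - 1)^-1 *: ((1 - s) * (1 - ln t) `^ (1 - s - 1) * - t^-1)) //.
  rewrite (_ : 1 - s - 1 = - s); last by ring.
  rewrite /GRing.scale /=; move: (_ `^ _) => w; field.
  by rewrite gt_eqF//= gt_eqF//; lra.
have cF (t : R) : 0 < t <= 1 -> {for t, continuous F}.
  move=> ht; apply: differentiable_continuous; apply/derivable1_diffP.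
  exact: (@ex_derive _ _ _ _ _ _ _ (dF t ht)).
have cf (t : R) : 0 < t <= 1 -> {for t, continuous f}.
  move=> /[dup] ht /andP[t0 t1]; apply: cvgM; last by apply: cvgV; rewrite ?gt_eqF//; exact: cvg_id.
  have c1 : {for t, continuous (fun t : R => 1 - ln t)}.
    by apply: cvgB; [exact: cvg_cst|exact: continuous_ln].
  have c2 : {for 1 - ln t, continuous (@powR R ^~ (- s))}.
    apply: differentiable_continuous; apply/derivable1_diffP.
    by apply: derivable_powR; rewrite in_itv/= andbT; exact: lnlt1.
  exact: (continuous_comp c1 c2).
have f0 (t : R) : 0 < t -> 0 <= f t by move=> t0; rewrite mulr_ge0 ?powR_ge0// invr_ge0 ltW.
pose a n : R := n.+2%:R^-1.
have a01 n : 0 < a n < 1 by rewrite /a invr_gt0 ltr0n /= invf_lt1// ltr1n.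
have Sn n : (\int[lam]_(t in `[a n, 1%R]) (f t)%:E <= ((s - 1)^-1)%:E)%E.
  have /andP[an0 an1] := a01 n.
  rewrite (@continuous_FTC2 _ f F)//.
  - rewrite -EFinB lee_fin /F ln1 subr0 powR1 mulr1 gerBl mulr_ge0 ?powR_ge0// invr_ge0; lra.
  - apply: continuous_in_subspaceT => t; rewrite inE /= in_itv/= => /andP[h1 h2].
    by apply: cf; rewrite (lt_le_trans an0).
  - split.
    + move=> t; rewrite in_itv/= => /andP[h1 h2].
      by apply: (@ex_derive _ _ _ _ _ _ _ (dF t _)); rewrite (lt_trans an0)//= ltW.
    + by apply: cvg_at_right_filter; apply: cF; rewrite an0 /= ltW.
    + by apply: cvg_at_left_filter; apply: cF; rewrite ltr01 lexx.
  - move=> t; rewrite in_itv/= => /andP[h1 h2].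
    by rewrite derive1E; apply: derive_val; apply: dF; rewrite (lt_trans an0)//= ltW.
pose E n : set (measurableTypeR R) := `[a n, 1%R]%classic.
have mE n : measurable (E n) by exact: measurable_itv.
have ndE : nondecreasing_seq E.
  move=> m n mn; rewrite subsetEset => t; rewrite /E /= !in_itv/= => /andP[h ->].
  rewrite andbT (le_trans _ h)// /a lef_pV2 ?posrE ?ltr0n// ler_nat.
  by rewrite !ltnS.
have mf n : measurable_fun (E n) (fun t => (f t)%:E).
  apply/measurable_EFinP; apply: subspace_continuous_measurable_fun; first exact: measurable_itv.
  apply: continuous_in_subspaceT => t; rewrite inE /= /E /= in_itv/= => /andP[h1 h2].
  by apply: cf; have /andP[an0 _] := a01 n; rewrite (lt_le_trans an0).
have fE0 n x : E n x -> (0 <= (f x)%:E)%E.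
  rewrite /E /= in_itv/= => /andP[h1 h2]; rewrite lee_fin; apply: f0.
  by have /andP[an0 _] := a01 n; rewrite (lt_le_trans an0).
have cvgE := @ge0_nondecreasing_set_cvg_integral _ _ _ E (fun t => (f t)%:E) lam ndE mE mf fE0.
apply: (@le_trans _ _ (\int[lam]_(t in \bigcup_n E n) (f t)%:E)%E); last first.
  rewrite -(cvg_lim _ cvgE)//; apply: lime_le; first by apply/cvg_ex; eexists; exact: cvgE.
  by near=> n; exact: Sn.
rewrite [leLHS]integral_mkcond [leRHS]integral_mkcond.
apply: ge0_le_integralT => t _.
  by rewrite patchE; case: ifPn => //; rewrite inE /= in_itv/= => /andP[t0 _]; rewrite lee_fin f0.
rewrite !patchE; case: ifPn => [|_].
  rewrite inE /= in_itv/= => /andP[t0 t1]; rewrite ifT//.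
  rewrite inE; exists (Num.truncn t^-1) => //; rewrite /E /= in_itv/= (ltW t1) andbT.
  rewrite /a -[leRHS]invrK lef_pV2 ?posrE ?ltr0n ?invr_gt0//.
  by rewrite ltW// (lt_le_trans (truncnS_gt _))// ler_nat.
case: ifPn => //; rewrite inE => -[n _ Et]; exact: (fE0 n).
Unshelve. all: by end_near. Qed.

(** The left side decays exponentially in max (0, log lambda - (1 - log t)), hence
    faster than any power of (1 - log t) / log lambda; the gain in log lambda is
    what makes a bump work when alpha = d / p. *)
Lemma min_powR_le_log (alpha eps : R) : 0 < alpha -> 0 < eps ->
  exists2 C, 0 < C & forall lambda t : R, expR 1 <= lambda -> 0 < t < 1 ->
    Num.min 1 ((lambda * t) `^ (- alpha)) <= C * ((1 - ln t) / ln lambda) `^ eps.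
Proof.
move=> a0 e0; have [C C0 hC] := powR_le_expR e0 a0; exists C => // lambda t hl /andP[t0 t1].
have l0 : 0 < lambda by apply: lt_le_trans hl; exact: expR_gt0.
have L1 : 1 <= ln lambda by rewrite -[leLHS]expRK ler_ln ?posrE ?expR_gt0.
have u1 : 1 <= 1 - ln t by have := ln_lt0 (x := t); rewrite t0 t1 => /(_ isT); lra.
move: L1 u1; set u := 1 - ln t; set Lg := ln lambda => L1 u1.
pose y := Num.max 0 (Lg - u).
have y0 : 0 <= y by rewrite le_max lexx.
have h1 : Lg / u <= 1 + y.
  rewrite ler_pdivrMr; last by lra.
  have yu : Lg - u <= y by rewrite le_max lexx orbT.
  by move: L1 u1 y0 yu; move: Lg u y => a1 a2 a3 *; nra.
have h2 : Num.min 1 ((lambda * t) `^ (- alpha)) <= expR (- (alpha * y)).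
  rewrite powR_expR ?mulr_gt0// lnM ?posrE// -/Lg.
  have -> : ln t = 1 - u by rewrite /u; ring.
  rewrite /y; case: (leP 0 (Lg - u)) => h; last first.
    by rewrite mulr0 oppr0 expR0 ge_min lexx.
  by rewrite ge_min; apply/orP; right; rewrite ler_expR; nra.
apply: (le_trans h2); rewrite expRN -[leLHS]mul1r ler_pdivrMr ?expR_gt0//.
have u0 : 0 < u by exact: lt_le_trans u1.
have L0 : 0 < Lg by exact: lt_le_trans L1.
have e1 : (u / Lg) `^ eps * (Lg / u) `^ eps = 1.
  rewrite -powRM ?divr_ge0 ?(ltW u0) ?(ltW L0)// (_ : u / Lg * (Lg / u) = 1) ?powR1//.
  by field; rewrite !gt_eqF.
rewrite mulrAC [leRHS]mulrC -[leLHS]e1 ler_wpM2l ?powR_ge0//.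
apply: le_trans (hC y y0).
by apply: ge0_ler_powR; rewrite ?nnegrE ?(ltW e0) ?divr_ge0 ?(ltW u0) ?(ltW L0) ?addr_ge0.
Qed.

End logarithmic_weights.

Section lipschitz_norm.
Context {R : realType} (d : nat).
Local Notation V := 'rV[R]_d.
Variables (mu : {measure set V -> \bar R}) (alpha p b : R) (q : \bar R).
Hypotheses (alpha0 : 0 < alpha) (p1 : 1 <= p) (q0 : (0 < q)%E) (hb : (q^-1 < b%:E)%E).
Local Notation L f := ('N[mu]_(p%:E)[EFin \o f%R])%E.

Lemma modulus_ge0 f t : 0 <= t -> (0 <= modulus mu alpha p f t)%E.
Proof.
move=> t0; apply: (@le_trans _ _ ('N[mu]_(p%:E)[EFin \o frac_diff alpha 0 f])%E); first exact: Lnorm_ge0.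
apply: ereal_sup_ubound; exists 0 => //=.
by rewrite /enorm big1 ?sqrtr0// => i _; rewrite mxE expr0n.
Qed.

Lemma lip_weighted_le (C eps : R) f t : 0 <= C -> 0 < t < 1 ->
  (modulus mu alpha p f t <= (C * (t `^ alpha * (1 - ln t) `^ eps))%:E)%E ->
  (lip_weighted mu alpha b p f t <= (C * (1 - ln t) `^ (- (b - eps)))%:E)%E.
Proof.
move=> C0 /andP[t0 t1] h.
have u0 : 0 < 1 - ln t by have := ln_lt0 (x := t); rewrite t0 t1 => /(_ isT); lra.
apply: (@le_trans _ _ ((t `^ (- alpha) * (1 - ln t) `^ (- b))%:E *
    (C * (t `^ alpha * (1 - ln t) `^ eps))%:E)%E).
  by rewrite lee_wpmul2l// lee_fin mulr_ge0 ?powR_ge0.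
rewrite -EFinM lee_fin (_ : - (b - eps) = - b + eps); last by ring.
rewrite [X in _ <= _ * X]powRD; last by rewrite (gt_eqF u0) implybT.
rewrite powRN le_eqVlt; apply/orP; left; apply/eqP; field.
by rewrite gt_eqF// powR_gt0.
Qed.

(** As b > 1/q, the weight is integrable even after a small power of 1 - log t has
    been spent. *)
Lemma lip_seminorm_log : exists2 eps : R, 0 < eps & exists2 D : R, 0 < D &
  forall (C : R) f, 0 <= C ->
  (forall t, 0 < t < 1 ->
    (modulus mu alpha p f t <= (C * (t `^ alpha * (1 - ln t) `^ eps))%:E)%E) ->
  (lip_seminorm mu alpha b p q f <= (C * D)%:E)%E.
Proof.
case: q q0 hb => [r| |//] r0 rb.
  rewrite lte_fin in r0; rewrite inver gt_eqF// lte_fin in rb.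
  exists ((b - r^-1) / 2); first by rewrite divr_gt0// subr_gt0.
  set eps := (b - r^-1) / 2; pose s := (b - eps) * r.
  have s1 : 1 < s.
    by rewrite -ltr_pdivrMr// mul1r /eps; lra.
  exists (((s - 1)^-1) `^ r^-1); first by rewrite powR_gt0// invr_gt0 subr_gt0.
  move=> C f C0 hf.
  have lnu (t : R) : 0 < t < 1 -> 0 < 1 - ln t.
    by move=> /ln_lt0; lra.
  rewrite /lip_seminorm.
  have -> : (C * (s - 1)^-1 `^ r^-1)%:E = ((C `^ r * (s - 1)^-1)%:E `^ r^-1)%E.
    rewrite poweR_EFin powRM ?powR_ge0 ?invr_ge0 ?subr_ge0 ?(ltW s1)//.
    by rewrite -powRrM divff ?gt_eqF// powRr1.
  have W0 (t : R) : 0 < t < 1 -> (0 <= lip_weighted mu alpha b p f t `^ r * (t^-1)%:E)%E.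
    by move=> /andP[t0 _]; rewrite mule_ge0 ?poweR_ge0// lee_fin invr_ge0 ltW.
  apply: gt0_ler_poweR; rewrite ?in_itv/= ?leey ?andbT ?invr_ge0 ?(ltW r0)//.
  - apply: integral_ge0 => t; rewrite /= in_itv/= => h; exact: W0.
  - by rewrite lee_fin mulr_ge0 ?powR_ge0// invr_ge0; lra.
  pose w (t : R) := (1 - ln t) `^ (- s) * t `^ (-1).
  have w0 t : 0 <= w t by rewrite mulr_ge0 ?powR_ge0.
  have mw : measurable_fun [set: R] w.
    apply: measurable_funM; last exact: measurable_powR.
    apply: (@measurableT_comp _ _ _ _ _ _ (@powR R ^~ (- s))); first exact: measurable_powR.
    apply: measurable_funB => //; exact: measurable_ln.
  apply: (@le_trans _ _ (\int[@lebesgue_measure R]_(t in `]0%R, 1%R[) ((C `^ r)%:E * (w t)%:E))%E).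
    apply: ge0_le_integralT => t; rewrite /= in_itv/= => ht; first exact: W0.
    have /andP[t0 t1] := ht.
    have h1 := lip_weighted_le C0 ht (hf t ht).
    have h2 : (lip_weighted mu alpha b p f t `^ r <= ((C `^ r) * (1 - ln t) `^ (- s))%:E)%E.
      apply: (@le_trans _ _ ((C * (1 - ln t) `^ (- (b - eps)))%:E `^ r)%E).
        apply: gt0_ler_poweR; rewrite ?in_itv/= ?leey ?andbT ?(ltW r0)//.
          by rewrite mule_ge0 ?modulus_ge0 ?(ltW t0)// lee_fin mulr_ge0 ?powR_ge0.
        by rewrite lee_fin mulr_ge0 ?powR_ge0.
      rewrite poweR_EFin powRM ?powR_ge0// -powRrM mulNr; exact: lexx.
    rewrite -EFinM /w mulrA EFinM powR_inv1 ?(ltW t0)//.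
    by apply: lee_wpmul2r => //; rewrite lee_fin invr_ge0 ltW.
  rewrite ge0_integralZl//.
  - rewrite EFinM lee_wpmul2l ?lee_fin ?powR_ge0//.
    apply: le_trans (log_integrable s1).
    apply: ge0_le_integralT => t; rewrite /= in_itv/= => /andP[t0 _]; rewrite lee_fin //.
    by rewrite /w powR_inv1 ?(ltW t0).
  - exact/measurable_EFinP/measurable_funTS.
  - by move=> t _; rewrite lee_fin.
  - by rewrite lee_fin powR_ge0.
have b0 : 0 < b by move: rb; rewrite invey lte_fin.
exists (b / 2); first by rewrite divr_gt0.
exists 1 => // C f C0 hf; rewrite /lip_seminorm mulr1.
apply: ge_ereal_sup => _ [t /= ht <-]; rewrite in_itv/= in ht.
apply: (le_trans (lip_weighted_le C0 ht (hf t ht))).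
rewrite lee_fin -[leRHS]mulr1 ler_wpM2l// powRN invf_le1.
  have u1 : 1 <= 1 - ln t by have := ln_lt0 ht; lra.
  rewrite -[leLHS](powRr0 (1 - ln t)) ler_powR//; lra.
by rewrite powR_gt0//; have := ln_lt0 ht; lra.
Qed.

(** By [min_powR_le_log] such a modulus is at most
    t^alpha ((1 - log t) / log lambda)^eps up to a constant, whence a seminorm of
    order (log lambda)^(- eps). The choice lambda = exp x makes both parts of the
    norm at most a negative power of [x]. *)
Lemma lip_norm_small (K e : R) : 0 <= K -> 0 < e ->
  exists2 lambda : R, 1 <= lambda & forall f,
    (L f <= (K * lambda `^ (- alpha))%:E)%E ->
    (forall t, 0 < t < 1 -> (modulus mu alpha p f t <=
      (K * Num.min (t `^ alpha) (lambda `^ (- alpha)))%:E)%E) ->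
    (lip_norm mu alpha b p q f < e%:E)%E.
Proof.
move=> K0 e0.
have [eps eps0 [D D0 hD]] := lip_seminorm_log.
have [C C0 hC] := min_powR_le_log alpha0 eps0.
pose m := Num.min alpha eps.
have m0 : 0 < m by rewrite lt_min alpha0.
pose K' := K + K * C * D.
have K'0 : 0 <= K' by rewrite addr_ge0// !mulr_ge0// ltW.
pose y := 2 * K' / e + 1.
have y1 : 1 <= y by rewrite lerDr divr_ge0 ?mulr_ge0// ltW.
have y0 : 0 < y by exact: lt_le_trans y1.
pose x := y `^ m^-1.
have x1 : 1 <= x by rewrite /x -[leLHS](powRr0 y) ler_powR// invr_ge0 ltW.
have x0 : 0 < x by exact: lt_le_trans x1.
have xm : x `^ (- m) = y^-1.
  by rewrite /x -powRrM mulrN mulVf ?gt_eqF// powR_inv1// ltW.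
have small a : m <= a -> x `^ (- a) <= y^-1.
  by move=> ma; rewrite -xm ler_powR// lerN2.
have K'y : K' * y^-1 < e / 2.
  by rewrite ltr_pdivrMr// /y mulrDr mulr1 (_ : e / 2 * _ = K'); [lra|field; rewrite gt_eqF].
exists (expR x); first by rewrite -expR0 ler_expR ltW.
move=> f hL hmod.
have hl : expR x `^ (- alpha) <= y^-1.
  apply: le_trans (small alpha _); last by rewrite ge_min lexx.
  apply: ler_powN => //; first exact: ltW.
  by apply: le_trans (expR_ge1Dx x); rewrite lerDr.
rewrite /lip_norm (splitr e) EFinD.
apply: (@le_lt_trans _ _ ((K * y^-1)%:E + (K * C * D * y^-1)%:E)%E); last first.
  by rewrite -!EFinD lte_fin -mulrDl -splitr; apply: (lt_le_trans K'y); lra.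
apply: leeD.
  by apply: (le_trans hL); rewrite lee_fin ler_wpM2l.
have := hD (K * C * x `^ (- eps)) f; move=> /(_ _ _)/le_trans; apply.
- by rewrite !mulr_ge0 ?powR_ge0// ltW.
- move=> t ht; apply: (le_trans (hmod t ht)); have /andP[t0 t1] := ht.
  rewrite lee_fin -!mulrA ler_wpM2l//.
  rewrite (_ : Num.min _ _ = t `^ alpha * Num.min 1 ((expR x * t) `^ (- alpha))); last first.
    rewrite minr_pMr ?powR_ge0// mulr1; congr Num.min.
    rewrite powRM ?expR_ge0 ?(ltW t0)// [in RHS]powRN [X in _ * (_ * X)]powRN.
    by rewrite mulrCA -powRN divff ?mulr1// gt_eqF// powR_gt0.
  have := hC (expR x) t _ ht; rewrite ler_expR => /(_ x1) h.
  apply: (le_trans (ler_wpM2l (powR_ge0 _ _) h)).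
  rewrite expRK powRM ?invr_ge0 ?(ltW x0)//; last by have := ln_lt0 ht; lra.
  rewrite -powR_inv1 ?(ltW x0)// -powRrM mulN1r.
  by rewrite le_eqVlt; apply/orP; left; apply/eqP; ring.
rewrite lee_fin mulrAC ler_wpM2l ?mulr_ge0 ?(ltW D0) ?(ltW C0)//.
by apply: small; rewrite ge_min lexx orbT.
Qed.

End lipschitz_norm.

(** * Bumps of small Lipschitz norm *)

Section small_bumps.
Context {R : realType} (d : nat).
Local Notation V := 'rV[R]_d.
Variables (mu : {measure set V -> \bar R}) (G : set V).
Variables (alpha p b : R) (q : \bar R) (kappa : R -> R).
Hypotheses (tmu : translation_measure mu G) (alpha0 : 0 < alpha) (p1 : 1 <= p).
Hypotheses (q0 : (0 < q)%E) (hb : (q^-1 < b%:E)%E).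
Hypothesis sq : square_like kappa.
Hypothesis kappaG : forall g, G g -> forall (x : V) l, kappa ((x + g) ord0 l) = kappa (x ord0 l).
Hypothesis kappa_volume : exists2 C : R, 0 <= C & forall lambda : R, 1 <= lambda ->
  (mu [set x | (0 < bump_base kappa lambda x)%R] <= (C * lambda `^ (- d%:R))%:E)%E.
Local Notation L f := ('N[mu]_(p%:E)[EFin \o f%R])%E.
Local Notation bump_base := (@bump_base R d kappa).
Local Notation bump := (@bump R d kappa).
Local Notation bump_support := (@bump_support R d kappa).

Lemma normr_coord_le_enorm (h : V) l : `|h ord0 l| <= enorm h.
Proof.
rewrite -sqrtr_sqr ler_wsqrtr// (bigD1 l)//= lerDl sumr_ge0// => i _.
exact: sqr_ge0.
Qed.

Lemma measurable_bump_base lambda : measurable_fun [set: V] (bump_base lambda).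
Proof.
apply: measurable_funB => //; apply: measurable_funM => //.
apply: measurable_sum => l.
apply: (@measurableT_comp _ _ _ _ _ _ kappa); last exact: measurable_row_coord.
by apply: continuous_measurable_fun; exact: sq_continuous.
Qed.

Lemma periodic_bump_base lambda : invariant_by G (bump_base lambda).
Proof.
move=> g Gg x; congr (1 - _ * _); apply: eq_bigr => l _; exact: kappaG.
Qed.

Lemma measurable_bump_base_gt0 lambda : measurable [set x | (0 < bump_base lambda x)%R].
Proof.
rewrite (_ : mkset _ = bump_base lambda @^-1` `]0, +oo[%classic); last first.
  by apply/seteqP; split => x; rewrite /= in_itv/= andbT.
by have := @measurable_bump_base lambda measurableT _ (measurable_itv `]0, +oo[); rewrite setTI.
Qed.

Lemma periodic_mfun_bump lambda M : periodic_mfun G (bump lambda M).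
Proof.
split.
  apply: measurable_funX; apply: measurable_maxr => //; exact: measurable_bump_base.
by move=> g Gg x; congr (Num.max _ _ ^+ _); exact: periodic_bump_base.
Qed.

Lemma bump_supportE lambda :
  bump_support lambda = \1_[set x | (0 < bump_base lambda x)%R].
Proof.
apply/funext => x; rewrite indicE; congr (nat_of_bool _)%:R.
by apply/idP/idP; rewrite inE.
Qed.

Lemma periodic_mfun_bump_support lambda : periodic_mfun G (bump_support lambda).
Proof.
split.
  rewrite bump_supportE; apply: measurable_indic; exact: measurable_bump_base_gt0.
by move=> g Gg x; congr (nat_of_bool (_ < _)%R)%:R; exact: periodic_bump_base.
Qed.

Lemma continuous_bump lambda M : continuous (bump lambda M).
Proof.
move=> x.
have cs : continuous (fun y : V => \sum_(l < d) kappa (y ord0 l)).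
  apply: (continuous_big add_continuous) => l _ z.
  apply: (@continuous_comp _ _ _ (fun y : V => y ord0 l) kappa).
    exact: coord_continuous.
  exact: sq_continuous.
have cb : {for x, continuous (bump_base lambda)}.
  have c1 : {for x, continuous (fun y : V => lambda ^+ 2 * \sum_(l < d) kappa (y ord0 l))}.
    exact: (@continuousM _ _ (fun=> lambda ^+ 2) _ x (@cst_continuous _ _ _ _) (cs x)).
  exact: (@continuousB _ _ _ (fun=> 1 : R) _ x (@cst_continuous _ _ _ _) c1).
have cm : {for x, continuous (fun y => Num.max 0 (bump_base lambda y))}.
  by apply: (@continuous_max _ _ (fun=> 0) (bump_base lambda) x) => //; exact: cst_continuous.
exact: (continuous_comp cm (@exprn_continuous _ M _)).
Qed.

Lemma bump_ge0 lambda M x : 0 <= bump lambda M x.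
Proof. by rewrite exprn_ge0// le_max lexx. Qed.

Lemma bump_le1 lambda M x : bump lambda M x <= 1.
Proof.
rewrite exprn_ile1// ?le_max ?lexx// ge_max ler01 /=.
exact: bump_base_le1.
Qed.

Lemma bump0 lambda M : bump lambda M 0 = 1.
Proof.
rewrite -[RHS](expr1n _ M); congr (_ ^+ _).
suff -> : bump_base lambda 0 = 1 by rewrite max_r.
rewrite -[RHS]subr0; congr (_ - _); rewrite big1 ?mulr0// => l _.
by rewrite mxE (sq0 sq).
Qed.

Lemma bump_le_support lambda M x : (0 < M)%N -> `|bump lambda M x| <= `|bump_support lambda x|.
Proof.
move=> M0; rewrite (ger0_norm (bump_ge0 _ _ _)) [leRHS]ger0_norm; last exact: ler0n.
have [h|] := boolP (0 < bump_base lambda x).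
  by apply: (le_trans (bump_le1 _ _ _)); rewrite (_ : bump_support lambda x = (true : nat)%:R)//; congr (nat_of_bool _)%:R.
rewrite -leNgt => h; apply: le_trans (ler0n _ _).
have -> : bump lambda M x = 0 ^+ M by congr (_ ^+ _); apply/max_idPl.
by rewrite expr0n gtn_eqF.
Qed.

Lemma Lnorm_bump_support : alpha <= d%:R / p ->
  exists2 C : R, 0 <= C & forall lambda, 1 <= lambda ->
  (L (bump_support lambda) <= (C * lambda `^ (- alpha))%:E)%E.
Proof.
move=> ap; have p0 : 0 < p by exact: lt_le_trans p1.
have [C C0 hC] := kappa_volume; exists (C `^ p^-1); first exact: powR_ge0.
move=> lambda l1; rewrite LnormE.
have l0 : 0 < lambda by exact: lt_le_trans l1.
have -> : (\int[mu]_x (`|(EFin \o bump_support lambda) x| `^ p) =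
    \int[mu]_x (\1_[set x | (0 < bump_base lambda x)%R] x)%:E)%E.
  apply: eq_integral => x _; rewrite /= bump_supportE indicE.
  by case: (_ \in _); rewrite ?normr1 ?powR1// normr0 powR0// gt_eqF.
rewrite integral_indic//; last exact: measurable_bump_base_gt0.
rewrite setIT; apply: (@le_trans _ _ ((C * lambda `^ (- d%:R))%:E `^ p^-1)%E).
  apply: gt0_ler_poweR; rewrite ?in_itv/= ?leey ?andbT ?invr_ge0 ?(ltW p0) ?measure_ge0//.
    by rewrite lee_fin mulr_ge0 ?powR_ge0.
  exact: hC.
rewrite poweR_EFin lee_fin powRM ?powR_ge0// ler_wpM2l ?powR_ge0// -powRrM.
by rewrite mulNr ler_powR// lerN2.
Qed.

Lemma Lnorm_iter_bdiff_bump M : (0 < M)%N -> alpha <= d%:R / p ->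
  exists2 C : R, 0 <= C & forall lambda t (h : V) i, 1 <= lambda -> 0 <= t ->
  lambda * t <= 1 -> enorm h <= t -> (i <= M)%N ->
  (L (iter i (bdiff h) (bump lambda M)) <=
    (C * lambda `^ (- alpha) * (lambda * t) ^+ i)%:E)%E.
Proof.
move=> M0 ap; have [C C0 hC] := Lnorm_bump_support ap.
have [C' C'0 hC'] := bump_pointwise d sq M0.
exists (C' * M.+1%:R * C); first by rewrite !mulr_ge0// ltW.
move=> lambda t h i l1 t0 lt1 ht iM.
have l0 : 0 < lambda by exact: lt_le_trans l1.
have e0 : 0 <= (lambda * t) ^+ i by rewrite exprn_ge0// mulr_ge0// ltW.
pose a := C' * (lambda * t) ^+ i.
have a0 : 0 <= a by rewrite mulr_ge0// ltW.
apply: (@le_trans _ _ (L (fun x => \sum_(j <- index_iota 0 i.+1) a * bump_support lambda (x - j%:R *: h))%R)).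
  apply: le_Lnorm => // x; rewrite /= lee_fin; apply: le_trans (ler_norm _).
  rewrite -mulr_sumr big_mkord; apply: hC' => // l.
  exact: le_trans (normr_coord_le_enorm _ _) ht.
apply: (le_trans (Lnorm_sum_shift_le tmu p1 _ (fun=> a) h (periodic_mfun_bump_support lambda))).
rewrite big_mkord sumr_const card_ord ger0_norm//.
rewrite -[a *+ _]mulr_natr.
apply: (@le_trans _ _ ((a * i.+1%:R)%:E * (C * lambda `^ (- alpha))%:E)%E).
  by rewrite EFinM -EFinM; apply: lee_wpmul2l; [rewrite lee_fin mulr_ge0|exact: hC].
rewrite -EFinM lee_fin /a.
rewrite (_ : C' * M.+1%:R * C * _ * _ = (C' * C * lambda `^ (- alpha) * (lambda * t) ^+ i) * M.+1%:R); last by ring.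
rewrite [leLHS](_ : _ = (C' * C * lambda `^ (- alpha) * (lambda * t) ^+ i) * i.+1%:R); last by ring.
by rewrite ler_wpM2l ?ler_nat// !mulr_ge0 ?powR_ge0// ltW.
Qed.

(** For lambda t <= 1 the integer differences of the bump bound the fractional one;
    for larger steps the trivial bound by the L_p norm is already good enough. *)
Lemma modulus_bump : alpha <= d%:R / p -> exists M, exists2 K : R, 0 <= K &
  forall lambda, 1 <= lambda ->
  (L (bump lambda M) <= (K * lambda `^ (- alpha))%:E)%E /\
  forall t, 0 < t ->
  (modulus mu alpha p (bump lambda M) t <= (K * Num.min (t `^ alpha) (lambda `^ (- alpha)))%:E)%E.
Proof.
move=> ap; pose M := (Num.truncn alpha).+1; exists M.
have aM : 0 < alpha < M%:R by rewrite alpha0 truncnS_gt.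
have [C1 C10 h1] := Lnorm_bump_support ap.
have [C2 C20 h2] := Lnorm_iter_bdiff_bump (ltn0Sn (Num.truncn alpha)) ap.
have [C3 C30 h3] := Lnorm_fdiff_powR tmu p1 aM.
have [C4 C40 h4] := Lnorm_fdiff_le tmu p1 alpha0.
pose K := C1 + C3 * C2 + C4 * C1.
have [k1 k2] : 0 <= C3 * C2 /\ 0 <= C4 * C1 by split; rewrite mulr_ge0// ltW.
have K0 : 0 <= K by rewrite !addr_ge0.
exists K => // lambda l1; have l0 : 0 < lambda by exact: lt_le_trans l1.
have la : 0 <= lambda `^ (- alpha) by exact: powR_ge0.
have LB : (L (bump lambda M) <= (C1 * lambda `^ (- alpha))%:E)%E.
  apply: le_trans (h1 _ l1); apply: le_Lnorm => // x /=; rewrite lee_fin.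
  exact: bump_le_support.
have hB := periodic_mfun_bump lambda M.
split; first by apply: (le_trans LB); rewrite lee_fin ler_wpM2r// /K -addrA lerDl addr_ge0.
move=> t t0; apply: ge_ereal_sup => _ [h /= ht <-].
rewrite (Lnorm_frac_diff p tmu)//.
have triv : (L (fdiff alpha h (bump lambda M)) <= (K * lambda `^ (- alpha))%:E)%E.
  apply: (le_trans (h4 h _ hB _)); first by apply: le_lt_trans LB _; rewrite ltry.
  apply: (@le_trans _ _ (C4%:E * (C1 * lambda `^ (- alpha))%:E)%E).
    by rewrite lee_wpmul2l ?lee_fin ?(ltW C40).
  by rewrite -EFinM lee_fin mulrA ler_wpM2r// /K lerDr addr_ge0.
have lat : lambda `^ (- alpha) * (lambda * t) `^ alpha = t `^ alpha.
  by rewrite powRM ?(ltW l0) ?(ltW t0)// mulrA powRN mulVf ?mul1r// gt_eqF// powR_gt0.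
have [lt1|lt1] := leP (lambda * t) 1.
  rewrite min_l; last first.
    rewrite -lat -[leRHS]mulr1 ler_wpM2l//.
    have -> : 1 = 1 `^ alpha :> R by rewrite powR1.
    apply: ge0_ler_powR; rewrite ?nnegrE ?(ltW alpha0)//.
    by rewrite mulr_ge0 ?ltW.
  have := h3 h (bump lambda M) (C2 * lambda `^ (- alpha)) (lambda * t) hB.
  rewrite lt1 mulr_gt0// => /(_ _ isT _)/le_trans; apply.
  - by rewrite mulr_ge0.
  - by move=> i iM; apply: h2 => //; exact: ltW.
  rewrite lee_fin -lat [leRHS]mulrA ler_wpM2r ?powR_ge0// mulrA ler_wpM2r//.
  by rewrite /K addrAC lerDr addr_ge0.
rewrite min_r//.
rewrite -lat -[leLHS]mulr1 ler_wpM2l//.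
have -> : 1 = 1 `^ alpha :> R by rewrite powR1.
by apply: ge0_ler_powR; rewrite ?nnegrE ?(ltW alpha0) ?(ltW lt1) ?mulr_ge0 ?ltW.
Qed.

Lemma small_bumps (e : R) : alpha <= d%:R / p -> 0 < e ->
  exists f : V -> R, [/\ periodic_mfun G f, continuous f, f 0 = 1,
    forall x, `|f x| <= 1 & (lip_norm mu alpha b p q f < e%:E)%E].
Proof.
move=> ap e0; have [M [K K0 hK]] := modulus_bump ap.
have [lambda l1 hl] := lip_norm_small mu p alpha0 q0 hb K0 e0.
have [hL hm] := hK _ l1.
exists (bump lambda M); split.
- exact: periodic_mfun_bump.
- exact: continuous_bump.
- exact: bump0.
- by move=> x; rewrite ger0_norm ?bump_ge0 ?bump_le1.
- by apply: hl => // t /andP[t0 _]; exact: hm.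
Qed.

End small_bumps.

(** * The squares on the line and on the circle *)

Section square_like_functions.
Context {R : realType}.

Lemma square_like_sqr : square_like (fun s : R => s ^+ 2).
Proof.
split.
- by move=> s; exact: sqr_ge0.
- by rewrite expr0n.
- by move=> s; exact: exprn_continuous.
- move=> s h e e0 se.
  have {}se : `|s| <= e by rewrite -(ger0_norm e0) -ler_sqr ?nnegrE// !real_normK ?num_real.
  rewrite (_ : _ - _ = 2 * h * s - h ^+ 2); last by ring.
  apply: (le_trans (ler_normB _ _)); rewrite lerD//.
    by rewrite !normrM (@ger0_norm _ 2)// ler_wpM2l// mulr_ge0.
  by rewrite ger0_norm ?sqr_ge0.
- move=> [//|[//|k]] s h _.
  rewrite -addn2 iterD (eq_iter_sdiff (b := fun=> 2 * h ^+ 2)); last first.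
    by move=> i _; rewrite !iterS_sdiff /= -!natr1; ring.
  case: k => [|k].
    by rewrite /= normrM ger0_norm// normrX.
  by rewrite iter_sdiff_cst normr0 mulr_ge0.
Qed.

Lemma normr_sin_le (x : R) : `|sin x| <= `|x|.
Proof.
wlog x0 : x / 0 <= x.
  move=> H; have [/H//|x0] := leP 0 x.
  by have := H (- x); rewrite sinN !normrN oppr_ge0 (ltW x0) => /(_ isT).
have [c _] := @MVT_segment R sin cos 0 x x0 (fun y _ => is_derive_sin y)
  (continuous_subspaceT (@continuous_sin R)).
rewrite sin0 !subr0 => ->; rewrite normrM -[leRHS]mul1r ler_wpM2r//; exact: cos_max.
Qed.

Lemma cos_sin_half (x : R) : cos x = 1 - 2 * sin (x / 2) ^+ 2.
Proof. by rewrite {1}(splitr x) cosD -!expr2 cos2sin2; ring. Qed.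

Lemma cos_ge_parabola (x : R) : 1 - x ^+ 2 / 2 <= cos x.
Proof.
rewrite cos_sin_half lerD2l lerN2.
have : sin (x / 2) ^+ 2 <= (x / 2) ^+ 2.
  by rewrite -real_normK ?num_real// -[leRHS]real_normK ?num_real// lerXn2r ?nnegrE// normr_sin_le.
by rewrite expr_div_n; lra.
Qed.

Lemma sin_ge_half (x : R) : 0 <= x <= 1 -> x / 2 <= sin x.
Proof.
move=> /andP[x0 x1].
have [c] := @MVT_segment R sin cos 0 x x0 (fun y _ => is_derive_sin y)
  (continuous_subspaceT (@continuous_sin R)).
rewrite in_itv/= sin0 !subr0 => /andP[c0 cx] ->; rewrite mulrC ler_wpM2r//.
apply: le_trans (cos_ge_parabola c).
have : c ^+ 2 <= 1 by rewrite exprn_ile1// (le_trans cx).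
by lra.
Qed.

(** The square of the chord between the points of angle 0 and [s] on the unit
    circle, which makes it periodic and comparable to [s ^+ 2] near 0. *)
Definition torus_square (s : R) : R := 2 * (1 - cos s).

Lemma torus_squareE s : torus_square s = (2 * sin (s / 2)) ^+ 2.
Proof. by rewrite /torus_square cos_sin_half; ring. Qed.

(** The difference of a cosine is again a shifted cosine, times 2 sin (h / 2); this
    can be iterated. *)
Lemma cos_sdiff (s h : R) : cos s - cos (s - h) = 2 * sin (h / 2) * cos (s - h / 2 + pi / 2).
Proof.
rewrite cosDpihalf.
rewrite (_ : s - h = s - h / 2 - h / 2); last by rewrite [X in s - X]splitr; ring.
rewrite {1}(_ : s = s - h / 2 + h / 2); last by rewrite subrK.
by rewrite cosB cosD; ring.
Qed.

Lemma normr_iter_sdiff_cos k (s h : R) :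
  `|iter k sdiff (fun j => cos (s - j%:R * h)) 0%N| <= `|h| ^+ k.
Proof.
elim: k s => [|k IH] s; first by rewrite expr0 cos_max.
rewrite -addn1 iterD (eq_iter_sdiff (b := fun j => 2 * sin (h / 2) *
    cos ((s - h / 2 + pi / 2) - j%:R * h))); last first.
  move=> i _; rewrite iterS_sdiff /= (_ : s - i.+1%:R * h = (s - i%:R * h) - h).
    by rewrite cos_sdiff; congr (_ * cos _); ring.
  by rewrite -natr1; ring.
rewrite iter_sdiffZ normrM addn1 exprS ler_pM//.
rewrite normrM (@ger0_norm _ 2)//.
have := normr_sin_le (h / 2); rewrite normrM (@ger0_norm _ (2^-1))//; lra.
Qed.

Lemma square_like_torus : square_like torus_square.
Proof.
split.
- by move=> s; rewrite torus_squareE sqr_ge0.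
- by rewrite /torus_square cos0 subrr mulr0.
- move=> s.
  have c1 : {for s, continuous (fun y : R => 1 - cos y)}.
    exact: (@continuousB _ _ _ (fun=> 1 : R) _ s (@cst_continuous _ _ _ _) (@continuous_cos R s)).
  exact: (@continuousM _ _ (fun=> 2 : R) _ s (@cst_continuous _ _ _ _) c1).
- move=> s h e e0; rewrite torus_squareE => se.
  have {}se : `|2 * sin (s / 2)| <= e.
    by rewrite -(ger0_norm e0) -ler_sqr ?nnegrE// !real_normK ?num_real.
  have ss : `|sin s| <= e.
    rewrite {1}(splitr s) sinD (_ : _ + _ = (2 * sin (s / 2)) * cos (s / 2)); last by ring.
    by rewrite normrM (le_trans _ se)// -[leRHS]mulr1 ler_wpM2l// cos_max.
  rewrite -torus_squareE /torus_square cosB (_ : _ - _ = 2 * (sin s * sin h) - (2 * (1 - cos h)) * cos s); last by ring.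
  apply: (le_trans (ler_normB _ _)); apply: lerD.
    rewrite !normrM (@ger0_norm _ 2)// -mulrA ler_wpM2l// mulrC.
    by apply: ler_pM => //; exact: normr_sin_le.
  rewrite normrM -[leRHS]mulr1; apply: ler_pM => //; last exact: cos_max.
  rewrite ger0_norm; last by rewrite mulr_ge0// subr_ge0 cos_le1.
  by have := cos_ge_parabola h; lra.
- move=> [//|k] s h _.
  rewrite (eq_iter_sdiff (b := fun j => 2 + - 2 * cos (s - j%:R * h))); last first.
    by move=> i _; rewrite /torus_square; ring.
  rewrite iter_sdiffD iter_sdiff_cst add0r iter_sdiffZ normrM normrN (@ger0_norm _ 2)//.
  by rewrite ler_wpM2l// normr_iter_sdiff_cos.
Qed.

(** The chord has length 2 sin (v / 2); being below 1 / lambda <= 1 it forces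
    v / 2 < 1, where the sine is at least half its argument. *)
Lemma torus_square_lt (lambda v : R) : 1 <= lambda -> - pi <= v <= pi ->
  lambda ^+ 2 * torus_square v < 1 -> `|v| < 2 / lambda.
Proof.
move=> l1; have l0 : 0 < lambda by exact: lt_le_trans l1.
wlog v0 : v / 0 <= v.
  move=> H vpi hv; have [/H|v0] := leP 0 v; first exact.
  rewrite -normrN; apply: H; first by rewrite oppr_ge0 ltW.
    by case/andP: vpi => ? ?; apply/andP; split; lra.
  by rewrite /torus_square cosN.
move=> /andP[_ vpi]; rewrite torus_squareE -exprMn => hv.
pose w := v / 2; rewrite (ger0_norm v0).
have w0 : 0 <= w by rewrite divr_ge0.
have wpi : w <= pi / 2 by rewrite ler_wpM2r.
have pi2 := @pi_ge2 R; have sw0 : 0 <= sin w.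
  by apply: sin_ge0_pi; rewrite w0/= (le_trans wpi)//; lra.
have {}hv : lambda * (2 * sin w) < 1.
  rewrite -(@ltr_pXn2r _ 2)// ?nnegrE ?expr1n//.
  by rewrite mulr_ge0 ?(ltW l0)// mulr_ge0.
have sl : sin w < (2 * lambda)^-1.
  by rewrite -[ltRHS]mul1r ltr_pdivlMr ?mulr_gt0//; move: hv; lra.
have w1 : w < 1.
  rewrite ltNge; apply/negP => w1.
  have : sin 1 <= sin w.
    rewrite leNgt; apply/negP; rewrite ltr_sin ?in_itv/=; [lra|apply/andP; split; lra..].
  have := @sin_ge_half 1; rewrite ler01 lexx => /(_ isT) s1 /(le_trans s1) s2.
  have : (2 * lambda)^-1 <= 1 / 2 :> R by rewrite div1r lef_pV2 ?posrE ?mulr_gt0//; lra.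
  by lra.
have := @sin_ge_half w; rewrite w0 (ltW w1) => /(_ isT) /le_lt_trans/(_ sl).
rewrite invfM /w => h1; have : 2 / lambda = 4 * (2^-1 / lambda) by field; rewrite gt_eqF.
by move=> ->; lra.
Qed.

End square_like_functions.

Section bump_volume.
Context {R : realType} (d : nat).
Local Notation V := 'rV[R]_d.

Lemma bump_base_gt0_coord (kappa : R -> R) lambda (x : V) l : square_like kappa ->
  0 < bump_base kappa lambda x -> lambda ^+ 2 * kappa (x ord0 l) < 1.
Proof.
move=> sq; rewrite /bump_base subr_gt0; apply: le_lt_trans; rewrite ler_wpM2l ?sqr_ge0//.
by rewrite (bigD1 l)//= lerDl sumr_ge0// => i _; exact: sq_ge0.
Qed.

Lemma torus_square_periodic g : torus_periods g -> forall (x : V) l,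
  torus_square ((x + g) ord0 l) = torus_square (x ord0 l).
Proof.
move=> [i _ <-] x l; rewrite !mxE /torus_square.
case: (_ && _); last by rewrite mulr0 addr0.
by rewrite (_ : 2 * pi * _ = pi *+ 2) ?cosD2pi// mulr1 [LHS]mulr_natl.
Qed.

Lemma lebesgue_row_le_cube (c r lambda : R) (A : set V) : 0 < lambda -> 0 <= r -> measurable A ->
  (forall x, A x -> forall l, `|x ord0 l - c| < r / lambda) ->
  (lebesgue_row d A <= ((2 * r) ^+ d * lambda `^ (- d%:R))%:E)%E.
Proof.
move=> l0 r0 mA hA; have rl : 0 <= r / lambda by rewrite divr_ge0// ltW.
apply: (@le_trans _ _ (lebesgue_row d (box (const_mx (c - r / lambda)) (const_mx (c + r / lambda) : V)))).
  apply: le_measure; rewrite ?inE//; first exact: measurable_box.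
  move=> x /hA h l; rewrite !mxE; have := h l; rewrite ltr_norml => /andP[]; lra.
rewrite lebesgue_row_box; last by move=> i; rewrite !mxE; lra.
under eq_bigr do rewrite !mxE.
rewrite prodr_const card_ord lee_fin powRN powR_mulrn ?(ltW l0)// -exprVn -exprMn.
by rewrite (_ : _ - _ = 2 * r / lambda)//; ring.
Qed.

Lemma bump_volume_row : exists2 C : R, 0 <= C & forall lambda : R, 1 <= lambda ->
  (lebesgue_row d [set x : V | (0 < bump_base (fun s : R => s ^+ 2) lambda x)%R] <=
   (C * lambda `^ (- d%:R))%:E)%E.
Proof.
exists ((2 * 1) ^+ d); first by rewrite exprn_ge0.
move=> lambda l1; have l0 : 0 < lambda by exact: lt_le_trans l1.
apply: (@lebesgue_row_le_cube 0) => //.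
  apply: measurable_bump_base_gt0; exact: square_like_sqr.
move=> x /= /bump_base_gt0_coord h l; rewrite subr0.
have := h l square_like_sqr; rewrite -exprMn => hx.
rewrite ltr_pdivlMr// mulrC -(ger0_norm (ltW l0)) -normrM.
by rewrite -(@ltr_pXn2r _ 2)// ?nnegrE// real_normK ?num_real// expr1n.
Qed.

(** The support surrounds the corners of the cell; translating it by half a period
    gathers it around the centre, inside one box. *)
Lemma bump_volume_torus : exists2 C : R, 0 <= C & forall lambda : R, 1 <= lambda ->
  (@lebesgue_torus R d [set x : V | (0 < bump_base (@torus_square R) lambda x)%R] <=
   (C * lambda `^ (- d%:R))%:E)%E.
Proof.
exists ((2 * 2) ^+ d); first by rewrite exprn_ge0.
move=> lambda l1; have l0 : 0 < lambda by exact: lt_le_trans l1.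
set S := mkset _; have mS : measurable S.
  apply: measurable_bump_base_gt0; exact: square_like_torus.
have mindic : measurable_fun [set: V] (fun x => (\1_S x : R)%:E).
  by apply/measurable_EFinP; exact: measurable_indic.
have <- : (\int[lebesgue_torus d]_x (\1_S x : R)%:E = lebesgue_torus d S)%E.
  by rewrite integral_indic ?setIT.
rewrite -(tm_shift (translation_measure_torus d) (const_mx pi) mindic); last 2 first.
- by move=> x; rewrite lee_fin.
- move=> g Gg x; congr (_%:E); rewrite !indicE; congr (nat_of_bool _)%:R.
  have pb := periodic_bump_base torus_square_periodic lambda Gg x.
  by apply/idP/idP; rewrite !inE /S /= pb.
rewrite integral_mrestr//; last first.
  exact: (measurableT_comp mindic (measurable_row_shift _)).
pose S' := [set x | torus_cell x /\ S (x + const_mx pi)].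
have mS' : measurable S'.
  apply: measurableI; first exact: measurable_torus_cell.
  by have := @measurable_row_shift R d (const_mx pi) measurableT _ mS; rewrite setTI.
rewrite (eq_integral (fun x => (\1_S' x : R)%:E)); last first.
  move=> x; rewrite inE => cx; congr (_%:E); rewrite !indicE; congr (nat_of_bool _)%:R.
  by apply/idP/idP; rewrite !inE; [split|case].
rewrite integral_indic//; last exact: measurable_torus_cell.
apply: (@le_trans _ _ (lebesgue_row d S')).
  apply: le_measure; rewrite ?inE//; apply: measurableI => //; exact: measurable_torus_cell.
apply: (@lebesgue_row_le_cube pi) => // x [cx Sx] l.
apply: torus_square_lt => //; first by have /andP[? ?] := cx l; apply/andP; split; lra.
have := bump_base_gt0_coord l square_like_torus Sx; rewrite !mxE.
by rewrite /torus_square cosDpi cosB cospi sinpi mulr0 addr0 mulrN1.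
Qed.

End bump_volume.

(** * Necessity *)

Section embedding_failure.
Context {R : realType} (d : nat).
Local Notation V := 'rV[R]_d.
Variables (mu : {measure set V -> \bar R}) (G : set V).
Hypothesis tmu : translation_measure mu G.
Local Notation X := [set F : V -> R | invariant_by G F].

Lemma mem_Lfun (r : \bar R) (f : V -> R) : measurable_fun [set: V] f ->
  ('N[mu]_r[EFin \o f] < +oo)%E -> f \in Lfun mu r.
Proof. by move=> mf Lf; rewrite inE; apply/andP; split; rewrite inE. Qed.

Lemma Lfun_measurable (r : \bar R) (f : V -> R) : f \in Lfun mu r -> measurable_fun [set: V] f.
Proof. by move=> /sub_Lfun_mfun; rewrite inE. Qed.

Lemma measure_setT_gt0 : (0 < mu [set: V])%E.
Proof.
rewrite lt0e measure_ge0 andbT; apply/eqP => mu0.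
have [||y []] := tm_dense (P := set0) tmu 0 ltr01.
  by [].
by exists [set: V]; split.
Qed.

(** A violation would persist in a neighbourhood, which meets every invariant set
    of full measure. *)
Lemma continuous_ae_le (f : V -> R) (c : R) : continuous f -> invariant_by G f ->
  {ae mu, forall x, `|f x| <= c} -> forall x, `|f x| <= c.
Proof.
move=> cf If ae x; rewrite leNgt; apply/negP => cx.
have /nbhs_ballP[e /= e0 he] : \forall y \near x, c < `|f y|.
  have /(_ _ _) := continuous_comp (cf x) (@norm_continuous _ _ (f x)).
  by move=> /cvgr_gt/(_ _ cx).
have [|y /= hy xy] := tm_dense (P := [set x | `|f x| <= c]) tmu x e0 _ ae.
  by move=> g Gg z /=; rewrite If.
suff /he : ball x e y by rewrite ltNge hy.
split=> // i j; rewrite (ord1 i) /ball /= distrC.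
by have /andP[h1 h2] := xy j; rewrite ger0_norm ?subr_ge0//; lra.
Qed.

Lemma Lnorm_infty_le (f : V -> R) (c : R) : 
  ('N[mu]_+oo[EFin \o f] <= c%:E)%E <-> {ae mu, forall x, `|f x| <= c}.
Proof.
rewrite unlock measure_setT_gt0; split.
  by move/ess_sup_inf.ess_supP; apply: filterS => x /=; rewrite lee_fin.
by move=> ae; apply/ess_sup_inf.ess_supP; apply: filterS ae => x /=; rewrite lee_fin.
Qed.

Variables (alpha p b : R) (q : \bar R) (kappa : R -> R).
Hypotheses (alpha0 : 0 < alpha) (p1 : 1 <= p) (q0 : (0 < q)%E) (hb : (q^-1 < b%:E)%E).
Hypothesis sq : square_like kappa.
Hypothesis kappaG : forall g, G g -> forall (x : V) l, kappa ((x + g) ord0 l) = kappa (x ord0 l).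
Hypothesis kappa_volume : exists2 C : R, 0 <= C & forall lambda : R, 1 <= lambda ->
  (mu [set x | (0 < bump_base kappa lambda x)%R] <= (C * lambda `^ (- d%:R))%:E)%E.
Local Notation L f := ('N[mu]_(p%:E)[EFin \o f%R])%E.

Lemma lip_seminorm_ge0 f : (0 <= lip_seminorm mu alpha b p q f)%E.
Proof.
have w0 t : 0 < t -> (0 <= lip_weighted mu alpha b p f t)%E.
  by move=> t0; rewrite mule_ge0 ?(modulus_ge0 _ _ _ _ (ltW t0))// lee_fin mulr_ge0// powR_ge0.
rewrite /lip_seminorm; case: q => [r||//]; first exact: poweR_ge0.
have t0 : 0 < 2^-1 :> R by rewrite invr_gt0.
apply: le_trans (w0 _ t0) _; apply: ereal_sup_ubound; exists 2^-1 => //=.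
rewrite in_itv/= t0/=; lra.
Qed.

(** The difference of the zero function is a limit of zero sums; the bounds proved
    for general functions give its norm. *)
Lemma lip_norm0_lty : (lip_norm mu alpha b p q (fun=> 0%R) < +oo)%E.
Proof.
have [lambda l1 hl] := lip_norm_small mu p alpha0 q0 hb (lexx 0) ltr01.
have L0 : L (fun=> 0) = 0%E by rewrite [X in Lnorm _ _ X](_ : _ = cst 0%E)// Lnorm0// gt_eqF// lte_fin (lt_le_trans _ p1).
have h0 : periodic_mfun G (fun=> 0) by split.
apply: lt_trans (ltry 1); apply: hl => [|t _]; first by rewrite mul0r L0.
rewrite mul0r; apply: ge_ereal_sup => _ [h _ <-].
rewrite (Lnorm_frac_diff p tmu)//.
have [C C0 /(_ h _ h0)] := Lnorm_fdiff_le tmu p1 alpha0.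
by rewrite L0 mule0; apply.
Qed.

(** Continuity of the inclusion at 0 is contradicted by bumps of small norm, whose
    value at the origin is 1. *)
Lemma not_embeds_small_bumps (B : fun_space) : alpha <= d%:R / p ->
  (forall f, periodic_mfun G f -> continuous f -> (forall x, `|f x| <= 1) -> carrier B f) ->
  (forall f : V -> R, continuous f -> invariant_by G f -> (fnorm B f < (2^-1)%:E)%E -> `|f 0| <= 2^-1) ->
  ~ embeds mu (Lip_space mu X alpha b p q) B.
Proof.
move=> ap Bf normB [_ emb].
have z0 : periodic_mfun G (fun=> 0) by split.
have carr f : periodic_mfun G f -> (lip_norm mu alpha b p q f < +oo)%E ->
    carrier (Lip_space mu X alpha b p q) f.
  move=> [mf If] lf; split => //; apply: mem_Lfun => //.
  apply: le_lt_trans lf; rewrite leeDl//; exact: lip_seminorm_ge0.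
have half : 0 < 2^-1 :> R by rewrite invr_gt0.
have B0 : carrier B (fun=> 0).
  by apply: Bf => // x; [exact: cst_continuous|rewrite normr0].
have [r r0 hr] := emb _ _ (carr _ z0 lip_norm0_lty) B0 (filterE _ (fun x _ => erefl)) _ half.
have [f [hf cf f0 f1 fr]] := small_bumps tmu alpha0 p1 q0 hb sq kappaG kappa_volume ap r0.
have fE : (f \- (fun=> 0)) = f by apply/funext => x /=; rewrite subr0.
have ff : f = f %[ae mu] by exact: filterE.
have := hr f f (carr _ hf (lt_trans fr (ltry _))) (Bf _ hf cf f1) ff.
rewrite fE => /(_ fr)/(normB _ cf hf.2); rewrite f0 normr1; lra.
Qed.

Lemma embeds_Linfty_lt : embeds mu (Lip_space mu X alpha b p q) (Linfty_space mu X) ->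
  d%:R / p < alpha.
Proof.
rewrite ltNge => emb; apply/negP => ap; apply: not_embeds_small_bumps emb => //.
- move=> f [mf If] cf f1; split => //; apply: mem_Lfun => //.
  by apply: (@le_lt_trans _ _ 1%:E); [apply/Lnorm_infty_le; exact: filterE|exact: ltry].
- move=> f cf If /ltW /Lnorm_infty_le ae; exact: (continuous_ae_le cf If ae).
Qed.

Lemma embeds_C_lt : embeds mu (Lip_space mu X alpha b p q) (C_space X) -> d%:R / p < alpha.
Proof.
rewrite ltNge => emb; apply/negP => ap; apply: not_embeds_small_bumps emb => //.
- move=> f [mf If] cf f1; split => //; apply: (@le_lt_trans _ _ 1%:E); last exact: ltry.
  by apply: ge_ereal_sup => _ [x _ <-]; rewrite lee_fin.
- move=> f cf If /ltW h; rewrite -lee_fin; apply: le_trans h.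
  by apply: ereal_sup_ubound; exists 0.
Qed.

End embedding_failure.

(** * Local integrals *)

Section local_integrals.
Context {R : realType} (d : nat).
Local Notation V := 'rV[R]_d.
Variables (mu : {measure set V -> \bar R}) (G : set V) (p : R).
Hypotheses (tmu : translation_measure mu G) (p1 : 1 < p).
Local Notation lam := (lebesgue_row d).
Local Notation L f := ('N[mu]_(p%:E)[EFin \o f%R])%E.

(** The dilation by [c >= 1] maps the box into a unit cube, on which [mu] dominates
    Lebesgue measure; its Jacobian is at least 1. *)
Lemma ge0_integral_dilated_box_le (F : V -> \bar R) (a x : V) (c t : R) :
  measurable_fun [set: V] F -> (forall y, 0 <= F y)%E -> invariant_by G F ->
  1 <= c -> c * t <= 1 ->
  (\int[lam]_(h in box a (a + const_mx t)) F (x + c *: h)%R <= \int[mu]_y F y)%E.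
Proof.
move=> mF F0 GF c1 ct; have c0 : 0 < c by exact: lt_le_trans c1.
pose I (y : V) : \bar R := (\1_(@cube R d 1) y)%:E.
have mI : measurable_fun [set: V] I.
  by apply/measurable_EFinP; apply: measurable_indic; exact: measurable_box.
have I0 y : (0 <= I y)%E by rewrite lee_fin.
pose w := x + c *: a.
pose K y := (I (y - w)%R * F y)%E.
have mK : measurable_fun [set: V] K.
  apply: emeasurable_funM => //; apply: (measurableT_comp mI); exact: measurable_row_shift.
have K0 y : (0 <= K y)%E by rewrite mule_ge0.
apply: (@le_trans _ _ (\int[lam]_h K (x + c *: h)%R)%E).
  rewrite integral_mkcond; apply: ge0_le_integralT => h _.
    by rewrite patchE; case: ifP.
  rewrite patchE; case: ifPn => // hbox; rewrite /K /I indicE mem_set ?mul1e//.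
  move=> i; rewrite !mxE; have := set_mem hbox i; rewrite !mxE => /andP[h1 h2].
  rewrite (_ : _ - _ = c * (h ord0 i - a ord0 i)); last by ring.
  rewrite mulr_ge0 ?subr_ge0 ?(ltW c0)//= (lt_le_trans _ ct)// ltr_pM2l//; lra.
apply: (@le_trans _ _ (\int[lam]_y K y)%E).
  rewrite (ge0_integral_row_affine x c0 mK K0) -[leLHS]mul1e lee_wpmul2r ?integral_ge0//.
  by rewrite lee_fin exprn_ege1.
rewrite -(ge0_integral_row_shift w mK K0).
have GFw : invariant_by G (fun y => F (y + w)) by move=> g Gg y; rewrite addrAC (GF g Gg).
have mFw : measurable_fun [set: V] (fun y => F (y + w)).
  by apply: (measurableT_comp mF); exact: measurable_row_shift.
rewrite -(tm_shift tmu w mF F0 GF); apply: le_trans (tm_cube tmu mFw (fun y => F0 _)).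
rewrite [leRHS]integral_mkcond; apply: ge0_le_integralT => y _; first exact: K0.
rewrite /K addrK /I indicE patchE; case: ifP => _; first by rewrite mul1e.
by rewrite mul0e.
Qed.

(** Hoelder's inequality on [S]; by [ge0_integral_dilated_box_le] the L_p norm over
    [S] is at most the full one. *)
Lemma local_integral_le (g : V -> R) (S : set V) (a x : V) (c t : R) :
  periodic_mfun G g -> measurable S -> S `<=` box a (a + const_mx t) ->
  1 <= c -> c * t <= 1 ->
  (\int[lam]_(h in S) `|g (x + c *: h)|%:E <= lam S `^ (1 - p^-1) * L g)%E.
Proof.
move=> [mg Gg] mS Sbox c1 ct; have p0 : 0 < p by exact: lt_trans p1.
have c0 : 0 < c by exact: lt_le_trans c1.
pose r := (1 - p^-1)^-1.
have ip1 : p^-1 < 1 by rewrite invf_lt1.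
have r0 : 0 < r by rewrite invr_gt0 subr_gt0.
pose u : V -> R := \1_S; pose v h := u h * g (x + c *: h).
have mu_ : measurable_fun [set: V] u by exact: measurable_indic.
have mgx : measurable_fun [set: V] (fun h => g (x + c *: h)).
  by apply: (measurableT_comp mg); exact: measurable_row_affine.
have mv : measurable_fun [set: V] v by exact: measurable_funM.
have uu h : u h * u h = u h by rewrite /u indicE; case: (_ \in _); rewrite ?mulr1 ?mulr0.
have uabs h : `|u h| = u h by rewrite /u indicE ger0_norm.
have -> : (\int[lam]_(h in S) `|g (x + c *: h)|%:E = 'N[lam]_1[EFin \o (u \* v)%R])%E.
  rewrite Lnorm1 [LHS]integral_mkcond; apply: eq_integral => h _.
  rewrite /= /v mulrA uu patchE normrM uabs /u indicE.
  by case: ifP => _; rewrite ?mul1r ?mul0r.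
apply: (le_trans (hoelder lam mu_ mv r0 p0 _)).
  by rewrite /r invrK subrK.
apply: lee_pmul; [exact: Lnorm_ge0|exact: Lnorm_ge0| |].
  rewrite unlock /Lnorm /r invrK le_eqVlt; apply/orP; left; apply/eqP; congr (_ `^ _)%E.
  rewrite -[S in RHS]setIT -integral_indic//; apply: eq_integral => h _.
  rewrite /= uabs /u indicE; case: (_ \in _); rewrite ?powR1// powR0// gt_eqF//.
rewrite unlock /Lnorm; apply: gt0_ler_poweR.
- by rewrite invr_ge0 ltW.
- by rewrite in_itv/= leey andbT integral_ge0// => h _; exact: poweR_ge0.
- by rewrite in_itv/= leey andbT integral_ge0// => h _; exact: poweR_ge0.
pose F y := (`|(EFin \o g) y| `^ p)%E.
have mF : measurable_fun [set: V] F.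
  apply: (measurableT_comp (measurable_poweR _)) => //.
  by apply: measurableT_comp => //; exact/measurable_EFinP.
have F0 y : (0 <= F y)%E by exact: poweR_ge0.
have GF : invariant_by G F by move=> z Gz y; rewrite /F /= Gg.
apply: le_trans (ge0_integral_dilated_box_le a x mF F0 GF c1 ct).
rewrite [leRHS]integral_mkcond; apply: ge0_le_integralT => h _; first exact: poweR_ge0.
rewrite patchE /= /v normrM uabs /u indicE.
case: ifPn => [|hb]; last first.
  rewrite memNset ?mul0r ?powR0 ?gt_eqF//; apply: contraNnot hb => /Sbox hb.
  exact: mem_set.
by case: (h \in S) => _; rewrite ?mul1r// mul0r powR0 ?lee_fin ?powR_ge0// gt_eqF.
Qed.

Lemma local_integrable (g : V -> R) (S : set V) (a x : V) (c t : R) :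
  periodic_mfun G g -> (L g < +oo)%E -> measurable S -> S `<=` box a (a + const_mx t) ->
  1 <= c -> 0 <= t -> c * t <= 1 ->
  lam.-integrable S (fun h => (g (x + c *: h))%:E).
Proof.
move=> hg Lg mS Sbox c1 t0 ct; apply/integrableP; split.
  apply: measurable_funTS; apply/measurable_EFinP.
  by apply: (measurableT_comp hg.1); exact: measurable_row_affine.
apply: (le_lt_trans (local_integral_le x hg mS Sbox c1 ct)).
have c0 : 0 < c by exact: lt_le_trans c1.
have ltS : (lam S < +oo)%E.
  apply: (@le_lt_trans _ _ (lam (box a (a + const_mx t)))).
    by apply: le_measure => //; rewrite inE//; exact: measurable_box.
  by rewrite lebesgue_row_box ?ltry// => i; rewrite !mxE lerDl.
rewrite lte_mul_pinfty ?poweR_ge0 ?poweR_lty//.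
by rewrite ge0_fin_numE ?poweR_ge0// poweR_lty.
Qed.

End local_integrals.

(** * Means over cubes *)

Section tonelli.
Context {R : realType} (d : nat).
Local Notation V := 'rV[R]_d.
Local Notation lam := (@lebesgue_row R d).

Lemma measurable_row_comb (x : V) (a c : R) :
  measurable_fun [set: V * V] (fun z : V * V => x + a *: z.1 + c *: z.2).
Proof.
apply: measurable_fun_rowP => i; rewrite /row_coord /=.
rewrite [X in measurable_fun _ X](_ : _ = (fun z : V * V =>
    (x ord0 i + a * row_coord i z.1) + c * row_coord i z.2)); last first.
  by apply/funext => z; rewrite /row_coord /= !mxE.
apply: measurable_funD; first apply: measurable_funD => //.
  apply: measurable_funM => //; apply: (measurableT_comp (measurable_row_coord i)).
  exact: measurable_fst.
apply: measurable_funM => //; apply: (measurableT_comp (measurable_row_coord i)).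
exact: measurable_snd.
Qed.

Variables (A B : set V) (F : V * V -> \bar R).
Hypotheses (mA : measurable A) (mB : measurable B).
Hypotheses (mF : measurable_fun [set: V * V] F) (F0 : forall z, (0 <= F z)%E).

Let cut (z : V * V) : \bar R := ((\1_A z.1 : R)%:E * (\1_B z.2 : R)%:E * F z)%E.

Let m1 : measurable_fun [set: V * V] (fun z : V * V => (\1_A z.1 : R)%:E).
Proof.
apply/measurable_EFinP.
have mi : measurable_fun [set: V] (\1_A : V -> R) by exact: measurable_indic.
exact: (measurableT_comp mi measurable_fst).
Qed.

Let m2 : measurable_fun [set: V * V] (fun z : V * V => (\1_B z.2 : R)%:E).
Proof.
apply/measurable_EFinP.
have mi : measurable_fun [set: V] (\1_B : V -> R) by exact: measurable_indic.
exact: (measurableT_comp mi measurable_snd).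
Qed.

Let mcut : measurable_fun [set: V * V] cut.
Proof. by apply: emeasurable_funM => //; exact: emeasurable_funM. Qed.

Let cutE x y : cut (x, y) =
  if x \in A then if y \in B then F (x, y) else 0%E else 0%E.
Proof.
rewrite /cut /= !indicE; case: (x \in A); last by rewrite !mul0e.
by case: (y \in B); rewrite mul1e ?mul1e// mul0e.
Qed.

Let cut0 z : (0 <= cut z)%E.
Proof. by rewrite mule_ge0// mule_ge0// lee_fin. Qed.

Lemma measurable_integral_snd : measurable_fun [set: V] (fun x => \int[lam]_(y in B) F (x, y))%E.
Proof.
pose H (z : V * V) : \bar R := ((\1_B z.2 : R)%:E * F z)%E.
have mH : measurable_fun [set: V * V] H.
  exact: emeasurable_funM.
have H0 z : (0 <= H z)%E by rewrite mule_ge0// lee_fin.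
have := @measurable_fun_fubini_tonelli_F _ _ _ _ _ lam _ mH H0.
congr (measurable_fun _ _); apply/funext => x.
rewrite /fubini_F [RHS]integral_mkcond; apply: eq_integral => y _.
by rewrite patchE /H /= indicE; case: ifP => _; rewrite ?mul1e ?mul0e.
Qed.

Let h1 : (\int[lam]_(x in A) \int[lam]_(y in B) F (x, y) = \int[lam]_x \int[lam]_y cut (x, y))%E.
Proof.
rewrite integral_mkcond; apply: eq_integral => x _; rewrite patchE.
case: ifPn => xA; last first.
  by rewrite [RHS]integral0_eq// => y _; rewrite cutE (negbTE xA).
rewrite [LHS]integral_mkcond; apply: eq_integral => y _.
by rewrite patchE cutE xA.
Qed.

Let h2 : (\int[lam]_(y in B) \int[lam]_(x in A) F (x, y) = \int[lam]_y \int[lam]_x cut (x, y))%E.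
Proof.
rewrite integral_mkcond; apply: eq_integral => y _; rewrite patchE.
case: ifPn => yB; last first.
  by rewrite [RHS]integral0_eq// => x _; rewrite cutE (negbTE yB); case: ifP.
rewrite [LHS]integral_mkcond; apply: eq_integral => x _.
by rewrite patchE cutE yB.
Qed.

(** Tonelli's theorem on the whole space, applied to the function cut off to the
    product set. *)
Lemma fubini_tonelli_set :
  (\int[lam]_(x in A) \int[lam]_(y in B) F (x, y) =
   \int[lam]_(y in B) \int[lam]_(x in A) F (x, y))%E.
Proof.
rewrite h1 h2; exact: (@fubini_tonelli _ _ _ _ _ lam lam _ mcut cut0).
Qed.

End tonelli.

Section means.
Context {R : realType} (d : nat).
Local Notation V := 'rV[R]_d.
Local Notation lam := (@lebesgue_row R d).

Lemma integral_cube_cst (t c : R) : 0 <= t ->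
  (\int[lam]_(h in @cube R d t) c%:E = (c * t ^+ d)%:E)%E.
Proof.
move=> t0; rewrite integral_cst; last exact: measurable_box.
rewrite EFinM; congr (_ * _)%E; exact: lebesgue_row_cube.
Qed.

Definition mean (t : R) (u : V -> R) : R := t^-1 ^+ d * Rintegral lam (cube t) u.

(** The mean of the constant [c] is [c]. *)
Lemma mean_dist_le (t c : R) (u : V -> R) : 0 < t ->
  lam.-integrable (cube t) (EFin \o u) ->
  (`|mean t u - c|%:E <= (t^-1 ^+ d)%:E * \int[lam]_(h in cube t) `|u h - c|%:E)%E.
Proof.
move=> t0 iu; have mQ : measurable (cube t : set V) by exact: measurable_box.
have lamQ : lam (cube t) = (t ^+ d)%:E by rewrite lebesgue_row_cube// ltW.
have ic : lam.-integrable (cube t) (EFin \o (fun=> c)).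
  apply/integrableP; split; first by apply: measurable_funTS; exact: measurable_cst.
  rewrite (eq_integral (cst `|c%:E|%E))// integral_cst//.
  have lQ : (lam (cube t) < +oo)%E by rewrite lamQ ltry.
  by apply: lte_mul_pinfty.
have iuc : lam.-integrable (cube t) (EFin \o (fun h => u h - c)).
  by rewrite (_ : _ \o _ = (EFin \o u) \- (EFin \o (fun=> c)))%E//; exact: integrableB.
have -> : mean t u - c = t^-1 ^+ d * Rintegral lam (cube t) (fun h => u h - c).
  rewrite RintegralB// Rintegral_cst//.
  have fl : fine (lam (cube t)) = t ^+ d by rewrite lamQ.
  rewrite [fine _](_ : _ = t ^+ d); last exact: fl.
  rewrite mulrBr; congr (_ - _).
  by rewrite mulrCA -exprMn mulVf ?gt_eqF// expr1n mulr1.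
have ti : 0 <= t^-1 ^+ d by rewrite exprn_ge0// invr_ge0 ltW.
rewrite normrM (ger0_norm ti) EFinM lee_wpmul2l ?lee_fin//.
apply: (@le_trans _ _ (Rintegral lam (cube t) (fun h => `|u h - c|))%:E).
  by rewrite lee_fin; exact: le_normr_Rintegral.
rewrite /Rintegral fineK//; apply: integrable_fin_num => //.
exact: (integrable_norm iuc).
Qed.

Lemma mean_mean_dist_le (t t' : R) (u v : V -> R) : 0 < t -> 0 < t' ->
  lam.-integrable (cube t) (EFin \o u) -> lam.-integrable (cube t') (EFin \o v) ->
  (`|mean t u - mean t' v|%:E <= (t^-1 ^+ d)%:E * \int[lam]_(h in cube t)
     ((t'^-1 ^+ d)%:E * \int[lam]_(k in cube t') `|u h - v k|%:E))%E.
Proof.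
move=> t0 t'0 iu iv; apply: (le_trans (mean_dist_le _ t0 iu)).
rewrite lee_wpmul2l ?lee_fin ?exprn_ge0 ?invr_ge0 ?(ltW t0)//.
apply: ge0_le_integralT => h _; first by rewrite lee_fin.
rewrite distrC; apply: (le_trans (mean_dist_le _ t'0 iv)).
rewrite lee_wpmul2l ?lee_fin ?exprn_ge0 ?invr_ge0 ?(ltW t'0)//.
by apply: ge0_le_integralT => k _; rewrite lee_fin// distrC.
Qed.

End means.

(** * Averaged differences *)

Section averaged_differences.
Context {R : realType} (d : nat).
Local Notation V := 'rV[R]_d.
Variables (mu : {measure set V -> \bar R}) (G : set V) (p alpha Cs : R).
Hypotheses (tmu : translation_measure mu G) (p1 : 1 < p).
Hypotheses (Cs0 : 0 <= Cs) (hCs : forall n, \sum_(j < n) `|dcoef alpha j| <= Cs).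
Local Notation lam := (@lebesgue_row R d).
Local Notation L f := ('N[mu]_(p%:E)[EFin \o f%R])%E.
Local Notation vol t := ((t ^+ d) `^ (- p^-1)).

(** The truncated difference of step [- h] without its term [j = 0], with the sign
    that makes it an approximation of [f x]. *)
Definition smooth_sum (J : nat) (f : V -> R) (x h : V) : R :=
  - \sum_(1 <= j < J.+1) dcoef alpha j * f (x + j%:R *: h).

Lemma pdiff_smooth_sum J f x h : pdiff alpha (- h) J.+1 f x = f x - smooth_sum J f x h.
Proof.
rewrite /pdiff /smooth_sum opprK.
rewrite -(big_mkord xpredT (fun j => dcoef alpha j * f (x - j%:R *: - h))).
rewrite big_nat_recl// dcoef0 mul1r scale0r subr0; congr (_ + _).
rewrite big_add1 /=; apply: eq_bigr => j _.
by rewrite scalerN opprK.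
Qed.

Lemma sum_dcoef_from1 J : \sum_(1 <= j < J.+1) `|dcoef alpha j| <= Cs.
Proof.
apply: le_trans (hCs J.+1); rewrite -(big_mkord xpredT (fun j => `|dcoef alpha j|)).
by rewrite [leRHS]big_nat_recl// big_add1 lerDr.
Qed.

Lemma measurable_pdiff_pair n (f : V -> R) (x : V) (a : R) : measurable_fun [set: V] f ->
  measurable_fun [set: V * V] (fun z : V * V => pdiff alpha (- z.2) n f (x + a *: z.1)).
Proof.
move=> mf; apply: measurable_sum => j; apply: measurable_funM => //.
rewrite [X in measurable_fun _ X](_ : _ = (fun z : V * V => f (x + a *: z.1 + j%:R *: z.2))).
  by apply: (measurableT_comp mf); exact: measurable_row_comb.
by apply/funext => z; rewrite scalerN opprK.
Qed.

(** Each term integrates over the cube as in [local_integral_le], which applies as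
    [j * t <= J * t <= 1]. *)
Lemma integral_weighted_sum_le (g : V -> R) (B t : R) (J : nat) (x : V) :
  periodic_mfun G g -> (L g <= B%:E)%E -> 0 < t -> J%:R * t <= 1 ->
  (\int[lam]_(h in cube t) (\sum_(1 <= j < J.+1) `|dcoef alpha j| * `|g (x + j%:R *: h)|)%:E
   <= (Cs * ((t ^+ d) `^ (1 - p^-1) * B))%:E)%E.
Proof.
move=> hg LB t0 Jt; have mQ : measurable (cube t : set V) by exact: measurable_box.
have tp : 0 <= (t ^+ d) `^ (1 - p^-1) by exact: powR_ge0.
have B0 : 0 <= B by rewrite -lee_fin (le_trans _ LB)// Lnorm_ge0.
have mg j : measurable_fun [set: V] (fun h => `|g (x + j%:R *: h)|%:E).
  apply/measurable_EFinP; apply: measurableT_comp => //.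
  by apply: (measurableT_comp hg.1); exact: measurable_row_affine.
under eq_integral do rewrite -sumEFin.
under eq_integral do under eq_bigr do rewrite EFinM.
rewrite ge0_integral_sum; last 3 first.
- exact: mQ.
- by move=> j; apply: measurable_funTS; apply: measurable_funeM.
- by move=> j h _; rewrite mule_ge0 ?lee_fin.
apply: (@le_trans _ _ (\sum_(1 <= j < J.+1) (`|dcoef alpha j| * ((t ^+ d) `^ (1 - p^-1) * B))%:E)%E).
  rewrite big_nat [leRHS]big_nat; apply: lee_sum => j /andP[j1 jJ].
  rewrite ge0_integralZl//; last exact: measurable_funTS.
  rewrite EFinM lee_wpmul2l ?lee_fin//.
  have jt : j%:R * t <= 1 by apply: le_trans Jt; rewrite ler_wpM2r ?(ltW t0)// ler_nat.
  apply: (le_trans (@local_integral_le _ _ _ _ _ tmu p1 g (cube t) 0 x j%:R t hg mQ _ _ jt)).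
  - by rewrite add0r.
  - by rewrite ler1n.
  rewrite lebesgue_row_cube ?(ltW t0)// poweR_EFin EFinM lee_wpmul2l ?lee_fin//.
rewrite sumEFin lee_fin -mulr_suml ler_wpM2r ?mulr_ge0//; exact: sum_dcoef_from1.
Qed.

Lemma invVol t : 0 < t -> t^-1 ^+ d * (t ^+ d) `^ (1 - p^-1) = vol t.
Proof.
move=> t0; have td : 0 < t ^+ d by rewrite exprn_gt0.
rewrite powRD; last by rewrite (gt_eqF td) implybT.
by rewrite powRr1 ?(ltW td)// mulrA exprVn mulVf ?mul1r// gt_eqF.
Qed.

Lemma smooth_sum_integrable (f : V -> R) (t : R) (J : nat) (x : V) :
  periodic_mfun G f -> (L f < +oo)%E -> 0 < t -> J%:R * t <= 1 ->
  lam.-integrable (cube t) (EFin \o smooth_sum J f x).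
Proof.
move=> hf Lf t0 Jt; have mQ : measurable (cube t : set V) by exact: measurable_box.
rewrite (_ : _ \o _ = (fun h => \sum_(1 <= j < J.+1 | (1 <= j < J.+1)%N) (- dcoef alpha j)%:E * (f (x + j%:R *: h))%:E)%E); last first.
  apply/funext => h; rewrite /= /smooth_sum -sumrN -sumEFin -big_nat.
  by apply: eq_bigr => j _; rewrite -EFinM mulNr.
apply: integrable_sum => // j /andP[j1 jJ]; apply: integrableZl => //.
have jt : j%:R * t <= 1 by apply: le_trans Jt; rewrite ler_wpM2r ?(ltW t0)// ler_nat.
apply: (@local_integrable _ _ _ _ _ tmu p1 f (cube t) 0 x j%:R t) => //.
- by rewrite add0r.
- by rewrite ler1n.
- exact: ltW.
Qed.

(** Insert f = (truncated difference) + (smooth sum of the other scale) into each of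
    the two sums. The double sums over both scales that appear are equal, so they
    cancel, and only truncated differences are left. *)
Lemma normr_smooth_sum_sub_le (f : V -> R) (J J' : nat) (x h k : V) :
  `|smooth_sum J f x h - smooth_sum J' f x k| <=
   \sum_(1 <= i < J.+1) `|dcoef alpha i| * `|pdiff alpha (- k) J'.+1 f (x + i%:R *: h)| +
   \sum_(1 <= j < J'.+1) `|dcoef alpha j| * `|pdiff alpha (- h) J.+1 f (x + j%:R *: k)|.
Proof.
have E : smooth_sum J f x h - smooth_sum J' f x k =
   - (\sum_(1 <= i < J.+1) dcoef alpha i * pdiff alpha (- k) J'.+1 f (x + i%:R *: h)) +
   \sum_(1 <= j < J'.+1) dcoef alpha j * pdiff alpha (- h) J.+1 f (x + j%:R *: k).
  rewrite (eq_bigr (fun i => dcoef alpha i * f (x + i%:R *: h) -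
      dcoef alpha i * smooth_sum J' f (x + i%:R *: h) k)); last first.
    by move=> i _; rewrite pdiff_smooth_sum mulrBr.
  rewrite [X in _ = _ + X](eq_bigr (fun j => dcoef alpha j * f (x + j%:R *: k) -
      dcoef alpha j * smooth_sum J f (x + j%:R *: k) h)); last first.
    by move=> i _; rewrite pdiff_smooth_sum mulrBr.
  rewrite !sumrB.
  have -> : \sum_(1 <= i < J.+1) dcoef alpha i * smooth_sum J' f (x + i%:R *: h) k =
            \sum_(1 <= j < J'.+1) dcoef alpha j * smooth_sum J f (x + j%:R *: k) h.
    rewrite /smooth_sum.
    under eq_bigr do rewrite mulrN mulr_sumr.
    under [RHS]eq_bigr do rewrite mulrN mulr_sumr.
    rewrite !sumrN exchange_big /=; congr (- _).
    apply: eq_bigr => j _; apply: eq_bigr => i _.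
    by rewrite mulrCA addrAC.
  rewrite {1 2}/smooth_sum; ring.
rewrite E; apply: (le_trans (ler_normD _ _)); rewrite normrN.
by apply: lerD; apply: (le_trans (ler_norm_sum _ _ _));
  apply: ler_sum => i _; rewrite normrM.
Qed.

(** In the first of the two sums of [normr_smooth_sum_sub_le] the difference of step
    [k] is evaluated along the progression of step [h], so integrating over [h]
    first gives a local integral of a function of small L_p norm; in the second
    sum the roles are exchanged, whence Tonelli's theorem. *)
Lemma mean_smooth_sum_dist (f : V -> R) (t t' B B' : R) (J J' : nat) (x : V) :
  periodic_mfun G f -> (L f < +oo)%E -> 0 < t -> 0 < t' -> J%:R * t <= 1 -> J'%:R * t' <= 1 ->
  (forall h, cube t h -> (L (pdiff alpha (- h) J.+1 f) <= B%:E)%E) ->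
  (forall h, cube t' h -> (L (pdiff alpha (- h) J'.+1 f) <= B'%:E)%E) ->
  `|mean t (smooth_sum J f x) - mean t' (smooth_sum J' f x)| <= Cs * (vol t * B' + vol t' * B).
Proof.
move=> hf Lf t0 t'0 Jt J't' hB hB'.
have mQ : measurable (cube t : set V) by exact: measurable_box.
have mQ' : measurable (cube t' : set V) by exact: measurable_box.
have iS := smooth_sum_integrable x hf Lf t0 Jt.
have iS' := smooth_sum_integrable x hf Lf t'0 J't'.
rewrite -lee_fin; apply: (le_trans (mean_mean_dist_le t0 t'0 iS iS')).
pose G1 (z : V * V) := (\sum_(1 <= i < J.+1) `|dcoef alpha i| * `|pdiff alpha (- z.2) J'.+1 f (x + i%:R *: z.1)|)%:E.
pose G2 (z : V * V) := (\sum_(1 <= j < J'.+1) `|dcoef alpha j| * `|pdiff alpha (- z.1) J.+1 f (x + j%:R *: z.2)|)%:E.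
have G10 z : (0 <= G1 z)%E by rewrite lee_fin sumr_ge0// => i _; rewrite mulr_ge0.
have G20 z : (0 <= G2 z)%E by rewrite lee_fin sumr_ge0// => i _; rewrite mulr_ge0.
have mG1 : measurable_fun [set: V * V] G1.
  apply/measurable_EFinP; apply: measurable_sum => i; apply: measurable_funM => //.
  by apply: measurableT_comp => //; exact: measurable_pdiff_pair hf.1.
have mG2 : measurable_fun [set: V * V] G2.
  apply/measurable_EFinP; apply: measurable_sum => i; apply: measurable_funM => //.
  apply: measurableT_comp => //.
  by have := measurableT_comp (measurable_pdiff_pair J.+1 x i%:R hf.1) (@measurable_swap _ _ V V).
have ti : (0 <= (t^-1 ^+ d)%:E)%E by rewrite lee_fin exprn_ge0// invr_ge0 ltW.
have t'i : (0 <= (t'^-1 ^+ d)%:E)%E by rewrite lee_fin exprn_ge0// invr_ge0 ltW.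
have c1 : (\int[lam]_(h in cube t) \int[lam]_(k in cube t') G1 (h, k) <=
    (Cs * ((t ^+ d) `^ (1 - p^-1) * B') * t' ^+ d)%:E)%E.
  rewrite fubini_tonelli_set//.
  apply: (@le_trans _ _ (\int[lam]_(k in cube t') (Cs * ((t ^+ d) `^ (1 - p^-1) * B'))%:E)%E).
    apply: ge0_le_integralT => k Qk; first exact: integral_ge0.
    have hp := periodic_mfun_pdiff alpha (- k) J'.+1 hf.
    have hw := integral_weighted_sum_le x hp (hB' k Qk) t0 Jt.
    exact: hw.
  by rewrite integral_cube_cst// ltW.
have c2 : (\int[lam]_(h in cube t) \int[lam]_(k in cube t') G2 (h, k) <=
    (Cs * ((t' ^+ d) `^ (1 - p^-1) * B) * t ^+ d)%:E)%E.
  apply: (@le_trans _ _ (\int[lam]_(h in cube t) (Cs * ((t' ^+ d) `^ (1 - p^-1) * B))%:E)%E).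
    apply: ge0_le_integralT => k Qk; first exact: integral_ge0.
    have hp := periodic_mfun_pdiff alpha (- k) J.+1 hf.
    have hw := integral_weighted_sum_le x hp (hB k Qk) t'0 J't'.
    exact: hw.
  by rewrite integral_cube_cst// ltW.
apply: (@le_trans _ _ ((t^-1 ^+ d)%:E * ((t'^-1 ^+ d)%:E *
   (\int[lam]_(h in cube t) \int[lam]_(k in cube t') G1 (h, k) +
    \int[lam]_(h in cube t) \int[lam]_(k in cube t') G2 (h, k))))%E).
  rewrite lee_wpmul2l// -ge0_integralD//; last 4 first.
  - by move=> h _; exact: integral_ge0.
  - by apply: measurable_funTS; exact: measurable_integral_snd.
  - by move=> h _; exact: integral_ge0.
  - by apply: measurable_funTS; exact: measurable_integral_snd.
  rewrite -ge0_integralZl//; last 2 first.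
  - by apply: measurable_funTS; apply: emeasurable_funD; exact: measurable_integral_snd.
  - by move=> h _; rewrite adde_ge0//; exact: integral_ge0.
  apply: ge0_le_integralT => h _.
    by rewrite mule_ge0// integral_ge0// => k _; rewrite lee_fin.
  rewrite lee_wpmul2l// -ge0_integralD//; last 2 first.
  - by apply: measurable_funTS; exact: (measurableT_comp mG1 (measurable_pair1 h)).
  - by apply: measurable_funTS; exact: (measurableT_comp mG2 (measurable_pair1 h)).
  apply: ge0_le_integralT => k _; first by rewrite lee_fin.
  by rewrite -EFinD lee_fin; exact: normr_smooth_sum_sub_le.
apply: (@le_trans _ _ ((t^-1 ^+ d)%:E * ((t'^-1 ^+ d)%:E *
   ((Cs * ((t ^+ d) `^ (1 - p^-1) * B') * t' ^+ d)%:E + (Cs * ((t' ^+ d) `^ (1 - p^-1) * B) * t ^+ d)%:E)))%E).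
  by rewrite !lee_wpmul2l// leeD.
rewrite -EFinD -!EFinM lee_fin le_eqVlt; apply/orP; left; apply/eqP.
rewrite -!invVol// !exprVn; field.
by rewrite !expf_neq0// gt_eqF.
Qed.

Lemma normr_mean_smooth_sum_le (f : V -> R) (t B : R) (J : nat) (x : V) :
  periodic_mfun G f -> (L f <= B%:E)%E -> 0 < t -> J%:R * t <= 1 ->
  `|mean t (smooth_sum J f x)| <= Cs * (vol t * B).
Proof.
move=> hf LB t0 Jt; have ti : 0 <= t^-1 ^+ d by rewrite exprn_ge0// invr_ge0 ltW.
have iS := smooth_sum_integrable x hf (le_lt_trans LB (ltry _)) t0 Jt.
rewrite -lee_fin -[X in `|X|]subr0; apply: (le_trans (mean_dist_le 0 t0 iS)).
rewrite -invVol// -mulrA mulrCA EFinM lee_wpmul2l ?lee_fin//.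
apply: le_trans (integral_weighted_sum_le x hf LB t0 Jt).
apply: ge0_le_integralT => h _; first by rewrite lee_fin.
rewrite lee_fin subr0 normrN (le_trans (ler_norm_sum _ _ _))//.
by apply: ler_sum => j _; rewrite normrM.
Qed.

Definition mean_pdiff (t : R) (J : nat) (f : V -> R) (y : V) : \bar R :=
  ((t^-1 ^+ d)%:E * \int[lam]_(h in cube t) `|pdiff alpha (- h) J.+1 f y|%:E)%E.

Let measurable_pdiff_swap (J : nat) (f : V -> R) : measurable_fun [set: V] f ->
  measurable_fun [set: V * V] (fun z : V * V => `|pdiff alpha (- z.2) J.+1 f z.1|%:E).
Proof.
move=> mf; apply/measurable_EFinP; apply: measurableT_comp => //.
rewrite [X in measurable_fun _ X](_ : _ =
    (fun z : V * V => pdiff alpha (- z.2) J.+1 f (0 + 1 *: z.1))).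
  exact: measurable_pdiff_pair.
by apply/funext => z; rewrite add0r scale1r.
Qed.

Lemma measurable_mean_pdiff t J f : measurable_fun [set: V] f ->
  measurable_fun [set: V] (mean_pdiff t J f).
Proof.
move=> mf; apply: measurable_funeM.
exact: (measurable_integral_snd (measurable_box _ _) (measurable_pdiff_swap J mf)).
Qed.

Lemma mean_pdiff_ge0 t J f y : 0 < t -> (0 <= mean_pdiff t J f y)%E.
Proof.
move=> t0; rewrite mule_ge0//; first by rewrite lee_fin exprn_ge0// invr_ge0 ltW.
by apply: integral_ge0 => h _; rewrite lee_fin.
Qed.

(** For fixed [y] the truncated difference is exactly the error of the smooth sum. *)
Lemma dist_mean_smooth_sum_le (f : V -> R) (t : R) (J : nat) (y : V) :
  periodic_mfun G f -> (L f < +oo)%E -> 0 < t -> J%:R * t <= 1 ->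
  (`|f y - mean t (smooth_sum J f y)|%:E <= mean_pdiff t J f y)%E.
Proof.
move=> hf Lf t0 Jt; have iS := smooth_sum_integrable y hf Lf t0 Jt.
rewrite distrC; apply: (le_trans (mean_dist_le (f y) t0 iS)).
rewrite /mean_pdiff le_eqVlt; apply/orP; left; apply/eqP; congr (_ * _)%E.
by apply: eq_integral => h _; rewrite pdiff_smooth_sum distrC.
Qed.

Lemma integral_mean_pdiff_le (f : V -> R) (t B : R) (J : nat) (a : V) :
  periodic_mfun G f -> 0 < t ->
  (forall h, cube t h -> (L (pdiff alpha (- h) J.+1 f) <= B%:E)%E) ->
  (\int[lam]_(y in box a (a + const_mx 1)%R) mean_pdiff t J f y <= B%:E)%E.
Proof.
move=> hf t0 hB; have ti : 0 <= t^-1 ^+ d by rewrite exprn_ge0// invr_ge0 ltW.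
have mQ : measurable (cube t : set V) by exact: measurable_box.
have mA : measurable (box a (a + const_mx 1)) by exact: measurable_box.
have mD := measurable_pdiff_swap J hf.1.
have D0 (z : V * V) : (0 <= `|pdiff alpha (- z.2) J.+1 f z.1|%:E)%E by rewrite lee_fin.
rewrite ge0_integralZl//; last 2 first.
- by apply: measurable_funTS; exact: (measurable_integral_snd mQ mD).
- by move=> y _; exact: integral_ge0.
have -> : B = t^-1 ^+ d * (B * t ^+ d).
  by rewrite mulrCA -exprMn mulVf ?gt_eqF// expr1n mulr1.
rewrite EFinM lee_wpmul2l ?lee_fin//.
rewrite (fubini_tonelli_set mA mQ mD D0) -integral_cube_cst ?(ltW t0)//.
apply: ge0_le_integralT => h Qh; first exact: integral_ge0.
have hp := periodic_mfun_pdiff alpha (- h) J.+1 hf.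
have hl := @local_integral_le _ _ _ _ _ tmu p1 _ _ a 0 1 1 hp mA (@subset_refl _ _) (lexx 1).
apply: (@le_trans _ _ (\int[lam]_(y in box a (a + const_mx 1)%R) `|pdiff alpha (- h) J.+1 f (0 + 1 *: y)|%:E)%E).
  by rewrite le_eqVlt; apply/orP; left; apply/eqP; apply: eq_integral => y _; rewrite add0r scale1r.
apply: (le_trans (hl _)); first by rewrite mulr1.
rewrite lebesgue_row_box; last by move=> i; rewrite !mxE lerDl.
rewrite big1 ?poweR_EFin ?powR1 ?mul1e; first exact: hB.
by move=> i _; rewrite !mxE addrAC subrr add0r.
Qed.

End averaged_differences.

(** * Continuity of local integrals *)

Section continuity_of_local_integrals.
Context {R : realType} (d : nat).
Local Notation V := 'rV[R]_d.
Variables (mu : {measure set V -> \bar R}) (G : set V) (p : R).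
Hypotheses (tmu : translation_measure mu G) (p1 : 1 < p).
Local Notation lam := (@lebesgue_row R d).
Local Notation L f := ('N[mu]_(p%:E)[EFin \o f%R])%E.

Lemma shell_volume_small (t e : R) : 0 < t -> 0 < e ->
  exists2 eps : R, 0 < eps < t / 2 & ((t + 2 * eps) ^+ d - (t - 2 * eps) ^+ d) <= e.
Proof.
move=> t0 e0.
pose psi (s : R) := (t + 2 * s) ^+ d - (t - 2 * s) ^+ d.
have cpsi : {for 0, continuous psi}.
  have c2 : {for (0 : R), continuous (fun s : R => 2 * s)} by exact: mulrl_continuous.
  have ca : {for (0 : R), continuous (fun s : R => t + 2 * s)}.
    exact: (@continuousD _ _ _ (fun=> t) _ _ (@cst_continuous _ _ _ _) c2).
  have cb : {for (0 : R), continuous (fun s : R => t - 2 * s)}.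
    exact: (@continuousB _ _ _ (fun=> t) _ _ (@cst_continuous _ _ _ _) c2).
  apply: (@continuousB _ _ _ (fun s : R => (t + 2 * s) ^+ d) (fun s : R => (t - 2 * s) ^+ d)).
    exact: (continuous_comp ca (@exprn_continuous _ d _)).
  exact: (continuous_comp cb (@exprn_continuous _ d _)).
have psi0 : psi 0 = 0 by rewrite /psi mulr0 addr0 subr0 subrr.
have : psi s @[s --> 0] --> psi 0 by exact: cpsi.
move=> /cvgrPdist_le /(_ _ e0); rewrite psi0 => /nbhs_ballP[r /= r0 hr].
pose eps := Num.min (r / 2) (t / 4).
have eps0 : 0 < eps by rewrite lt_min !divr_gt0.
have er : eps <= r / 2 by rewrite ge_min lexx.
have et : eps <= t / 4 by rewrite ge_min lexx orbT.
exists eps; first by rewrite eps0/=; lra.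
have := hr eps; rewrite /ball /= !sub0r !normrN (ger0_norm (ltW eps0)) => hh.
apply: le_trans (ler_norm _) (hh _); lra.
Qed.

(** Moving [x] by less than [eps] moves the cube of steps by at most [eps], and both
    cubes lie between two concentric boxes. As [f >= 0] the two integrals differ
    by at most the one over the shell between the boxes, which is small by
    Hoelder's inequality. *)
Lemma continuous_ge0_local_integral (f : V -> R) (c t : R) : periodic_mfun G f ->
  (forall x, 0 <= f x) -> (L f < +oo)%E -> 1 <= c -> 0 < t -> c * (3 * t) <= 1 ->
  continuous (fun x : V => Rintegral lam (cube t) (fun h => f (x + c *: h))).
Proof.
move=> hf f0 Lf c1 t0 ct x; have c0 : 0 < c by exact: lt_le_trans c1.
pose r := 1 - p^-1.
have r0 : 0 < r by rewrite subr_gt0 invf_lt1// (lt_trans _ p1).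
have LfR : L f = (fine (L f))%:E by rewrite fineK// ge0_fin_numE ?Lnorm_ge0.
set N := fine (L f) in LfR; have N0 : 0 <= N by rewrite -lee_fin -LfR Lnorm_ge0.
apply/(@cvgrPdist_le _ _ _ (nbhs x) (nbhs_filter x)) => /= eta eta0.
pose zeta := eta / (N + 1).
have z0 : 0 < zeta by rewrite divr_gt0// ltr_wpDl.
have [eps /andP[e0 et] he] := shell_volume_small t0 (powR_gt0 r^-1 z0).
pose Qm : set V := box (const_mx eps) (const_mx (t - eps)).
pose Qp : set V := box (const_mx (- eps)) (const_mx (t + eps)).
pose S := Qp `\` Qm.
have mQm : measurable Qm by exact: measurable_box.
have mQp : measurable Qp by exact: measurable_box.
have mS : measurable S by exact: measurableD.
have QmQp : Qm `<=` Qp.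
  by move=> h hh i; have := hh i; rewrite !mxE => /andP[h1 h2]; apply/andP; split; lra.
have Qpb : Qp `<=` box (const_mx (- t)) (const_mx (- t) + const_mx (3 * t)).
  by move=> h hh i; have := hh i; rewrite !mxE => /andP[h1 h2]; apply/andP; split; lra.
have lamS : (lam S <= (zeta `^ r^-1)%:E)%E.
  have lQp : lam Qp = ((t + 2 * eps) ^+ d)%:E.
    rewrite lebesgue_row_box => [|i]; last by rewrite !mxE; lra.
    rewrite (eq_bigr (fun=> t + 2 * eps)) => [|i _]; last by rewrite !mxE; ring.
    by rewrite prodr_const card_ord.
  have lQm : lam Qm = ((t - 2 * eps) ^+ d)%:E.
    rewrite lebesgue_row_box => [|i]; last by rewrite !mxE; lra.
    rewrite (eq_bigr (fun=> t - 2 * eps)) => [|i _]; last by rewrite !mxE; ring.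
    by rewrite prodr_const card_ord.
  have lQpy : (lam Qp < +oo)%E by rewrite lQp ltry.
  have -> : (lam S = lam Qp - lam (Qp `&` Qm))%E by exact: measureD.
  by rewrite (setIidr QmQp) lQp lQm -EFinB lee_fin.
pose F (h : V) : \bar R := (f (x + c *: h))%:E.
have mF : measurable_fun [set: V] F.
  by apply/measurable_EFinP; apply: (measurableT_comp hf.1); exact: measurable_row_affine.
have F0 h : (0 <= F h)%E by rewrite lee_fin.
have shell : (\int[lam]_(h in S) F h <= eta%:E)%E.
  have Sb : S `<=` box (const_mx (- t)) (const_mx (- t) + const_mx (3 * t)).
    by move=> h [/Qpb].
  have := local_integral_le tmu p1 x hf mS Sb c1 ct.
  under eq_integral do rewrite ger0_norm//.
  move=> /le_trans; apply; rewrite -/r LfR.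
  apply: (@le_trans _ _ (zeta%:E * N%:E)%E).
    rewrite lee_wpmul2r ?lee_fin//.
    have -> : zeta%:E = ((zeta `^ r^-1)%:E `^ r)%E.
      by rewrite poweR_EFin -powRrM mulVf ?gt_eqF// powRr1// ltW.
    apply: gt0_ler_poweR; rewrite ?in_itv/= ?leey ?andbT ?(ltW r0) ?lee_fin ?powR_ge0//.
  rewrite -EFinM lee_fin /zeta -mulrA ger_pMr// mulrC ler_pdivrMr ?mul1r ?lerDl//.
  by rewrite ltr_wpDl.
pose Im := (\int[lam]_(h in Qm) F h)%E.
have Ip : (\int[lam]_(h in Qp) F h = Im + \int[lam]_(h in S) F h)%E.
  rewrite -ge0_integral_setU//; last 2 first.
  - by apply: measurable_funTS.
  - by rewrite disj_set2E setDIK.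
  by congr integral; rewrite setDUK.
have bounds y : ball x eps y ->
    (Im <= \int[lam]_(h in cube t) (f (y + c *: h))%:E)%E /\
    (\int[lam]_(h in cube t) (f (y + c *: h))%:E <= Im + eta%:E)%E.
  move=> [_ xy].
  (* Evaluating at [y] amounts to translating the cube of steps by [w]. *)
  pose w := c^-1 *: (y - x).
  have wl i : `|w ord0 i| <= eps.
    have := xy ord0 i; rewrite /ball /= distrC => /ltW hxy.
    rewrite !mxE normrM; apply: le_trans hxy; rewrite -[leRHS]mul1r ler_wpM2r//.
    by rewrite ger0_norm ?invr_ge0 ?(ltW c0)// invf_le1.
  pose K (h : V) : \bar R := (if h \in cube t then (f (y + c *: h))%:E else 0)%E.
  have KE : (\int[lam]_(h in cube t) (f (y + c *: h))%:E = \int[lam]_h K h)%E.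
    by rewrite integral_mkcond; apply: eq_integral => h _; rewrite patchE.
  have K0 h : (0 <= K h)%E by rewrite /K; case: ifP; rewrite ?lee_fin.
  have mK : measurable_fun [set: V] K.
    have mQ : measurable (cube t : set V) by exact: measurable_box.
    apply: (measurable_fun_restrict mQ); apply: measurable_funTS.
    by apply/measurable_EFinP; apply: (measurableT_comp hf.1); exact: measurable_row_affine.
  have Kw h : K (h - w) = if (h - w) \in cube t then F h else 0%E.
    rewrite /K /F; case: ifP => // _; congr (f _)%:E.
    by rewrite scalerBr /w scalerA divff ?gt_eqF// scale1r opprB; rewrite addrCA [y + _]addrC subrK addrC.
  rewrite KE -(ge0_integral_row_shift (- w) mK K0); split.
    rewrite /Im integral_mkcond; apply: ge0_le_integralT => h _; rewrite patchE.
      by case: ifP.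
    case: ifPn => [/set_mem hm|_]; last exact: K0.
    rewrite Kw mem_set// => i; have := hm i; have := wl i; rewrite !mxE ler_norml.
    by move=> /andP[h1 h2] /andP[h3 h4]; apply/andP; split; lra.
  apply: (@le_trans _ _ (\int[lam]_(h in Qp) F h)%E); last by rewrite Ip leeD2l.
  rewrite [leRHS]integral_mkcond; apply: ge0_le_integralT => h _; first exact: K0.
  rewrite Kw patchE; case: ifPn => [/set_mem hm|_]; last by case: ifP.
  rewrite mem_set// => i; have := hm i; have := wl i; rewrite !mxE ler_norml.
  by move=> /andP[h1 h2] /andP[h3 h4]; apply/andP; split; lra.
have Imfin : Im \is a fin_num.
  rewrite ge0_fin_numE ?integral_ge0//.
  have Qmb : Qm `<=` box (const_mx (- t)) (const_mx (- t) + const_mx (3 * t)).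
    by apply: subset_trans QmQp Qpb.
  have /integrableP[_] := local_integrable tmu p1 x hf Lf mQm Qmb c1 (ltac:(lra) : 0 <= 3 * t) ct.
  by under eq_integral do rewrite gee0_abs ?lee_fin//.
have fin y : ball x eps y -> (\int[lam]_(h in cube t) (f (y + c *: h))%:E)%E \is a fin_num.
  move=> /bounds[_ h2]; rewrite ge0_fin_numE; last by apply: integral_ge0 => h _; rewrite lee_fin.
  by apply: (le_lt_trans h2); rewrite -(fineK Imfin) -EFinD ltry.
near=> y.
have by_ : ball x eps y by near: y; exact: nbhsx_ballx.
have bx : ball x eps x by exact: ballxx.
have [x1 x2] := bounds _ bx; have [y1 y2] := bounds _ by_.
move: x1 x2 y1 y2; rewrite /Rintegral.
rewrite -(fineK (fin _ bx)) -(fineK (fin _ by_)) -(fineK Imfin) -!EFinD !lee_fin.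
move: (fine _) (fine _) (fine _) => u v w u1 u2 v1 v2.
by rewrite /= ler_norml; apply/andP; split; lra.
Unshelve. all: by end_near.
Qed.

End continuity_of_local_integrals.

(** * Continuity and convergence of the means *)

Section continuity_of_means.
Context {R : realType} (d : nat).
Local Notation V := 'rV[R]_d.
Variables (mu : {measure set V -> \bar R}) (G : set V) (p : R).
Hypotheses (tmu : translation_measure mu G) (p1 : 1 < p).
Local Notation lam := (@lebesgue_row R d).
Local Notation L f := ('N[mu]_(p%:E)[EFin \o f%R])%E.

Lemma continuous_local_integral (f : V -> R) (c t : R) : periodic_mfun G f ->
  (L f < +oo)%E -> 1 <= c -> 0 < t -> c * (3 * t) <= 1 ->
  continuous (fun x : V => Rintegral lam (cube t) (fun h => f (x + c *: h))).
Proof.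
move=> hf Lf c1 t0 ct x; have c0 : 0 < c by exact: lt_le_trans c1.
pose f1 x := Num.max (f x) 0; pose f2 x := Num.max (- f x) 0.
have hf1 : periodic_mfun G f1.
  split; first by apply: measurable_maxr => //; exact: hf.1.
  by move=> g Gg y; rewrite /f1 (hf.2 g Gg).
have hf2 : periodic_mfun G f2.
  split; first by apply: measurable_maxr => //; apply: measurableT_comp => //; exact: hf.1.
  by move=> g Gg y; rewrite /f2 (hf.2 g Gg).
have f10 y : 0 <= f1 y by rewrite le_max lexx orbT.
have f20 y : 0 <= f2 y by rewrite le_max lexx orbT.
have fE y : f y = f1 y - f2 y.
  by rewrite /f1 /f2; case: (leP (f y) 0) => h; case: (leP (- f y) 0) => k; lra.
have p1' := ltW p1.
have L1 : (L f1 < +oo)%E.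
  apply: le_lt_trans Lf; apply: le_Lnorm => // y; rewrite /= lee_fin (ger0_norm (f10 y)).
  by rewrite ge_max ler_norm normr_ge0.
have L2 : (L f2 < +oo)%E.
  apply: le_lt_trans Lf; apply: le_Lnorm => // y; rewrite /= lee_fin (ger0_norm (f20 y)).
  by rewrite ge_max -normrN ler_norm normr_ge0.
have mQ : measurable (cube t : set V) by exact: measurable_box.
have Qb : cube t `<=` (box 0 (0 + const_mx t) : set V) by rewrite add0r.
have ct' : c * t <= 1 by apply: le_trans ct; rewrite ler_wpM2l ?(ltW c0)//; lra.
rewrite (_ : (fun y : V => Rintegral lam (cube t) (fun h => f (y + c *: h))) =
  (fun y : V => Rintegral lam (cube t) (fun h => f1 (y + c *: h))) \-
  (fun y : V => Rintegral lam (cube t) (fun h => f2 (y + c *: h)))); last first.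
  apply/funext => y; rewrite /= -RintegralB//; last 2 first.
  - exact: (local_integrable tmu p1 y hf1 L1 mQ Qb c1 (ltW t0) ct').
  - exact: (local_integrable tmu p1 y hf2 L2 mQ Qb c1 (ltW t0) ct').
  by apply: eq_Rintegral => h _; exact: fE.
apply: continuousB.
  exact: (continuous_ge0_local_integral tmu p1 hf1 f10 L1 c1 t0 ct).
exact: (continuous_ge0_local_integral tmu p1 hf2 f20 L2 c1 t0 ct).
Qed.

Lemma continuous_mean_smooth_sum (alpha : R) (f : V -> R) (t : R) (J : nat) :
  periodic_mfun G f -> (L f < +oo)%E -> 0 < t -> J%:R * (3 * t) <= 1 ->
  continuous (fun x => mean t (smooth_sum alpha J f x)).
Proof.
move=> hf Lf t0 Jt.
have mQ : measurable (cube t : set V) by exact: measurable_box.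
have Qb : cube t `<=` (box 0 (0 + const_mx t) : set V) by rewrite add0r.
have j1 (j : 'I_J) : 1 <= j.+1%:R :> R by rewrite ler1n.
have jt (j : 'I_J) : j.+1%:R * (3 * t) <= 1.
  by apply: le_trans Jt; rewrite ler_wpM2r ?ler_nat// mulr_ge0// ltW.
have int (j : 'I_J) y : lam.-integrable (cube t) (EFin \o (fun h => f (y + j.+1%:R *: h))).
  have jt1 : j.+1%:R * t <= 1 by apply: le_trans (jt j); rewrite ler_wpM2l//; lra.
  exact: (local_integrable tmu p1 y hf Lf mQ Qb (j1 j) (ltW t0) jt1).
pose I (j : 'I_J) (y : V) := Rintegral lam (cube t) (fun h => f (y + j.+1%:R *: h)).
rewrite (_ : (fun y : V => _) = (fun y : V => \sum_(j < J) (- (t^-1 ^+ d * dcoef alpha j.+1)) * I j y)).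
  apply: (continuous_big add_continuous) => j _ x.
  have cI := continuous_local_integral hf Lf (j1 j) t0 (jt j).
  exact: (@continuousM _ _ (fun=> _) _ x (@cst_continuous _ _ _ _) (cI x)).
apply/funext => y; rewrite /mean /Rintegral.
rewrite (eq_integral (fun h : V => \sum_(j < J) ((- dcoef alpha j.+1)%:E * (f (y + j.+1%:R *: h))%:E))%E); last first.
  move=> h _; rewrite /smooth_sum big_add1 big_mkord -sumrN -sumEFin.
  by apply: eq_bigr => j _; rewrite -EFinM mulNr.
rewrite integral_sum//; last by move=> j; apply: integrableZl => //; exact: int.
rewrite (eq_bigr (fun j : 'I_J => (- dcoef alpha j.+1 * I j y)%:E)); last first.
  move=> j _; rewrite integralZl//; last exact: int.
  by rewrite EFinM /I /Rintegral fineK//; apply: integrable_fin_num => //; exact: int.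
by rewrite sumEFin /= mulr_sumr; apply: eq_bigr => j _; rewrite !mulNr mulrN mulrA.
Qed.

End continuity_of_means.

Section geometric_sequences.
Context {R : realType}.

Lemma geometric_limn (a : nat -> R) (D rho : R) : 0 <= D -> 0 <= rho < 1 ->
  (forall k, `|a k - a k.+1| <= D * rho ^+ k) ->
  cvgn a /\ forall k, `|a k - limn a| <= D / (1 - rho) * rho ^+ k.
Proof.
move=> D0 /andP[r0 r1] ha; have r1' : 0 < 1 - rho by rewrite subr_gt0.
have step k n : `|a (k + n)%N - a k| <= D / (1 - rho) * rho ^+ k.
  suff : `|a (k + n)%N - a k| <= D / (1 - rho) * rho ^+ k * (1 - rho ^+ n).
    move=> /le_trans; apply; rewrite -[leRHS]mulr1 ler_wpM2l//.
      by rewrite mulr_ge0 ?exprn_ge0// divr_ge0// ltW.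
    by rewrite gerBl exprn_ge0.
  elim: n => [|n IH]; first by rewrite addn0 subrr normr0 expr0 subrr mulr0.
  rewrite addnS (_ : _ - _ = (a (k + n)%N - a k) - (a (k + n)%N - a (k + n).+1)); last by ring.
  apply: (le_trans (ler_normB _ _)); apply: (le_trans (lerD IH (ha _))).
  rewrite le_eqVlt; apply/orP; left; apply/eqP; rewrite exprD exprS; field.
  by rewrite gt_eqF.
have ca : cvgn a.
  apply/cauchy_cvgP/cauchy_exP => e e0.
  have : (D / (1 - rho) * rho ^+ k) @[k --> \oo] --> D / (1 - rho) * 0.
    by apply: cvgMr; apply: cvg_expr; rewrite ger0_norm.
  rewrite mulr0 => /cvgrPdist_lt/(_ e e0)[k _ /(_ k (leqnn _))].
  rewrite /= sub0r normrN => hk.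
  exists (a k); exists k => // n /= kn; rewrite /ball /= distrC -(subnKC kn).
  by apply: le_lt_trans hk; apply: le_trans (step _ _) (ler_norm _).
split => // k; rewrite distrC; apply: (limn_dist_le (m := k)) => // n kn.
by rewrite -(subnKC kn); exact: step.
Qed.

End geometric_sequences.

(** * Decay of the modulus of smoothness *)

Section modulus_decay.
Context {R : realType} (d : nat).
Local Notation V := 'rV[R]_d.
Variables (mu : {measure set V -> \bar R}) (alpha p b : R) (q : \bar R).
Hypotheses (alpha0 : 0 < alpha) (q0 : (0 < q)%E) (hb : (q^-1 < b%:E)%E).

Lemma log_exponent_gt0 : 0 < b.
Proof.
case: q q0 hb => [r||//]; last by rewrite invey lte_fin.
rewrite lte_fin => r0; rewrite inver gt_eqF// lte_fin; apply: lt_trans.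
by rewrite invr_gt0.
Qed.

Lemma le_modulus f (t s : R) : t <= s -> (modulus mu alpha p f t <= modulus mu alpha p f s)%E.
Proof.
move=> ts; apply: ge_ereal_sup => _ [h /= ht <-].
by apply: ereal_sup_ubound; exists h => //=; exact: le_trans ts.
Qed.

(** For finite [q] restrict the integral to ]t, 2t[, where the modulus is at least
    its value at [t] and the weight is comparable to its value at [t]. *)
Lemma modulus_le_seminorm : exists2 c : R, 0 < c & forall f (t : R), 0 < t <= 2^-1 ->
  ((c * (t `^ (- alpha) * (1 - ln t) `^ (- b)))%:E * modulus mu alpha p f t <=
   lip_seminorm mu alpha b p q f)%E.
Proof.
have b0 := log_exponent_gt0.
case: q q0 => [r| |//] r0; last first.
  exists 1 => // f t /andP[t0 th]; rewrite mul1r.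
  apply: ereal_sup_ubound; exists t => //=; rewrite in_itv/= t0/=; lra.
rewrite lte_fin in r0.
exists ((2^-1) `^ r^-1 * 2 `^ (- alpha)); first by rewrite mulr_gt0 ?powR_gt0.
move=> f t /andP[t0 th].
have m0 := modulus_ge0 mu alpha p f (ltW t0).
have lnu (s : R) : 0 < s < 1 -> 0 < 1 - ln s by move=> /ln_lt0; lra.
have t1 : t < 1 by lra.
have ut : 0 < 1 - ln t by apply: lnu; rewrite t0.
pose W := (2 * t) `^ (- alpha) * (1 - ln t) `^ (- b).
have W0 : 0 <= W by rewrite mulr_ge0 ?powR_ge0.
move: m0; set m := modulus mu alpha p f t => m0.
have wm (s : R) : t < s < 2 * t -> (W%:E * m <= lip_weighted mu alpha b p f s)%E.
  move=> /andP[ts s2]; have s0 : 0 < s by exact: lt_trans ts.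
  have s1 : s < 1 by lra.
  apply: lee_pmul; [by rewrite lee_fin|exact: m0| |exact/le_modulus/ltW].
  rewrite lee_fin; apply: ler_pM; rewrite ?powR_ge0// !powRN lef_pV2 ?posrE ?powR_gt0 ?mulr_gt0//; last first.
  - by apply: lnu; rewrite s0.
  - apply: ge0_ler_powR; rewrite ?nnegrE ?(ltW b0) ?(ltW ut)//.
      by apply/ltW/lnu; rewrite s0.
    by rewrite lerD2l lerN2 ler_ln ?posrE// ltW.
  - by apply: ge0_ler_powR; rewrite ?nnegrE ?(ltW alpha0) ?(ltW s0) ?(ltW s2)// mulr_ge0// ltW.
pose c0 : \bar R := ((W%:E * m) `^ r * ((2 * t)^-1)%:E)%E.
have c00 : (0 <= c0)%E by rewrite mule_ge0 ?poweR_ge0// lee_fin invr_ge0 mulr_ge0// ltW.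
have int : ((W%:E * m) `^ r * (2^-1)%:E <=
    \int[@lebesgue_measure R]_(s in `]0%R, 1%R[) (lip_weighted mu alpha b p f s `^ r * (s^-1)%:E))%E.
  apply: (@le_trans _ _ (\int[@lebesgue_measure R]_(s in `]t, (2 * t)%R[) c0)%E).
    rewrite integral_cst//= lebesgue_measure_itv/= lte_fin ltr_pMl// ltr1n.
    rewrite -EFinB /c0 -muleA -EFinM (_ : _^-1 * _ = 2^-1)//; field.
    by rewrite gt_eqF.
  rewrite integral_mkcond [leRHS]integral_mkcond; apply: ge0_le_integralT => s _.
    by rewrite patchE; case: ifP.
  rewrite !patchE; case: ifPn => [|_]; last first.
    case: ifPn => //; rewrite inE/= in_itv/= => /andP[s0 _].
    by rewrite mule_ge0 ?poweR_ge0// lee_fin invr_ge0 ltW.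
  rewrite inE/= in_itv/= => /andP[ts s2]; have s0 : 0 < s by exact: lt_trans ts.
  rewrite mem_set; last by rewrite /= in_itv/= s0/=; lra.
  apply: lee_pmul; [exact: poweR_ge0|by rewrite lee_fin invr_ge0 mulr_ge0// ltW| |].
    apply: gt0_ler_poweR; rewrite ?in_itv/= ?leey ?andbT ?(ltW r0)//.
    - by rewrite mule_ge0 ?lee_fin.
    - rewrite mule_ge0 ?modulus_ge0 ?(ltW s0)// lee_fin mulr_ge0 ?powR_ge0//.
    - by apply: wm; rewrite ts.
  by rewrite lee_fin lef_pV2 ?posrE ?mulr_gt0// ltW.
rewrite /lip_seminorm.
apply: (@le_trans _ _ (((W%:E * m) `^ r * (2^-1)%:E) `^ r^-1)%E); last first.
  apply: gt0_ler_poweR; rewrite ?in_itv/= ?leey ?andbT ?invr_ge0 ?(ltW r0)//.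
    by rewrite mule_ge0 ?poweR_ge0// lee_fin invr_ge0.
  by apply: le_trans int; rewrite mule_ge0 ?poweR_ge0// lee_fin invr_ge0.
rewrite poweRM ?poweR_ge0 ?lee_fin ?invr_ge0//.
rewrite -poweRrM divff ?gt_eqF// poweRe1 ?mule_ge0 ?lee_fin// poweR_EFin.
rewrite -muleA [(m * _)%E]muleC muleA -EFinM le_eqVlt; apply/orP; left; apply/eqP.
congr (_%:E * _)%E; rewrite /W powRM ?(ltW t0)//; ring.
Qed.

(** The factor t^(alpha - s) absorbs the logarithm. *)
Lemma modulus_decay (s : R) : s < alpha -> exists2 C : R, 0 < C & forall f (N t : R), 0 < t <= 2^-1 ->
  (lip_norm mu alpha b p q f <= N%:E)%E -> (modulus mu alpha p f t <= (C * t `^ s * N)%:E)%E.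
Proof.
move=> sa; have [c c0 hc] := modulus_le_seminorm.
have b0 := log_exponent_gt0.
have as0 : 0 < alpha - s by rewrite subr_gt0.
have [C C0 hC] := powR_le_expR b0 as0.
exists (C / c); first by rewrite divr_gt0.
move=> f N t ht LN; have /andP[t0 th] := ht.
have t1 : t < 1 by lra.
have lt0 : ln t < 0 by apply: ln_lt0; rewrite t0.
have u0 : 0 < 1 - ln t by lra.
have semi : (lip_seminorm mu alpha b p q f <= N%:E)%E.
  by apply: le_trans LN; rewrite /lip_norm leeDr// Lnorm_ge0.
have := le_trans (hc f t ht) semi.
set W := c * _; have W0 : 0 < W by rewrite !mulr_gt0 ?powR_gt0.
rewrite -lee_pdivlMl// => /le_trans; apply; rewrite -EFinM lee_fin.
have N0 : 0 <= N by rewrite -lee_fin (le_trans _ LN)// adde_ge0 ?Lnorm_ge0 ?lip_seminorm_ge0.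
have y0 : 0 <= - ln t by lra.
have key : t `^ alpha * (1 - ln t) `^ b <= C * t `^ s.
  have ta : 0 < t `^ (alpha - s) by rewrite powR_gt0.
  have E : expR ((alpha - s) * - ln t) = (t `^ (alpha - s))^-1.
    by rewrite powR_expR// -expRN mulrN.
  have aE : t `^ alpha = t `^ (alpha - s) * t `^ s.
    by rewrite -powRD ?subrK// (gt_eqF t0) implybT.
  have := hC _ y0; rewrite E ler_pdivlMr// => h.
  by rewrite aE mulrAC ler_wpM2r ?powR_ge0// mulrC.
have -> : W^-1 = c^-1 * (t `^ alpha * (1 - ln t) `^ b).
  by rewrite /W invfM invfM !powRN !invrK.
rewrite ler_wpM2r// (mulrC C) -mulrA ler_wpM2l ?invr_ge0 ?(ltW c0)//.
Qed.

End modulus_decay.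

(** * The continuous representative *)

Section unit_boxes.
Context {R : realType} (d : nat).
Local Notation V := 'rV[R]_d.
Local Notation lam := (@lebesgue_row R d).

Lemma ae_of_unit_boxes (P : V -> Prop) :
  (forall z : V, {ae lam, forall x, box z (z + const_mx 1) x -> P x}) ->
  {ae lam, forall x, P x}.
Proof.
move=> h.
pose T n (x : V) := if unpickle n is Some m then
  box (map_mx intr (m : 'rV[int]_d)) (map_mx intr m + const_mx 1) x -> P x else True.
have : {ae lam, forall x, forall n, T n x}.
  apply: ae_foralln => n; rewrite /T; case: unpickle => [m|]; first exact: h.
  exact: filterE.
apply: filterS => x hx.
have := hx (pickle (\row_i Num.floor (x ord0 i) : 'rV[int]_d)).
rewrite /T pickleK; apply => i; rewrite !mxE.
by have /andP[-> h2] := floor_itv (x ord0 i); rewrite /= -intrD1.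
Qed.

Lemma lebesgue_row_unit_box (z : V) : lam (box z (z + const_mx 1)) = 1%E.
Proof.
rewrite lebesgue_row_box => [|i]; last by rewrite !mxE lerDl.
by rewrite big1// => i _; rewrite !mxE addrAC subrr add0r.
Qed.

(** On each unit box the infimum of the [H k] has integral zero,
    and it bounds |f - g|. *)
Lemma ae_eq_of_small_integrals (f g : V -> R) (H : nat -> V -> \bar R) (e : nat -> R) :
  (forall k, measurable_fun [set: V] (H k)) -> (forall k x, 0 <= H k x)%E ->
  (forall k x, (`|f x - g x|%:E <= H k x)%E) ->
  (forall k z, (\int[lam]_(x in box z (z + const_mx 1)%R) H k x <= (e k)%:E)%E) ->
  e k @[k --> \oo] --> 0 -> {ae lam, forall x, f x = g x}.
Proof.
move=> mH H0 fgH intH e0; apply: ae_of_unit_boxes => z.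
set Q := box z _; have mQ : measurable Q by exact: measurable_box.
pose Psi x := einfs (H ^~ x) 0%N.
have mPsi : measurable_fun [set: V] Psi by exact: measurable_fun_einfs.
have Psi0 x : (0 <= Psi x)%E by apply: le_ereal_inf_tmp => _ [k _ <-].
have fgPsi x : (`|f x - g x|%:E <= Psi x)%E.
  by apply: le_ereal_inf_tmp => _ [k _ <-]; exact: fgH.
have Psi_int : (\int[lam]_(x in Q) Psi x = 0)%E.
  apply/eqP; rewrite eq_le integral_ge0// andbT; apply/lee_addgt0Pr => eta eta0.
  rewrite add0e; move/cvgrPdist_le : e0 => /(_ _ eta0)[k _ /(_ k (leqnn k))].
  rewrite /= sub0r normrN => ek.
  apply: (@le_trans _ _ (\int[lam]_(x in Q) H k x)%E).
    by apply: ge0_le_integralT => // x _; apply: ereal_inf_lbound; exists k.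
  by apply: (le_trans (intH k z)); rewrite lee_fin (le_trans (ler_norm _)).
have mPsiQ : measurable_fun Q Psi by exact: measurable_funTS.
have := (ae_eq_integral_abs lam mQ mPsiQ).1.
rewrite (eq_integral Psi); last by move=> x _; rewrite gee0_abs.
move=> /(_ Psi_int); apply: filterS => x hx Qx.
by have := fgPsi x; rewrite hx// lee_fin normr_le0 subr_eq0 => /eqP.
Qed.

End unit_boxes.

Section embedding.
Context {R : realType} (d : nat).
Local Notation V := 'rV[R]_d.
Variables (mu : {measure set V -> \bar R}) (G : set V) (alpha p b : R) (q : \bar R).
Hypotheses (tmu : translation_measure mu G) (d0 : (0 < d)%N) (alpha0 : 0 < alpha) (p1 : 1 < p).
Hypotheses (q0 : (0 < q)%E) (hb : (q^-1 < b%:E)%E).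
Local Notation lam := (@lebesgue_row R d).
Local Notation L f := ('N[mu]_(p%:E)[EFin \o f%R])%E.
Local Notation N_ f := (lip_norm mu alpha b p q f).

Let p1' : 1 <= p. Proof. exact: ltW. Qed.

Lemma Lnorm_le_lip_norm f : (L f <= N_ f)%E.
Proof. by rewrite leeDl// lip_seminorm_ge0. Qed.

Definition dyadic (k : nat) : R := 2^-1 ^+ k.+1.

Lemma dyadic_gt0 k : 0 < dyadic k.
Proof. by rewrite exprn_gt0. Qed.

Lemma dyadic_le_half k : dyadic k <= 2^-1.
Proof. by rewrite /dyadic exprS ger_pMr// exprn_ile1// invf_le1// ler1n. Qed.

Lemma dyadic_natr k : (2 ^ k.+1)%:R * dyadic k = 1 :> R.
Proof. by rewrite natrX /dyadic exprVn divff// expf_neq0. Qed.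

(** After 2^(k+1) terms the tail of the coefficients is of order 2^(- k alpha), no
    worse than the modulus at the same scale. *)
Lemma Lnorm_dyadic_pdiff (s : R) : s < alpha -> exists2 C : R, 0 < C &
  forall f N k (h : V), periodic_mfun G f -> (N_ f <= N%:E)%E -> enorm h <= dyadic k ->
  (L (pdiff alpha (- h) (2 ^ k.+1).+1 f) <= (C * dyadic k `^ s * N)%:E)%E.
Proof.
move=> sa; have [C1 C10 h1] := modulus_decay mu p alpha0 q0 hb sa.
have [C2 C20 h2] := dcoef_tail alpha0.
exists (C1 + C2); first by rewrite addr_gt0.
move=> f N k h hf LN hk.
have LfN : (L f <= N%:E)%E by apply: le_trans LN; exact: Lnorm_le_lip_norm.
have N0 : 0 <= N by rewrite -lee_fin (le_trans _ LfN)// Lnorm_ge0.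
have Lf : (L f < +oo)%E by apply: le_lt_trans LfN _; exact: ltry.
set dl := dyadic k in hk *; have dl0 : 0 < dl by exact: dyadic_gt0.
have dlh : dl <= 2^-1 by exact: dyadic_le_half.
have fd : (L (fdiff alpha (- h) f) <= (C1 * dl `^ s * N)%:E)%E.
  apply: le_trans (h1 f N dl _ LN); last by rewrite dl0.
  rewrite -(Lnorm_frac_diff p tmu)//; apply: ereal_sup_ubound; exists (- h) => //=.
  rewrite (le_trans _ hk)// /enorm le_eqVlt; apply/orP; left; apply/eqP; congr Num.sqrt.
  by apply: eq_bigr => i _; rewrite mxE sqrrN.
have tail n : \sum_((2 ^ k.+1).+1 <= j < n) `|dcoef alpha j| <= C2 * dl `^ s.
  apply: (le_trans (h2 _ _)); rewrite ler_wpM2l ?(ltW C20)//.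
  apply: (@le_trans _ _ (dl `^ alpha)).
    apply: (@le_trans _ _ ((2 ^ k.+1)%:R `^ (- alpha))).
      by apply: ler_powN; rewrite ?(ltW alpha0) ?ltr0n ?expn_gt0// ler_nat.
    rewrite powRN -[leLHS]mulr1 ler_pdivrMl ?powR_gt0 ?ltr0n ?expn_gt0//.
    by rewrite -powRM ?(ltW dl0)// dyadic_natr powR1.
  by apply: ger_powR; [rewrite dl0/=; lra|exact: ltW].
have rem := Lnorm_fdiff_remainder tmu p1' (- h) hf Lf tail.
have hp := periodic_mfun_pdiff alpha (- h) (2 ^ k.+1).+1 hf.
have hF := periodic_mfun_fdiff alpha (- h) hf.
apply: (le_trans (Lnorm_triangle mu p1' hp hF)).
rewrite (_ : (C1 + C2) * _ * _ = C2 * dl `^ s * N + C1 * dl `^ s * N); last by ring.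
rewrite EFinD; apply: leeD => //; rewrite (Lnorm_subC mu p1').
apply: (le_trans rem).
by rewrite [leRHS]EFinM lee_wpmul2l// lee_fin mulr_ge0 ?powR_ge0// ltW.
Qed.

(** The factor [d] makes the Euclidean norm of a step at most [dyadic k]; the factor
    3 leaves room around the cube of steps for [continuous_ge0_local_integral]. *)
Definition cell_size (k : nat) : R := dyadic k / (3 * d%:R).

Lemma cell_size_gt0 k : 0 < cell_size k.
Proof. by rewrite divr_gt0 ?dyadic_gt0// mulr_gt0// ltr0n. Qed.

Lemma cell_size_le k : (2 ^ k.+1)%:R * (3 * cell_size k) <= 1.
Proof.
have d1 : 1 <= d%:R :> R by rewrite ler1n.
rewrite (_ : _ * _ = ((2 ^ k.+1)%:R * dyadic k) / d%:R); last first.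
  by rewrite /cell_size; field; rewrite pnatr_eq0 gtn_eqF.
by rewrite dyadic_natr div1r invf_le1// ltr0n.
Qed.

Lemma enorm_cell k (h : V) : cube (cell_size k) h -> enorm h <= dyadic k.
Proof.
move=> hh; have d1 : 1 <= d%:R :> R by rewrite ler1n.
rewrite /enorm -(ger0_norm (ltW (dyadic_gt0 k))) -sqrtr_sqr ler_wsqrtr//.
apply: (@le_trans _ _ (\sum_(i < d) (dyadic k / d%:R) ^+ 2)).
  apply: ler_sum => i _; have := hh i; rewrite !mxE => /andP[h0 h1].
  rewrite lerXn2r// ?nnegrE//; first by rewrite divr_ge0// ltW// dyadic_gt0.
  apply: (le_trans (ltW h1)); rewrite /cell_size ler_wpM2l ?(ltW (dyadic_gt0 _))//.
  by rewrite lef_pV2 ?posrE ?mulr_gt0 ?ltr0n//; lra.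
rewrite sumr_const card_ord -[_ *+ d]mulr_natr expr_div_n -mulrA.
rewrite ger_pMr ?exprn_gt0 ?dyadic_gt0//.
by rewrite [_ ^+ 2]expr2 invfM -mulrA mulVf ?mulr1 ?invf_le1 ?ltr0n// pnatr_eq0 gtn_eqF.
Qed.

Lemma dyadicS k : dyadic k.+1 = 2^-1 * dyadic k.
Proof. by rewrite /dyadic exprS. Qed.

Lemma dyadic_powR k (e : R) : dyadic k `^ e = (2^-1 `^ e) ^+ k.+1.
Proof. by rewrite /dyadic -powR_mulrn// -powRrM mulrC powRrM powR_mulrn ?powR_ge0. Qed.

(** The loss in Hoelder's inequality at scale [k]. *)
Lemma cell_volume k : (cell_size k ^+ d) `^ (- p^-1) =
  (3 * d%:R)^-1 `^ (- (d%:R / p)) * dyadic k `^ (- (d%:R / p)).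
Proof.
rewrite -powR_mulrn ?(ltW (cell_size_gt0 k))// -powRrM mulrN.
by rewrite /cell_size powRM ?(ltW (dyadic_gt0 _)) ?invr_ge0 ?mulr_ge0// mulrC.
Qed.

(** Between consecutive scales the means change by at most a constant times
    [rho ^+ k], where rho = 2^(- (s - d/p)) is less than 1 because s > d/p. *)
Lemma continuous_representative : d%:R / p < alpha -> exists2 C : R, 0 < C &
  forall f N, periodic_mfun G f -> (N_ f <= N%:E)%E ->
  exists g : V -> R, [/\ continuous g, invariant_by G g,
    {ae mu, forall x, f x = g x} & forall x, `|g x| <= C * N].
Proof.
move=> da; pose s := (d%:R / p + alpha) / 2.
have ds : d%:R / p < s by rewrite /s; lra.
have sa : s < alpha by rewrite /s; lra.
clearbody s.
have s0 : 0 < s by apply: le_lt_trans ds; rewrite divr_ge0// ltW// (lt_trans _ p1).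
have [B B0 hB] := Lnorm_dyadic_pdiff sa.
have [Cs Cs0 hCs] := dcoef_summable alpha0.
pose e := d%:R / p; pose rho : R := 2^-1 `^ (s - e).
pose K : R := (3 * d%:R)^-1 `^ (- e).
have dR : 0 < d%:R :> R by rewrite ltr0n.
have K0 : 0 < K by rewrite powR_gt0// invr_gt0 mulr_gt0.
have rho0 : 0 < rho by rewrite powR_gt0.
have rho1 : rho < 1.
  have -> : 1 = 1 `^ (s - e) :> R by rewrite powR1.
  by apply: gt0_ltr_powR; rewrite ?nnegrE ?subr_gt0// invf_lt1// ltr1n.
pose D : R := Cs * K * B * (1 + 2 `^ e).
have D0 : 0 < D by rewrite !mulr_gt0// addr_gt0// powR_gt0.
pose C := Cs * (cell_size 0 ^+ d) `^ (- p^-1) + D / (1 - rho) + 1.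
have r1 : 0 < 1 - rho by rewrite subr_gt0.
have Dr : 0 < D / (1 - rho) by rewrite divr_gt0.
have C0 : 0 < C by rewrite addr_gt0// ltr_wpDl// mulr_ge0 ?powR_ge0// ltW.
exists C => // f N hf LN.
have LfN : (L f <= N%:E)%E by apply: le_trans LN; exact: Lnorm_le_lip_norm.
have N0 : 0 <= N by rewrite -lee_fin (le_trans _ LfN)// Lnorm_ge0.
have Lf : (L f < +oo)%E by apply: le_lt_trans LfN _; exact: ltry.
pose J k := (2 ^ k.+1)%N.
pose A k x := mean (cell_size k) (smooth_sum alpha (J k) f x).
have Jt k : (J k)%:R * cell_size k <= 1.
  apply: le_trans (cell_size_le k); rewrite ler_wpM2l//.
  by have := cell_size_gt0 k; lra.
have hBk k h : cube (cell_size k) h ->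
    (L (pdiff alpha (- h) (J k).+1 f) <= (B * dyadic k `^ s * N)%:E)%E.
  by move=> hh; apply: hB => //; exact: enorm_cell.
have cellk k : dyadic k `^ s * dyadic k `^ (- e) = rho ^+ k.+1.
  rewrite -powRD; last by rewrite (gt_eqF (dyadic_gt0 k)) implybT.
  by rewrite dyadic_powR.
have step x k : `|A k x - A k.+1 x| <= (D * N) * rho ^+ k.
  have st := mean_smooth_sum_dist tmu p1 hCs x hf Lf (cell_size_gt0 k) (cell_size_gt0 k.+1) (Jt k) (Jt k.+1) (hBk k) (hBk k.+1).
  rewrite /A; apply: (le_trans st).
  rewrite !cell_volume -/K -/e dyadicS.
  set u := dyadic k `^ (- e); set v := dyadic k `^ s.
  have v' : (2^-1 * dyadic k) `^ s <= v.
    apply: ge0_ler_powR; rewrite ?nnegrE ?mulr_ge0 ?(ltW (dyadic_gt0 _))//.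
      exact: ltW s0.
    by rewrite ger_pMl ?dyadic_gt0// invf_le1// ler1n.
  have u' : (2^-1 * dyadic k) `^ (- e) = 2 `^ e * u.
    rewrite powRM ?(ltW (dyadic_gt0 _))//; congr (_ * _).
    by rewrite -(@powR_inv1 _ 2)// -powRrM mulrNN mul1r.
  rewrite u' -/u; apply: (@le_trans _ _ (Cs * (K * u * (B * v * N) + K * (2 `^ e * u) * (B * v * N)))).
    rewrite ler_wpM2l ?(ltW Cs0)// lerD2r ler_wpM2l ?mulr_ge0 ?powR_ge0 ?(ltW K0)//.
    by rewrite ler_wpM2r// ler_wpM2l// ltW.
  have rg (u1 v1 w : R) : Cs * (K * u1 * (B * v1 * N) + K * (w * u1) * (B * v1 * N)) =
      Cs * K * B * (1 + w) * N * (v1 * u1) by ring.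
  rewrite rg -/D cellk; apply: ler_wpM2l; first by rewrite mulr_ge0 ?(ltW D0).
  by rewrite exprS ger_pMl ?exprn_gt0// ltW.
have DN0 : 0 <= D * N by rewrite mulr_ge0// ltW.
have rho01 : 0 <= rho < 1 by rewrite (ltW rho0).
have lim x := geometric_limn DN0 rho01 (step x).
pose g x := limn (fun k => A k x).
have cA k : continuous (A k).
  exact: (continuous_mean_smooth_sum tmu p1 hf Lf (cell_size_gt0 k) (cell_size_le k)).
pose E k := D * N / (1 - rho) * rho ^+ k.
have E0 k : 0 <= E k by rewrite mulr_ge0 ?exprn_ge0 ?(ltW rho0)// divr_ge0// ltW.
have hE k x : `|A k x - g x| <= E k by exact: (lim x).2.
have Ecvg : E k @[k --> \oo] --> 0.
  rewrite -[X in _ --> X](mulr0 (D * N / (1 - rho))); apply: cvgMr.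
  by apply: cvg_expr; rewrite ger0_norm// ltW.
have hdist k x : (`|f x - A k x|%:E <= mean_pdiff alpha (cell_size k) (J k) f x)%E.
  exact: (dist_mean_smooth_sum_le alpha tmu p1 x hf Lf (cell_size_gt0 k) (Jt k)).
exists g; split.
- move=> x; apply/(@cvgrPdist_le _ _ _ (nbhs x) (nbhs_filter x)) => /= eta eta0.
  have eta3 : 0 < eta / 3 by rewrite divr_gt0.
  move/cvgrPdist_le : Ecvg => /(_ _ eta3)[k _ /(_ k (leqnn k))].
  rewrite /= sub0r normrN ger0_norm// => Ek.
  have /cvgrPdist_le/(_ _ eta3) := cA k x.
  apply: filterS => y hy.
  have tri (a1 a2 g1 g2 ek : R) : `|a1 - a2| <= eta / 3 -> ek <= eta / 3 ->
      `|a1 - g1| <= ek -> `|a2 - g2| <= ek -> `|g1 - g2| <= eta.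
    rewrite !ler_norml; move=> /andP[? ?] ? /andP[? ?] /andP[? ?].
    by apply/andP; split; lra.
  exact: (tri _ _ _ _ _ hy Ek (hE k x) (hE k y)).
- move=> z Gz x; rewrite /g; congr (limn _); apply/funext => k; rewrite /A; congr mean.
  apply/funext => h; rewrite /smooth_sum; congr (- _); apply: eq_bigr => j _.
  by rewrite addrAC (hf.2 z Gz).
- have vanish : (B * dyadic k `^ s * N + E k) @[k --> \oo] --> (0 : R).
    pose r : R := 2^-1 `^ s.
    have r0 : 0 <= r by exact: powR_ge0.
    have rlt : r < 1.
      have -> : 1 = 1 `^ s :> R by rewrite powR1.
      by apply: gt0_ltr_powR; rewrite ?nnegrE// invf_lt1// ltr1n.
    rewrite -[X in _ --> X]addr0; apply: cvgD => //.
    rewrite (_ : (fun k => _) = (fun k => B * N * r * r ^+ k)).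
      rewrite -[X in _ --> X](mulr0 (B * N * r)); apply: cvgMr.
      by apply: cvg_expr; rewrite ger0_norm.
    by apply/funext => k; rewrite dyadic_powR exprS -/r; ring.
  pose H k x := (mean_pdiff alpha (cell_size k) (J k) f x + (E k)%:E)%E.
  have mmp k : measurable_fun [set: V] (mean_pdiff alpha (cell_size k) (J k) f).
    exact: measurable_mean_pdiff hf.1.
  apply: (tm_ac tmu); apply: (@ae_eq_of_small_integrals _ _ f g H _ _ _ _ _ vanish).
  + by move=> k; apply: emeasurable_funD => //; exact: measurable_cst.
  + by move=> k x; rewrite adde_ge0 ?lee_fin// mean_pdiff_ge0// cell_size_gt0.
  + move=> k x; apply: (@le_trans _ _ (`|f x - A k x|%:E + `|A k x - g x|%:E)%E).
      rewrite -EFinD lee_fin (_ : f x - g x = (f x - A k x) + (A k x - g x)) ?ler_normD//; ring.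
    by apply: leeD; [exact: hdist|rewrite lee_fin].
  + move=> k z; set Q := box z _; have mQ : measurable Q by exact: measurable_box.
    have lamQ : lam Q = 1%E by exact: lebesgue_row_unit_box.
    rewrite ge0_integralD//; last 3 first.
    * by move=> x _; exact: mean_pdiff_ge0 (cell_size_gt0 k).
    * exact: measurable_funTS.
    * by move=> x _; rewrite lee_fin.
    rewrite EFinD; apply: leeD; first exact: (integral_mean_pdiff_le tmu p1 z hf (cell_size_gt0 k) (hBk k)).
    have IE : (\int[lam]_(x in Q) (E k)%:E = (E k)%:E * lam Q)%E by exact: integral_cst.
    by rewrite IE lamQ mule1.
- move=> x; have h0 := hE 0 x.
  have hA := normr_mean_smooth_sum_le tmu p1 hCs x hf LfN (cell_size_gt0 0) (Jt 0%N).
  have : `|g x| <= `|A 0%N x| + `|A 0%N x - g x|.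
    by rewrite -[X in `|X| <= _](subKr (A 0%N x)); exact: ler_normB.
  move=> /le_trans; apply; apply: (le_trans (lerD hA h0)).
  rewrite /E expr0 mulr1 /C !mulrDl mul1r.
  rewrite (_ : D * N / (1 - rho) = D / (1 - rho) * N); last by rewrite mulrAC.
  by rewrite !mulrA lerDl.
Qed.

End embedding.

(** * Sufficiency and the equivalence *)

Section sufficiency.
Context {R : realType} (d : nat).
Local Notation V := 'rV[R]_d.
Variables (mu : {measure set V -> \bar R}) (G : set V) (alpha p b : R) (q : \bar R).
Hypotheses (tmu : translation_measure mu G) (d0 : (0 < d)%N) (alpha0 : 0 < alpha) (p1 : 1 < p).
Hypotheses (q0 : (0 < q)%E) (hb : (q^-1 < b%:E)%E) (da : d%:R / p < alpha).
Local Notation X := [set F : V -> R | invariant_by G F].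
Local Notation Lip := (Lip_space mu X alpha b p q).

(** [continuous_representative] applied to the difference of two functions gives
    the continuity of the inclusion, in whichever of the two targets. *)
Lemma embeds_of_sup_bound (B : fun_space) :
  (forall f, carrier Lip f -> exists2 g, carrier B g & f = g %[ae mu]) ->
  (forall f g C, carrier B f -> carrier B g ->
    {ae mu, forall x, `|(f \- g) x| <= C} -> (fnorm B (f \- g)%R <= C%:E)%E) ->
  embeds mu Lip B.
Proof.
move=> ex normB; split => // f g [If Lf lf] Bg fg e e0.
have [C C0 hC] := continuous_representative tmu d0 alpha0 p1 q0 hb da.
exists (e / 2 / C); first by rewrite !divr_gt0.
move=> f' g' [If' Lf' lf'] Bg' fg' hr.
have hsub : periodic_mfun G (f' \- f).
  by apply: periodic_mfunB; split => //; [exact: Lfun_measurable Lf'|exact: Lfun_measurable Lf].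
have [h [_ _ hae hbound]] := hC _ _ hsub (ltW hr).
apply: (@le_lt_trans _ _ (e / 2)%:E); last by rewrite lte_fin; lra.
apply: normB => //.
apply: filterS3 fg fg' hae => x /= <- // <- // fh.
rewrite fh; apply: (le_trans (hbound x)).
by rewrite mulrC divfK// gt_eqF.
Qed.

Lemma lip_representative f : carrier Lip f -> exists g C, [/\ continuous g, invariant_by G g,
  {ae mu, forall x, f x = g x} & forall x, `|g x| <= C].
Proof.
move=> [If Lf lf].
have [C C0 hC] := continuous_representative tmu d0 alpha0 p1 q0 hb da.
have lfR : lip_norm mu alpha b p q f = (fine (lip_norm mu alpha b p q f))%:E.
  by rewrite fineK// ge0_fin_numE// adde_ge0 ?Lnorm_ge0// lip_seminorm_ge0.
have hf : periodic_mfun G f by split => //; exact: Lfun_measurable Lf.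
have lfN : (lip_norm mu alpha b p q f <= (fine (lip_norm mu alpha b p q f))%:E)%E.
  by rewrite -lfR.
have [g [cg Ig fg gC]] := hC f _ hf lfN.
by exists g, (C * fine (lip_norm mu alpha b p q f)).
Qed.

Lemma embeds_Linfty : embeds mu Lip (Linfty_space mu X).
Proof.
apply: embeds_of_sup_bound => [f lf|f g C _ _]; last by move=> h; apply/(Lnorm_infty_le tmu).
have [g [C [cg Ig fg gC]]] := lip_representative lf; have [If Lf _] := lf.
exists f => //; last exact: filterE.
split => //; apply: mem_Lfun; first exact: Lfun_measurable Lf.
apply: (@le_lt_trans _ _ C%:E); last exact: ltry.
by apply/(Lnorm_infty_le tmu); apply: filterS fg => x ->.
Qed.

Lemma embeds_C : embeds mu Lip (C_space X).
Proof.
apply: embeds_of_sup_bound => [f lf|f g C [If cf _] [Ig cg _] h].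
  have [g [C [cg Ig fg gC]]] := lip_representative lf.
  exists g; last by apply: filterS fg => x fx _.
  split => //; apply: (@le_lt_trans _ _ C%:E); last exact: ltry.
  by apply: ge_ereal_sup => _ [x _ <-]; rewrite lee_fin.
apply: ge_ereal_sup => _ [x _ <-]; rewrite lee_fin.
apply: (continuous_ae_le tmu _ _ h).
  by move=> y; apply: continuousB; [exact: cf|exact: cg].
by move=> z Gz y /=; rewrite (If z Gz) (Ig z Gz).
Qed.

End sufficiency.

Theorem theorem10p2 (R : realType) (d : nat) (alpha p b : R) (q : \bar R)
    (hd : (0 < d)%N) (halpha : 0 < alpha) (hp : 1 < p)
    (hq : (0 < q)%E) (hb : (q^-1 < b%:E)%E) :
  let muR : {measure set 'rV[R]_d -> \bar R} := lebesgue_row d in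
  let muT : {measure set 'rV[R]_d -> \bar R} := lebesgue_torus d in
  let LipR := Lip_space muR setT alpha b p q in
  let LipT := Lip_space muT (@torus_periodic R d) alpha b p q in
  [/\ embeds muR LipR (Linfty_space muR setT) <-> d%:R / p < alpha,
      embeds muR LipR (C_space setT) <-> d%:R / p < alpha,
      embeds muT LipT (Linfty_space muT (@torus_periodic R d)) <->
        d%:R / p < alpha
    & embeds muT LipT (C_space (@torus_periodic R d)) <-> d%:R / p < alpha].
Proof.
move=> muR muT LipR LipT; rewrite /LipR /LipT.
have hp' : 1 <= p by exact: ltW.
have tR : translation_measure muR set0 := translation_measure_row d.
have tT : translation_measure muT (@torus_periods R d) := translation_measure_torus d.
have sqR := @square_like_sqr R; have sqT := @square_like_torus R.
have pR : forall g : 'rV[R]_d, set0 g -> forall (x : 'rV[R]_d) l,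
  (x + g) ord0 l ^+ 2 = x ord0 l ^+ 2 by [].
have pT := @torus_square_periodic R d.
have vR := @bump_volume_row R d; have vT := @bump_volume_torus R d.
rewrite -(@invariant_by_set0 R d R) -(@invariant_by_torus R d); split; split => [emb|da].
- exact: (embeds_Linfty_lt tR halpha hp' hq hb sqR pR vR emb).
- exact: (embeds_Linfty tR).
- exact: (embeds_C_lt tR halpha hp' hq hb sqR pR vR emb).
- exact: (embeds_C tR).
- exact: (embeds_Linfty_lt tT halpha hp' hq hb sqT pT vT emb).
- exact: (embeds_Linfty tT).
- exact: (embeds_C_lt tT halpha hp' hq hb sqT pT vT emb).
- exact: (embeds_C tT).
Qed.
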